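(* Make $W_{a}$ into a $\mathbb{Z}/2[[X,Y]]$-module with $X$ acting by $T_{3}$ and $Y$ acting by $T_{7}$. Then the action of $\mathbb{Z}/2[[X,Y]]$ on $W_{a}$ is faithful.
   Context: All power series are in $\mathbb{Z}/2[[x]]$. Let $F=\sum_{n\ \mathrm{odd},\,n>0}x^{n^{2}}$, $G=F(x^{5})$, and $D=\sum_{n>0,\ (n,10)=1}x^{n^{2}}$. For $k>0$ with $(k,10)=1$ define $D_{k}$ by $D_{1}=D$, $D_{3}=D^{8}/G$, $D_{7}=D^{2}G$, $D_{9}=D^{4}G$ and $D_{k+10}=G^{2}D_{k}$. $W_{a}$ is the $\mathbb{Z}/2$-span of the $D_{k}$ with $k\equiv 1,3,7,9 \pmod{20}$. For an odd prime $p$, $T_{p}(\sum c_{n}x^{n})=\sum c_{pn}x^{n}+\sum c_{n}x^{pn}$. The commuting operators $T_{3},T_{7}$ map $W_{a}$ into itself and each expresses $T_{3}(D_{k})$, $T_{7}(D_{k})$ as sums of $D_{i}$ with $i<k$, so every element of $W_{a}$ is killed by all monomials $X^{i}Y^{j}$ with $i+j$ large; hence the $\mathbb{Z}/2[X,Y]$-module structure extends to a $\mathbb{Z}/2[[X,Y]]$-module structure. *)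

(* Defs.v *)
(* Power series over Z/2 are modelled as
   coefficient functions nat -> bool, with addition = xor (addb) and
   multiplication = andb. *)
From Stdlib Require Import ClassicalEpsilon.
From mathcomp Require Import all_boot.
Set Implicit Arguments. Unset Strict Implicit. Unset Printing Implicit Defensive.

(* Z/2[[x]] : f n is the coefficient of x^n *)
Definition ps := nat -> bool.

Definition pzero : ps := fun _ => false.
Definition pone : ps := fun n => n == 0.
Definition padd (f g : ps) : ps := fun n => addb (f n) (g n).
Definition pmul (f g : ps) : ps :=
  fun n => \big[addb/false]_(i < n.+1) (f i && g (n - i)).
Definition ppow (f : ps) (k : nat) : ps := iter k (pmul f) pone.

(* exact division in Z/2[[x]]: the h with h * g = f (unique when g <> 0,
   Z/2[[x]] being an integral domain; exists in the case used below) *)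
Definition pdiv (f g : ps) : ps :=
  epsilon (inhabits pzero) (fun h => pmul h g = f).

Definition F : ps := fun N => [exists m : 'I_N.+1, odd m && (m * m == N)].
Definition G : ps := fun N => (5 %| N) && F (N %/ 5).
Definition D : ps :=
  fun N => [exists m : 'I_N.+1, [&& 0 < m, coprime m 10 & m * m == N]].

Definition Dbase (r : nat) : ps :=
  if r == 1 then D
  else if r == 3 then pdiv (ppow D 8) G
  else if r == 7 then pmul (ppow D 2) G
  else if r == 9 then pmul (ppow D 4) G
  else pzero.

(* D_k for k > 0, (k,10) = 1, via D_{k+10} = G^2 D_k *)
Definition Dk (k : nat) : ps := pmul (ppow G (2 * (k %/ 10))) (Dbase (k %% 10)).

Definition idx_a (k : nat) : bool := (k %% 20) \in [:: 1; 3; 7; 9].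
Definition in_Wa (w : ps) : Prop :=
  exists s : seq nat, all idx_a s /\ w = \big[padd/pzero]_(k <- s) Dk k.

Definition Tp (p : nat) (f : ps) : ps :=
  fun n => addb (f (p * n)) ((p %| n) && f (n %/ p)).

Definition T3 := Tp 3.
Definition T7 := Tp 7.

Definition mono_act (i j : nat) (w : ps) : ps := iter i T3 (iter j T7 w).

(* Z/2[[X,Y]] : P i j is the coefficient of X^i Y^j *)
Definition ps2 := nat -> nat -> bool.

(* a bound N with X^i Y^j w = 0 whenever i + j >= N (exists for w in W_a) *)
Definition nil_bound (w : ps) : nat :=
  epsilon (inhabits 0%N)
    (fun N => forall i j, N <= i + j -> mono_act i j w = pzero).

Definition act (P : ps2) (w : ps) : ps :=
  fun n => let N := nil_bound w in
    \big[addb/false]_(i < N) \big[addb/false]_(j < N)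
       [&& P i j, i + j < N & mono_act i j w n].

(* Main.v *)
From HB Require Import structures.
From Stdlib Require Import FunctionalExtensionality ClassicalEpsilon Classical.
From Stdlib Require Import Ring PArith NArith.
Require Import Defs.
From mathcomp Require Import all_boot.
From mathcomp Require ssralg zmodp poly.
From mathcomp Require Import zify.
Set Implicit Arguments. Unset Strict Implicit. Unset Printing Implicit Defensive.

(* Write g for G and t = g^4, so that W_a has the basis t^m D_r with r in {1,3,7,9}, encoded as
   [basis (4 m + rho)].  The modular equations of F for 3 and 7 give
     T_3(t^4 f) = t^4 T_3 f + t T_3(t f),
     T_7(t^8 f) = t^8 T_7 f + t T_7(t f) + t^2 T_7(t^2 f),
   and the same identities with t replaced by t^(2^s); together with finitely many explicit images
   they show that T_3 and T_7 lower the height, a weight in which bit e of the code counts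
   2^(e/2).  Let p = T_3 T_7, and let sp(n) be the binary digits of n read in base 4.  Modulo
   smaller heights the commutator of p with t^sp(n) is t^sp(n-1).  The series
   theta = t^(2 * 4^n) D counts the representations by 10 * 4^(n+1) b^2 + a^2 (b odd, a prime to
   10), is killed by T_3, and T_7^H theta has x-coefficient 1 for H = 2^(n+1), because 7^H has
   exactly one primitive representation by this form.  Hence v = t^sp(d) theta has height at most
   2d + H, and X^(d+e) Y^(d+H-e) v = X^e Y^(H-e) theta vanishes for 0 < e <= H but not for e = 0.
   If d is the degree of the lowest form of a nonzero P, multiplying P by a suitable monomial and
   letting it act on v isolates a single coefficient of that form. *)

(* The weights of the height are dictated by the recurrences: that of T_3 trades bit e of the code
   for bit e-2 used twice, so the weight doubles every two bits; that of T_7 trades it for bits e-3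
   and e-2, each used twice. Since T_3 and T_7 are controlled only up to smaller heights, a monomial
   can be evaluated only where every error term has height below the degree still to be applied. The
   factor t^sp(d) is made for this: sp(d) has height d, so t^sp(d) adds at most 2d, the degree of
   p^d, and p^d brings v back to theta modulo elements that the remaining H operators kill. The
   operator p cannot be treated alone, because commuting it with a power of t through the T_7
   recurrence leaves powers of t between T_3 and T_7; hence the operators T_3 t^l T_7 are bounded
   for all l at once. The seed theta separates X from Y: a monomial of degree H that contains X
   vanishes on theta, so in the lowest form of P the term with the least power of X is selected. *)
Declare Scope ps_scope.
Delimit Scope ps_scope with ps.
Bind Scope ps_scope with ps.
Infix "+" := padd : ps_scope.
Infix "*" := pmul : ps_scope.
Notation "f ^ n" := (ppow f n) : ps_scope.
Notation "0" := pzero : ps_scope.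
Notation "1" := pone : ps_scope.

Arguments padd : simpl never.
Arguments pmul : simpl never.
Arguments ppow : simpl never.

(** * The ring of power series over Z/2 *)

Section TruncatedPolynomials.
Import ssralg zmodp poly GRing.Theory.
Local Open Scope ring_scope.

Definition F2_of (b : bool) : 'F_2 := if b then 1 else 0.

Lemma F2_of_inj : injective F2_of.
Proof. by case; case. Qed.

Lemma F2_ofM a b : F2_of (a && b) = F2_of a * F2_of b.
Proof. by case: a b => [] []; rewrite /= ?mulr0 ?mul0r ?mulr1. Qed.

Lemma F2_of_sum I (r : seq I) (Q : pred I) (E : I -> bool) :
  F2_of (\big[addb/false]_(i <- r | Q i) E i) = \sum_(i <- r | Q i) F2_of (E i).
Proof.
by apply: (big_morph F2_of) => //; case; case; apply/val_inj.
Qed.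

(** Coefficient n of a product involves only coefficients up to n, so commutativity and
    associativity are transported from truncated polynomials over F_2. *)
Definition trunc (N : nat) (f : ps) : {poly 'F_2} := \poly_(i < N) F2_of (f i).

Lemma coef_trunc N f n : (n < N)%N -> (trunc N f)`_n = F2_of (f n).
Proof. by rewrite coef_poly => ->. Qed.

Lemma coef_trunc_mul N f g n :
  (n < N)%N -> F2_of (pmul f g n) = (trunc N f * trunc N g)`_n.
Proof.
move=> ltnN; rewrite coefM F2_of_sum; apply: eq_bigr => i _.
rewrite F2_ofM !coef_trunc //; first by apply: leq_ltn_trans ltnN; rewrite leq_subr.
by apply: leq_trans ltnN; rewrite ltn_ord.
Qed.

Lemma coefM_low (p p' q q' : {poly 'F_2}) n :
  (forall i, (i <= n)%N -> p`_i = p'`_i) -> (forall i, (i <= n)%N -> q`_i = q'`_i) ->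
  (p * q)`_n = (p' * q')`_n.
Proof.
move=> pp' qq'; rewrite !coefM; apply: eq_bigr => i _.
by rewrite pp' ?qq' ?leq_subr // -ltnS ltn_ord.
Qed.

Lemma pmulC f g : pmul f g = pmul g f.
Proof.
apply: functional_extensionality => n; apply: F2_of_inj.
by rewrite !(@coef_trunc_mul n.+1) // mulrC.
Qed.

Lemma pmulA f g h : pmul f (pmul g h) = pmul (pmul f g) h.
Proof.
apply: functional_extensionality => n; apply: F2_of_inj.
rewrite !(@coef_trunc_mul n.+1) //.
have E u v i : (i <= n)%N ->
    (trunc n.+1 (pmul u v))`_i = (trunc n.+1 u * trunc n.+1 v)`_i.
  by move=> le_i; rewrite coef_trunc // (@coef_trunc_mul n.+1).
rewrite (coefM_low (p' := trunc n.+1 f) (q' := trunc n.+1 g * trunc n.+1 h)) //;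
  last exact: E.
rewrite mulrA; apply: coefM_low => // i le_i; exact/esym/E.
Qed.

End TruncatedPolynomials.

Lemma paddA f g h : padd f (padd g h) = padd (padd f g) h.
Proof. by apply: functional_extensionality => n; rewrite /padd addbA. Qed.

Lemma paddC f g : padd f g = padd g f.
Proof. by apply: functional_extensionality => n; rewrite /padd addbC. Qed.

Lemma padd0 f : padd pzero f = f.
Proof. by apply: functional_extensionality => n. Qed.

Lemma paddff f : padd f f = pzero.
Proof. by apply: functional_extensionality => n; rewrite /padd addbb. Qed.

Lemma pmulDl f g h : pmul (padd f g) h = padd (pmul f h) (pmul g h).
Proof.
apply: functional_extensionality => n; rewrite /padd /pmul -big_split /=.
by apply: eq_bigr => i _; rewrite andb_addl.
Qed.

Lemma pmul1 f : pmul pone f = f.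
Proof.
apply: functional_extensionality => n; rewrite /pmul big_ord_recl subn0 big1.
  by rewrite addbF.
by move=> i _; rewrite /pone.
Qed.

Lemma pmul0 f : pmul pzero f = pzero.
Proof. by apply: functional_extensionality => n; rewrite /pmul big1. Qed.

HB.instance Definition _ := Monoid.isComLaw.Build ps pzero padd paddA paddC padd0.

Lemma ps_ring_theory : ring_theory pzero pone padd pmul padd id (@eq ps).
Proof.
split=> *; rewrite ?padd0 ?pmul1 ?paddff ?pmulDl //.
- exact: paddC.
- exact: paddA.
- exact: pmulC.
- exact: pmulA.
Qed.

(** With Z/2 as coefficient ring the [ring] tactic works in characteristic 2 and proves identities
    such as (f + g)^4 = f^4 + g^4. *)
Definition ps_of_bool (b : bool) : ps := if b then pone else pzero.

Lemma ps_of_bool_morph :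
  ring_morph pzero pone padd pmul padd id (@eq ps)
    false true addb andb addb id Bool.eqb ps_of_bool.
Proof.
split=> //.
- by case; case; rewrite /= ?paddff ?padd0 // paddC padd0.
- by case; case; rewrite /= ?paddff ?padd0 // paddC padd0.
- by case; case; rewrite /= ?pmul1 ?pmul0.
- by move=> x y /Bool.eqb_prop ->.
Qed.

Lemma ppowD f m n : (f ^ (m + n) = f ^ m * f ^ n)%ps.
Proof.
by elim: m => [|m IH]; rewrite ?pmul1 // addSn /ppow /= -!/(ppow _ _) IH pmulA.
Qed.

Lemma ps_power_theory : power_theory pone pmul (@eq ps) N.to_nat ppow.
Proof.
split=> f [|p] //=; elim: p => [p IH|p IH|].
- by rewrite Pos2Nat.inj_xI /= -!IH -ppowD /ppow /=; do 2 f_equal; lia.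
- by rewrite Pos2Nat.inj_xO /= -!IH -ppowD; f_equal; lia.
- by rewrite /= /ppow /= pmulC pmul1.
Qed.

Ltac bool_cst t :=
  match t with
  | pzero => constr:(false) | pone => constr:(true)
  | _ => constr:(InitialRing.NotConstant) end.
Ltac nat_pow_cst t :=
  match isnatcst t with
  | true => let n := eval vm_compute in (N.of_nat t) in constr:(n)
  | _ => constr:(InitialRing.NotConstant) end.

Add Ring ps_ring : ps_ring_theory
  (morphism ps_of_bool_morph, constants [bool_cst], power_tac ps_power_theory [nat_pow_cst]).

(** * Counting representations by binary forms *)

(** Points moved by [f] pair off, leaving the fixed points. *)
Lemma odd_size_involution (T : eqType) (f : T -> T) (s : seq T) :
  uniq s -> {in s, forall x, f x \in s} -> {in s, forall x, f (f x) = x} ->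
  odd (size s) = odd (count (fun x => f x == x) s).
Proof.
have [n] := ubnP (size s); elim: n s => // n IH [|x s] //= /ltnSE le_s /andP[xs us] fs ff.
have f_inj : {in x :: s &, injective f} by move=> y z ys zs e; rewrite -(ff y ys) e ff.
have [fx|fx] := eqVneq (f x) x.
  rewrite /= IH //.
    by move=> y ys; have := fs y; rewrite !inE ys orbT => /(_ isT)/predU1P[] // e;
       move: xs; rewrite -(f_inj y x) ?ys ?inE ?ys ?orbT ?eqxx // e fx.
  by move=> y ys; apply: ff; rewrite inE ys orbT.
have fxs : f x \in s by have := fs x; rewrite !inE eqxx (negbTE fx) => /(_ isT).
have /permP ps := perm_to_rem fxs; rewrite add0n ps /= ff ?inE ?eqxx //.
rewrite eq_sym (negbTE fx) add0n (perm_size (perm_to_rem fxs)) /= negbK.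
have mem_r y : y \in rem (f x) s = (y != f x) && (y \in s) by rewrite mem_rem_uniq ?inE.
apply: IH; first by rewrite size_rem //; case: (s) fxs le_s => //= *; lia.
- exact: rem_uniq.
- move=> y; rewrite !mem_r => /andP[yfx ys].
  have := fs y; rewrite !inE ys orbT => /(_ isT) /predU1P[e|->].
    by case/eqP: yfx; rewrite -e ff // inE ys orbT.
  rewrite andbT; apply: contraNneq xs => e.
  by rewrite -(f_inj y x) ?inE ?ys ?eqxx ?orbT.
- by move=> y; rewrite mem_r => /andP[_ ys]; rewrite ff // inE ys orbT.
Qed.

Definition pairs (K : nat) : seq (nat * nat) :=
  [seq (a, b) | a <- iota 0 K, b <- iota 0 K].

Lemma mem_pairs K x : (x \in pairs K) = (x.1 < K) && (x.2 < K).
Proof.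
case: x => a b; apply/allpairsP/idP => [[[c d] [/= hc hd [-> ->]]]|/= /andP[ha hb]].
  by move: hc hd; rewrite !mem_iota /= !add0n => -> ->.
by exists (a, b); rewrite !mem_iota !add0n.
Qed.

Lemma uniq_pairs K : uniq (pairs K).
Proof. by apply: allpairs_uniq; rewrite ?iota_uniq // => -[a b] [c d]. Qed.

(** Representations are counted modulo 2 in a finite box; any box containing all solutions gives the
    same parity, hence the bounds assumed below. *)
Definition par (K : nat) (P : pred (nat * nat)) : bool := odd (count P (pairs K)).

Lemma par_involution K (P : pred (nat * nat)) f :
    (forall x, P x -> [/\ x.1 < K & x.2 < K]) -> (forall x, P x -> P (f x)) ->
    (forall x, P x -> f (f x) = x) ->
  par K P = par K (fun x => P x && (f x == x)).
Proof.
move=> bd Pf ff; rewrite /par -size_filter (@odd_size_involution _ f).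
- by rewrite count_filter; congr odd; apply: eq_count => x /=; rewrite andbC.
- by rewrite filter_uniq ?uniq_pairs.
- move=> x; rewrite !mem_filter => /andP[Px _]; rewrite (Pf _ Px) mem_pairs /=.
  by apply/andP; apply: bd; apply: Pf.
- by move=> x; rewrite mem_filter => /andP[/ff].
Qed.

Lemma par_bij K (P Q : pred (nat * nat)) f g :
    (forall x, P x -> [/\ x.1 < K & x.2 < K]) -> (forall x, Q x -> [/\ x.1 < K & x.2 < K]) ->
    (forall x, P x -> Q (f x) /\ g (f x) = x) ->
    (forall x, Q x -> P (g x) /\ f (g x) = x) ->
  par K P = par K Q.
Proof.
move=> bP bQ PQ QP; rewrite /par -!size_filter -(size_map f); congr odd.
apply: perm_size; apply: uniq_perm.
- rewrite map_inj_in_uniq ?filter_uniq ?uniq_pairs // => x y.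
  rewrite !mem_filter => /andP[/PQ[_ gx] _] /andP[/PQ[_ gy] _] e.
  by rewrite -gx -gy e.
- by rewrite filter_uniq ?uniq_pairs.
move=> y; rewrite mem_filter; apply/mapP/andP => [[x]|[Qy _]].
  by rewrite mem_filter => /andP[/PQ[Qx _] _ ->]; split=> //; rewrite mem_pairs; apply/andP; apply: bQ.
by have [Pg e] := QP _ Qy; exists (g y) => //; rewrite mem_filter Pg mem_pairs /=; apply/andP; apply: bP.
Qed.

(** The sum of x^(c m^2) over the m in [A]. For c > 0 distinct m give distinct exponents, so a
    coefficient is an existence statement. *)
Definition theta (A : pred nat) (c : nat) : ps :=
  fun N => [exists m : 'I_N.+1, A m && (c * (m * m) == N)].

Lemma sq_inj a b : a * a = b * b -> a = b.
Proof. by move=> e; apply/eqP; rewrite -eqn_sqr -!mulnn e. Qed.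

Lemma xor_single (r : seq nat) (P : pred nat) m :
  uniq r -> m \in r -> (forall i, i \in r -> P i -> i = m) ->
  \big[addb/false]_(i <- r) P i = P m.
Proof.
move=> ur mr Pm; rewrite (big_rem m) //= big1_seq ?addbF // => i /andP[_ ir].
apply: contraTF ir => Pi; rewrite mem_rem_uniq ?inE //.
by apply/negP => /andP[im /Pm e]; rewrite e ?eqxx in im.
Qed.

Lemma xor_count (T : Type) (r : seq T) (P : pred T) :
  \big[addb/false]_(i <- r) P i = odd (count P r).
Proof. by elim: r => [|x r IH]; rewrite ?big_nil // big_cons IH /= oddD oddb. Qed.

Lemma thetaE A c N K : 0 < c -> N < K ->
  theta A c N = \big[addb/false]_(a <- iota 0 K) (A a && (c * (a * a) == N)).
Proof.
move=> c0 NK; apply/existsP/idP => [[m /andP[Am e]]|].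
  rewrite (@xor_single _ _ m) ?iota_uniq ?Am ?e // ?mem_iota.
    by rewrite add0n (leq_trans (ltn_ord m)).
  move=> i _ /andP[_ /eqP ei]; apply: sq_inj; apply/eqP.
  by rewrite -(eqn_pmul2l c0) ei (eqP e).
rewrite xor_count => /odd_gt0; rewrite -has_count => /hasP[a _ /andP[Aa e]].
have aN : a < N.+1 by rewrite ltnS -(eqP e); nia.
by exists (Ordinal aN); rewrite /= Aa.
Qed.

(** Turns an identity between products of theta series into a parity count of representations by c
    a^2 + d b^2. *)
Lemma theta_mul A B c d N K : 0 < c -> 0 < d -> N < K ->
  pmul (theta A c) (theta B d) N =
  par K (fun x => [&& A x.1, B x.2 & c * (x.1 * x.1) + d * (x.2 * x.2) == N]).
Proof.
move=> c0 d0 NK; rewrite /par -xor_count /pairs big_allpairs_dep /=.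
rewrite /pmul -(big_mkord xpredT (fun i => theta A c i && theta B d (N - i))).
pose h a b i := [&& A a, B b, c * (a * a) == i & d * (b * b) == N - i].
transitivity (\big[addb/false]_(0 <= i < N.+1)
   \big[addb/false]_(a <- iota 0 K) \big[addb/false]_(b <- iota 0 K) h a b i).
  apply: eq_big_nat => i /andP[_ iN].
  rewrite (@thetaE A c i K) // ?(leq_trans iN) // (@thetaE B d _ K) //; last by lia.
  rewrite big_distrlr /=; apply: eq_bigr => a _; apply: eq_bigr => b _.
  by rewrite /h; case: (A a) (B b) (_ == _) => [] [] [].
rewrite exchange_big; apply: eq_bigr => a _; rewrite exchange_big; apply: eq_bigr => b _ /=.
rewrite /h; case: (A a); last by rewrite big1.
case: (B b); last by rewrite big1.
have [e|ne] /= := eqVneq; last first.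
  rewrite big_seq big1 // => i; rewrite mem_index_iota => /andP[_ iN].
  by apply: contraNF ne => /andP[/eqP ei /eqP eb]; apply/eqP; lia.
rewrite (@xor_single _ _ (c * (a * a))) ?iota_uniq //.
- by rewrite eqxx -e addKn eqxx.
- by rewrite mem_index_iota; lia.
- by move=> i _ /andP[/eqP].
Qed.

(** |x - y|: representations have nonnegative entries, so products in a quadratic field are taken up
    to the sign of each coordinate. *)
Definition dist (x y : nat) : nat := (x - y) + (y - x).

Lemma dist_sq x y : dist x y * dist x y + 2 * (x * y) = x * x + y * y.
Proof. by rewrite /dist; case: (leqP x y) => h; [have -> : x - y = 0 by lia|have -> : y - x = 0 by lia]; nia. Qed.

Definition cop10 (m : nat) : bool := (0 < m) && coprime m 10.

Lemma cop10E m : cop10 m = odd m && (m %% 5 != 0).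
Proof.
rewrite /cop10 (coprimeMr m 2 5) coprimen2 [coprime m 5]coprime_sym prime_coprime //.
by case: m => [|m].
Qed.

Lemma sq_mod16 a : a * a %% 16 = (a %% 8) * (a %% 8) %% 16.
Proof.
have -> : a * a = (4 * (a %/ 8) * (a %/ 8) + (a %/ 8) * (a %% 8)) * 16 + (a %% 8) * (a %% 8).
  by rewrite {1 2}(divn_eq a 8); lia.
by rewrite modnMDl.
Qed.

Lemma odd_sq_mod16 a : odd a ->
  [\/ a %% 8 = 1 /\ a * a %% 16 = 1, a %% 8 = 3 /\ a * a %% 16 = 9,
      a %% 8 = 5 /\ a * a %% 16 = 9 | a %% 8 = 7 /\ a * a %% 16 = 1].
Proof.
move=> oa; rewrite sq_mod16.
have : a %% 8 = 1 \/ a %% 8 = 3 \/ a %% 8 = 5 \/ a %% 8 = 7 by lia.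
case=> [->|[->|[->|->]]].
- exact: Or41.
- exact: Or42.
- exact: Or43.
- exact: Or44.
Qed.

Lemma form_mod16 p q a b :
  (p * (a * a) + q * (b * b)) %% 16 = (p * (a * a %% 16) + q * (b * b %% 16)) %% 16.
Proof. by rewrite -modnDm -(modnMmr p) -(modnMmr q) modnDm. Qed.

Ltac pair_lia := first [lia | move=> *; case: eqP => ?; congr pair; lia].

(* Multiplication by an element of norm 1 in the quadratic field of the form, with the sign making
   the result integral: an involution on the representations of N = 8 mod 16 by 5a^2+3b^2,
   by 15a^2+b^2 and by a^2+7b^2. *)
Definition involution5_3 (x : nat * nat) : nat * nat :=
  let: (a, b) := x in
  if (a + b) %% 4 == 0 then (dist a (3 * b) %/ 4, (5 * a + b) %/ 4)
  else ((a + 3 * b) %/ 4, dist (5 * a) b %/ 4).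
Definition involution15_1 (x : nat * nat) : nat * nat :=
  let: (a, b) := x in
  if (a + b) %% 4 == 0 then ((a + b) %/ 4, dist (15 * a) b %/ 4)
  else (dist a b %/ 4, (15 * a + b) %/ 4).
Definition involution1_7 (x : nat * nat) : nat * nat :=
  let: (a, b) := x in
  if (a + b) %% 4 == 0 then ((3 * a + 7 * b) %/ 4, dist a (3 * b) %/ 4)
  else (dist (3 * a) (7 * b) %/ 4, (a + 3 * b) %/ 4).

(** The multiplier is (1 + sqrt(-15))/4 or its conjugate, applied to 5a + b sqrt(-15). The
    congruence modulo 16 forces a = b or a = -b modulo 8, and the matching sign makes both new
    entries odd integers. *)
Lemma involution5_3P a b :
  odd a -> odd b -> b %% 5 != 0 -> (5 * (a * a) + 3 * (b * b)) %% 16 = 8 ->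
  let: (a1, b1) := involution5_3 (a, b) in
  [/\ odd a1, odd b1, b1 %% 5 != 0, 5 * (a1 * a1) + 3 * (b1 * b1) = 5 * (a * a) + 3 * (b * b)
    & involution5_3 (a1, b1) = (a, b)].
Proof.
move=> oa ob b5 N8; have a0 : 0 < a by case: (a) oa.
have h8 : (a + b) %% 8 = 0 \/ a %% 8 = b %% 8.
  move: N8; rewrite form_mod16.
  by case: (odd_sq_mod16 oa) => -[ra ->]; case: (odd_sq_mod16 ob) => -[rb ->] //= _;
    first [by left; rewrite -modnDm ra rb | by right; rewrite ra rb].
move: {N8} h8; rewrite /involution5_3 => -[] h8.
- have -> : ((a + b) %% 4 == 0) = true by lia.
  set a1 := _ %/ 4; set b1 := _ %/ 4.
  have ea : 4 * a1 = dist a (3 * b) by rewrite /a1 /dist; lia.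
  have sa : (4 * a1) * (4 * a1) + 2 * (a * (3 * b)) = a * a + (3 * b) * (3 * b) by rewrite ea dist_sq.
  have eb : 4 * b1 = 5 * a + b by rewrite /b1; lia.
  have sb : (4 * b1) * (4 * b1) = (5 * a + b) * (5 * a + b) by rewrite eb.
  have eN : 5 * (a1 * a1) + 3 * (b1 * b1) = 5 * (a * a) + 3 * (b * b).
    by move: {ea eb h8} sa sb; lia.
  move: {sa sb} eN ea eb; rewrite /dist; clearbody a1 b1 => eN ea eb.
  by split=> //; move: {eN} h8 oa ob b5 ea eb; pair_lia.
- have -> : ((a + b) %% 4 == 0) = false by lia.
  set a1 := _ %/ 4; set b1 := _ %/ 4.
  have ea : 4 * a1 = a + 3 * b by rewrite /a1; lia.
  have sa : (4 * a1) * (4 * a1) = (a + 3 * b) * (a + 3 * b) by rewrite ea.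
  have eb : 4 * b1 = dist (5 * a) b by rewrite /b1 /dist; lia.
  have sb : (4 * b1) * (4 * b1) + 2 * ((5 * a) * b) = (5 * a) * (5 * a) + b * b by rewrite eb dist_sq.
  have eN : 5 * (a1 * a1) + 3 * (b1 * b1) = 5 * (a * a) + 3 * (b * b).
    by move: {ea eb h8} sa sb; lia.
  move: {sa sb} eN ea eb; rewrite /dist; clearbody a1 b1 => eN ea eb.
  by split=> //; move: {eN} h8 oa ob b5 ea eb; pair_lia.
Qed.

(** Same multiplier, applied to b + a sqrt(-15); here the congruence forces a + b or a - b to be 4
    modulo 8. *)
Lemma involution15_1P a b :
  odd a -> odd b -> b %% 5 != 0 -> (15 * (a * a) + 1 * (b * b)) %% 16 = 8 ->
  let: (a1, b1) := involution15_1 (a, b) in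
  [/\ odd a1, odd b1, b1 %% 5 != 0, 15 * (a1 * a1) + 1 * (b1 * b1) = 15 * (a * a) + 1 * (b * b)
    & involution15_1 (a1, b1) = (a, b)].
Proof.
move=> oa ob b5 N8; have a0 : 0 < a by case: (a) oa.
have h8 : (a + b) %% 8 = 4 \/ a %% 8 = (b + 4) %% 8.
  move: N8; rewrite form_mod16.
  by case: (odd_sq_mod16 oa) => -[ra ->]; case: (odd_sq_mod16 ob) => -[rb ->] //= _;
    first [by left; rewrite -modnDm ra rb | by right; rewrite ra -modnDml rb].
move: {N8} h8; rewrite /involution15_1 => -[] h8.
- have -> : ((a + b) %% 4 == 0) = true by lia.
  set a1 := _ %/ 4; set b1 := _ %/ 4.
  have ea : 4 * a1 = a + b by rewrite /a1; lia.
  have sa : (4 * a1) * (4 * a1) = (a + b) * (a + b) by rewrite ea.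
  have eb : 4 * b1 = dist (15 * a) b by rewrite /b1 /dist; lia.
  have sb : (4 * b1) * (4 * b1) + 2 * ((15 * a) * b) = (15 * a) * (15 * a) + b * b by rewrite eb dist_sq.
  have eN : 15 * (a1 * a1) + 1 * (b1 * b1) = 15 * (a * a) + 1 * (b * b).
    by move: {ea eb h8} sa sb; lia.
  move: {sa sb} eN ea eb; rewrite /dist; clearbody a1 b1 => eN ea eb.
  by split=> //; move: {eN} h8 oa ob b5 ea eb; pair_lia.
- have -> : ((a + b) %% 4 == 0) = false by lia.
  set a1 := _ %/ 4; set b1 := _ %/ 4.
  have ea : 4 * a1 = dist a b by rewrite /a1 /dist; lia.
  have sa : (4 * a1) * (4 * a1) + 2 * (a * b) = a * a + b * b by rewrite ea dist_sq.
  have eb : 4 * b1 = 15 * a + b by rewrite /b1; lia.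
  have sb : (4 * b1) * (4 * b1) = (15 * a + b) * (15 * a + b) by rewrite eb.
  have eN : 15 * (a1 * a1) + 1 * (b1 * b1) = 15 * (a * a) + 1 * (b * b).
    by move: {ea eb h8} sa sb; lia.
  move: {sa sb} eN ea eb; rewrite /dist; clearbody a1 b1 => eN ea eb.
  by split=> //; move: {eN} h8 oa ob b5 ea eb; pair_lia.
Qed.

(** The multiplier is (3 + sqrt(-7))/4 or its conjugate, of norm (9 + 7)/16. *)
Lemma involution1_7P a b :
  odd a -> odd b -> (1 * (a * a) + 7 * (b * b)) %% 16 = 8 ->
  let: (a1, b1) := involution1_7 (a, b) in
  [/\ odd a1, odd b1, 1 * (a1 * a1) + 7 * (b1 * b1) = 1 * (a * a) + 7 * (b * b)
    & involution1_7 (a1, b1) = (a, b)].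
Proof.
move=> oa ob N8; have a0 : 0 < a by case: (a) oa.
have h8 : (a + b) %% 8 = 0 \/ a %% 8 = b %% 8.
  move: N8; rewrite form_mod16.
  by case: (odd_sq_mod16 oa) => -[ra ->]; case: (odd_sq_mod16 ob) => -[rb ->] //= _;
    first [by left; rewrite -modnDm ra rb | by right; rewrite ra rb].
move: {N8} h8; rewrite /involution1_7 => -[] h8.
- have -> : ((a + b) %% 4 == 0) = true by lia.
  set a1 := _ %/ 4; set b1 := _ %/ 4.
  have ea : 4 * a1 = 3 * a + 7 * b by rewrite /a1; lia.
  have sa : (4 * a1) * (4 * a1) = (3 * a + 7 * b) * (3 * a + 7 * b) by rewrite ea.
  have eb : 4 * b1 = dist a (3 * b) by rewrite /b1 /dist; lia.
  have sb : (4 * b1) * (4 * b1) + 2 * (a * (3 * b)) = a * a + (3 * b) * (3 * b) by rewrite eb dist_sq.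
  have eN : 1 * (a1 * a1) + 7 * (b1 * b1) = 1 * (a * a) + 7 * (b * b).
    by move: {ea eb h8} sa sb; lia.
  move: {sa sb} eN ea eb; rewrite /dist; clearbody a1 b1 => eN ea eb.
  by split=> //; move: {eN} h8 oa ob ea eb; pair_lia.
- have -> : ((a + b) %% 4 == 0) = false by lia.
  set a1 := _ %/ 4; set b1 := _ %/ 4.
  have ea : 4 * a1 = dist (3 * a) (7 * b) by rewrite /a1 /dist; lia.
  have sa : (4 * a1) * (4 * a1) + 2 * ((3 * a) * (7 * b)) = (3 * a) * (3 * a) + (7 * b) * (7 * b) by rewrite ea dist_sq.
  have eb : 4 * b1 = a + 3 * b by rewrite /b1; lia.
  have sb : (4 * b1) * (4 * b1) = (a + 3 * b) * (a + 3 * b) by rewrite eb.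
  have eN : 1 * (a1 * a1) + 7 * (b1 * b1) = 1 * (a * a) + 7 * (b * b).
    by move: {ea eb h8} sa sb; lia.
  move: {sa sb} eN ea eb; rewrite /dist; clearbody a1 b1 => eN ea eb.
  by split=> //; move: {eN} h8 oa ob ea eb; pair_lia.
Qed.

(* For 16 | N the representations by 5a^2+3b^2, 15a^2+b^2, a^2+7b^2 correspond bijectively to those by
   30a^2+2b^2, 10a^2+6b^2, 2a^2+14b^2. *)
Definition half5_3 (x : nat * nat) : nat * nat :=
  let: (a, b) := x in
  if (a + b) %% 4 == 0 then ((a + b) %/ 4, dist (5 * a) (3 * b) %/ 4)
  else (dist a b %/ 4, (5 * a + 3 * b) %/ 4).
Definition half5_3_inv (x : nat * nat) : nat * nat :=
  let: (a, b) := x in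
  if (3 * a + b) %% 4 == 2 then ((3 * a + b) %/ 2, dist (5 * a) b %/ 2)
  else (dist (3 * a) b %/ 2, (5 * a + b) %/ 2).
Definition half15_1 (x : nat * nat) : nat * nat :=
  let: (a, b) := x in
  if (a + b) %% 4 == 0 then (dist (3 * a) b %/ 4, (5 * a + b) %/ 4)
  else ((3 * a + b) %/ 4, dist (5 * a) b %/ 4).
Definition half15_1_inv (x : nat * nat) : nat * nat :=
  let: (a, b) := x in
  if (a + b) %% 4 == 2 then ((a + b) %/ 2, dist (5 * a) (3 * b) %/ 2)
  else (dist a b %/ 2, (5 * a + 3 * b) %/ 2).
Definition half1_7 (x : nat * nat) : nat * nat :=
  let: (a, b) := x in
  if (a + b) %% 4 == 0 then (dist a (7 * b) %/ 4, (a + b) %/ 4)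
  else ((a + 7 * b) %/ 4, dist a b %/ 4).
Definition half1_7_inv (x : nat * nat) : nat * nat :=
  let: (a, b) := x in
  if (a + b) %% 4 == 0 then ((a + 7 * b) %/ 2, dist a b %/ 2)
  else (dist a (7 * b) %/ 2, (a + b) %/ 2).

(** Multiplies 5a + b sqrt(-15) by (5 + sqrt(-15))/20 or its conjugate, of norm 1/10. The primes
    above 2 in Q(sqrt(-15)) are not principal, so dividing by one exchanges the forms 5a^2 + 3b^2
    and 15a^2 + b^2. *)
Lemma half5_3P a b :
  odd a -> odd b -> b %% 5 != 0 -> (5 * (a * a) + 3 * (b * b)) %% 16 = 0 ->
  let: (a1, b1) := half5_3 (a, b) in
  [/\ odd a1, odd b1, b1 %% 5 != 0, 30 * (a1 * a1) + 2 * (b1 * b1) = 5 * (a * a) + 3 * (b * b)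
    & half5_3_inv (a1, b1) = (a, b)].
Proof.
move=> oa ob b5 N0.
have a0 : 0 < a by case: (a) oa.
have h8 : (a + b) %% 8 = 4 \/ a %% 8 = (b + 4) %% 8.
  move: N0; rewrite form_mod16.
  case: (odd_sq_mod16 oa) => -[ra ->]; case: (odd_sq_mod16 ob) => -[rb ->] //= _;
    first [by left; rewrite -modnDm ra rb | by right; rewrite ra -modnDml rb].
move: {N0} h8; rewrite /half5_3 => -[] h8.
- have -> : ((a + b) %% 4 == 0) = true by lia.
  set a1 := _ %/ 4; set b1 := _ %/ 4.
  have ea : 4 * a1 = a + b by rewrite /a1; lia.
  have sa : (4 * a1) * (4 * a1) = (a + b) * (a + b) by rewrite ea.
  have eb : 4 * b1 = dist (5 * a) (3 * b) by rewrite /b1 /dist; lia.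
  have sb : (4 * b1) * (4 * b1) + 2 * ((5 * a) * (3 * b)) = (5 * a) * (5 * a) + (3 * b) * (3 * b) by rewrite eb dist_sq.
  have eN : 30 * (a1 * a1) + 2 * (b1 * b1) = 5 * (a * a) + 3 * (b * b).
    by move: {ea eb h8} sa sb; lia.
  move: {sa sb} eN ea eb; rewrite /half5_3_inv /dist; clearbody a1 b1 => eN ea eb.
  by split=> //; move: {eN} h8 oa ob b5 ea eb; pair_lia.
- have -> : ((a + b) %% 4 == 0) = false by lia.
  set a1 := _ %/ 4; set b1 := _ %/ 4.
  have ea : 4 * a1 = dist a b by rewrite /a1 /dist; lia.
  have sa : (4 * a1) * (4 * a1) + 2 * (a * b) = a * a + b * b by rewrite ea dist_sq.
  have eb : 4 * b1 = 5 * a + 3 * b by rewrite /b1; lia.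
  have sb : (4 * b1) * (4 * b1) = (5 * a + 3 * b) * (5 * a + 3 * b) by rewrite eb.
  have eN : 30 * (a1 * a1) + 2 * (b1 * b1) = 5 * (a * a) + 3 * (b * b).
    by move: {ea eb h8} sa sb; lia.
  move: {sa sb} eN ea eb; rewrite /half5_3_inv /dist; clearbody a1 b1 => eN ea eb.
  by split=> //; move: {eN} h8 oa ob b5 ea eb; pair_lia.
Qed.

Lemma half5_3_invP a b :
  odd a -> odd b -> b %% 5 != 0 -> 
  let: (a1, b1) := half5_3_inv (a, b) in
  [/\ odd a1, odd b1, b1 %% 5 != 0, 5 * (a1 * a1) + 3 * (b1 * b1) = 30 * (a * a) + 2 * (b * b)
    & half5_3 (a1, b1) = (a, b)].
Proof.
move=> oa ob b5.
have a0 : 0 < a by case: (a) oa.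
rewrite /half5_3_inv; have [h8|h8] : ((3 * a + b) %% 4 == 2) = true \/ ((3 * a + b) %% 4 == 2) = false by case: (_ == _); [left|right].
- rewrite h8.
  set a1 := _ %/ 2; set b1 := _ %/ 2.
  have ea : 2 * a1 = 3 * a + b by rewrite /a1; lia.
  have sa : (2 * a1) * (2 * a1) = (3 * a + b) * (3 * a + b) by rewrite ea.
  have eb : 2 * b1 = dist (5 * a) b by rewrite /b1 /dist; lia.
  have sb : (2 * b1) * (2 * b1) + 2 * ((5 * a) * b) = (5 * a) * (5 * a) + b * b by rewrite eb dist_sq.
  have eN : 5 * (a1 * a1) + 3 * (b1 * b1) = 30 * (a * a) + 2 * (b * b).
    by move: {ea eb h8} sa sb; lia.
  move: {sa sb} eN ea eb; rewrite /half5_3 /dist; clearbody a1 b1 => eN ea eb.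
  by split=> //; move: {eN} h8 oa ob b5 ea eb; pair_lia.
- rewrite h8.
  set a1 := _ %/ 2; set b1 := _ %/ 2.
  have ea : 2 * a1 = dist (3 * a) b by rewrite /a1 /dist; lia.
  have sa : (2 * a1) * (2 * a1) + 2 * ((3 * a) * b) = (3 * a) * (3 * a) + b * b by rewrite ea dist_sq.
  have eb : 2 * b1 = 5 * a + b by rewrite /b1; lia.
  have sb : (2 * b1) * (2 * b1) = (5 * a + b) * (5 * a + b) by rewrite eb.
  have eN : 5 * (a1 * a1) + 3 * (b1 * b1) = 30 * (a * a) + 2 * (b * b).
    by move: {ea eb h8} sa sb; lia.
  move: {sa sb} eN ea eb; rewrite /half5_3 /dist; clearbody a1 b1 => eN ea eb.
  by split=> //; move: {eN} h8 oa ob b5 ea eb; pair_lia.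
Qed.

Lemma half15_1P a b :
  odd a -> odd b -> b %% 5 != 0 -> (15 * (a * a) + 1 * (b * b)) %% 16 = 0 ->
  let: (a1, b1) := half15_1 (a, b) in
  [/\ odd a1, odd b1, b1 %% 5 != 0, 10 * (a1 * a1) + 6 * (b1 * b1) = 15 * (a * a) + 1 * (b * b)
    & half15_1_inv (a1, b1) = (a, b)].
Proof.
move=> oa ob b5 N0.
have a0 : 0 < a by case: (a) oa.
have h8 : (a + b) %% 8 = 0 \/ a %% 8 = b %% 8.
  move: N0; rewrite form_mod16.
  case: (odd_sq_mod16 oa) => -[ra ->]; case: (odd_sq_mod16 ob) => -[rb ->] //= _;
    first [by left; rewrite -modnDm ra rb | by right; rewrite ra rb].
move: {N0} h8; rewrite /half15_1 => -[] h8.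
- have -> : ((a + b) %% 4 == 0) = true by lia.
  set a1 := _ %/ 4; set b1 := _ %/ 4.
  have ea : 4 * a1 = dist (3 * a) b by rewrite /a1 /dist; lia.
  have sa : (4 * a1) * (4 * a1) + 2 * ((3 * a) * b) = (3 * a) * (3 * a) + b * b by rewrite ea dist_sq.
  have eb : 4 * b1 = 5 * a + b by rewrite /b1; lia.
  have sb : (4 * b1) * (4 * b1) = (5 * a + b) * (5 * a + b) by rewrite eb.
  have eN : 10 * (a1 * a1) + 6 * (b1 * b1) = 15 * (a * a) + 1 * (b * b).
    by move: {ea eb h8} sa sb; lia.
  move: {sa sb} eN ea eb; rewrite /half15_1_inv /dist; clearbody a1 b1 => eN ea eb.
  by split=> //; move: {eN} h8 oa ob b5 ea eb; pair_lia.
- have -> : ((a + b) %% 4 == 0) = false by lia.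
  set a1 := _ %/ 4; set b1 := _ %/ 4.
  have ea : 4 * a1 = 3 * a + b by rewrite /a1; lia.
  have sa : (4 * a1) * (4 * a1) = (3 * a + b) * (3 * a + b) by rewrite ea.
  have eb : 4 * b1 = dist (5 * a) b by rewrite /b1 /dist; lia.
  have sb : (4 * b1) * (4 * b1) + 2 * ((5 * a) * b) = (5 * a) * (5 * a) + b * b by rewrite eb dist_sq.
  have eN : 10 * (a1 * a1) + 6 * (b1 * b1) = 15 * (a * a) + 1 * (b * b).
    by move: {ea eb h8} sa sb; lia.
  move: {sa sb} eN ea eb; rewrite /half15_1_inv /dist; clearbody a1 b1 => eN ea eb.
  by split=> //; move: {eN} h8 oa ob b5 ea eb; pair_lia.
Qed.

Lemma half15_1_invP a b :
  odd a -> odd b -> b %% 5 != 0 -> 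
  let: (a1, b1) := half15_1_inv (a, b) in
  [/\ odd a1, odd b1, b1 %% 5 != 0, 15 * (a1 * a1) + 1 * (b1 * b1) = 10 * (a * a) + 6 * (b * b)
    & half15_1 (a1, b1) = (a, b)].
Proof.
move=> oa ob b5.
have a0 : 0 < a by case: (a) oa.
rewrite /half15_1_inv; have [h8|h8] : ((a + b) %% 4 == 2) = true \/ ((a + b) %% 4 == 2) = false by case: (_ == _); [left|right].
- rewrite h8.
  set a1 := _ %/ 2; set b1 := _ %/ 2.
  have ea : 2 * a1 = a + b by rewrite /a1; lia.
  have sa : (2 * a1) * (2 * a1) = (a + b) * (a + b) by rewrite ea.
  have eb : 2 * b1 = dist (5 * a) (3 * b) by rewrite /b1 /dist; lia.
  have sb : (2 * b1) * (2 * b1) + 2 * ((5 * a) * (3 * b)) = (5 * a) * (5 * a) + (3 * b) * (3 * b) by rewrite eb dist_sq.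
  have eN : 15 * (a1 * a1) + 1 * (b1 * b1) = 10 * (a * a) + 6 * (b * b).
    by move: {ea eb h8} sa sb; lia.
  move: {sa sb} eN ea eb; rewrite /half15_1 /dist; clearbody a1 b1 => eN ea eb.
  by split=> //; move: {eN} h8 oa ob b5 ea eb; pair_lia.
- rewrite h8.
  set a1 := _ %/ 2; set b1 := _ %/ 2.
  have ea : 2 * a1 = dist a b by rewrite /a1 /dist; lia.
  have sa : (2 * a1) * (2 * a1) + 2 * (a * b) = a * a + b * b by rewrite ea dist_sq.
  have eb : 2 * b1 = 5 * a + 3 * b by rewrite /b1; lia.
  have sb : (2 * b1) * (2 * b1) = (5 * a + 3 * b) * (5 * a + 3 * b) by rewrite eb.
  have eN : 15 * (a1 * a1) + 1 * (b1 * b1) = 10 * (a * a) + 6 * (b * b).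
    by move: {ea eb h8} sa sb; lia.
  move: {sa sb} eN ea eb; rewrite /half15_1 /dist; clearbody a1 b1 => eN ea eb.
  by split=> //; move: {eN} h8 oa ob b5 ea eb; pair_lia.
Qed.

(** Multiplies a + b sqrt(-7) by (1 + sqrt(-7))/4 or its conjugate, of norm 1/2. The primes above 2
    in Q(sqrt(-7)) are principal, so the form only acquires the factor 2. *)
Lemma half1_7P a b :
  odd a -> odd b -> (1 * (a * a) + 7 * (b * b)) %% 16 = 0 ->
  let: (a1, b1) := half1_7 (a, b) in
  [/\ odd a1, odd b1, 2 * (a1 * a1) + 14 * (b1 * b1) = 1 * (a * a) + 7 * (b * b)
    & half1_7_inv (a1, b1) = (a, b)].
Proof.
move=> oa ob N0.
have a0 : 0 < a by case: (a) oa.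
have h8 : (a + b) %% 8 = 4 \/ a %% 8 = (b + 4) %% 8.
  move: N0; rewrite form_mod16.
  case: (odd_sq_mod16 oa) => -[ra ->]; case: (odd_sq_mod16 ob) => -[rb ->] //= _;
    first [by left; rewrite -modnDm ra rb | by right; rewrite ra -modnDml rb].
move: {N0} h8; rewrite /half1_7 => -[] h8.
- have -> : ((a + b) %% 4 == 0) = true by lia.
  set a1 := _ %/ 4; set b1 := _ %/ 4.
  have ea : 4 * a1 = dist a (7 * b) by rewrite /a1 /dist; lia.
  have sa : (4 * a1) * (4 * a1) + 2 * (a * (7 * b)) = a * a + (7 * b) * (7 * b) by rewrite ea dist_sq.
  have eb : 4 * b1 = a + b by rewrite /b1; lia.
  have sb : (4 * b1) * (4 * b1) = (a + b) * (a + b) by rewrite eb.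
  have eN : 2 * (a1 * a1) + 14 * (b1 * b1) = 1 * (a * a) + 7 * (b * b).
    by move: {ea eb h8} sa sb; lia.
  move: {sa sb} eN ea eb; rewrite /half1_7_inv /dist; clearbody a1 b1 => eN ea eb.
  by split=> //; move: {eN} h8 oa ob ea eb; pair_lia.
- have -> : ((a + b) %% 4 == 0) = false by lia.
  set a1 := _ %/ 4; set b1 := _ %/ 4.
  have ea : 4 * a1 = a + 7 * b by rewrite /a1; lia.
  have sa : (4 * a1) * (4 * a1) = (a + 7 * b) * (a + 7 * b) by rewrite ea.
  have eb : 4 * b1 = dist a b by rewrite /b1 /dist; lia.
  have sb : (4 * b1) * (4 * b1) + 2 * (a * b) = a * a + b * b by rewrite eb dist_sq.
  have eN : 2 * (a1 * a1) + 14 * (b1 * b1) = 1 * (a * a) + 7 * (b * b).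
    by move: {ea eb h8} sa sb; lia.
  move: {sa sb} eN ea eb; rewrite /half1_7_inv /dist; clearbody a1 b1 => eN ea eb.
  by split=> //; move: {eN} h8 oa ob ea eb; pair_lia.
Qed.

Lemma half1_7_invP a b :
  odd a -> odd b -> 
  let: (a1, b1) := half1_7_inv (a, b) in
  [/\ odd a1, odd b1, 1 * (a1 * a1) + 7 * (b1 * b1) = 2 * (a * a) + 14 * (b * b)
    & half1_7 (a1, b1) = (a, b)].
Proof.
move=> oa ob.
have a0 : 0 < a by case: (a) oa.
rewrite /half1_7_inv; have [h8|h8] : ((a + b) %% 4 == 0) = true \/ ((a + b) %% 4 == 0) = false by case: (_ == _); [left|right].
- rewrite h8.
  set a1 := _ %/ 2; set b1 := _ %/ 2.
  have ea : 2 * a1 = a + 7 * b by rewrite /a1; lia.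
  have sa : (2 * a1) * (2 * a1) = (a + 7 * b) * (a + 7 * b) by rewrite ea.
  have eb : 2 * b1 = dist a b by rewrite /b1 /dist; lia.
  have sb : (2 * b1) * (2 * b1) + 2 * (a * b) = a * a + b * b by rewrite eb dist_sq.
  have eN : 1 * (a1 * a1) + 7 * (b1 * b1) = 2 * (a * a) + 14 * (b * b).
    by move: {ea eb h8} sa sb; lia.
  move: {sa sb} eN ea eb; rewrite /half1_7 /dist; clearbody a1 b1 => eN ea eb.
  by split=> //; move: {eN} h8 oa ob ea eb; pair_lia.
- rewrite h8.
  set a1 := _ %/ 2; set b1 := _ %/ 2.
  have ea : 2 * a1 = dist a (7 * b) by rewrite /a1 /dist; lia.
  have sa : (2 * a1) * (2 * a1) + 2 * (a * (7 * b)) = a * a + (7 * b) * (7 * b) by rewrite ea dist_sq.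
  have eb : 2 * b1 = a + b by rewrite /b1; lia.
  have sb : (2 * b1) * (2 * b1) = (a + b) * (a + b) by rewrite eb.
  have eN : 1 * (a1 * a1) + 7 * (b1 * b1) = 2 * (a * a) + 14 * (b * b).
    by move: {ea eb h8} sa sb; lia.
  move: {sa sb} eN ea eb; rewrite /half1_7 /dist; clearbody a1 b1 => eN ea eb.
  by split=> //; move: {eN} h8 oa ob ea eb; pair_lia.
Qed.

(** Multiplication of a + b sqrt(-3) by the unit (1 + sqrt(-3))/2 or its conjugate, whichever keeps
    both entries odd. *)
Definition involution1_3 (x : nat * nat) : nat * nat :=
  let: (a, b) := x in
  if (a + b) %% 4 == 2 then (dist a (3 * b) %/ 2, (a + b) %/ 2)
  else ((a + 3 * b) %/ 2, dist a b %/ 2).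
Lemma involution1_3P a b :
  odd a -> odd b -> 
  let: (a1, b1) := involution1_3 (a, b) in
  [/\ odd a1, odd b1, 1 * (a1 * a1) + 3 * (b1 * b1) = 1 * (a * a) + 3 * (b * b)
    & involution1_3 (a1, b1) = (a, b)].
Proof.
move=> oa ob.
have a0 : 0 < a by case: (a) oa.
rewrite /involution1_3; have [h8|h8] : ((a + b) %% 4 == 2) = true \/ ((a + b) %% 4 == 2) = false by case: (_ == _); [left|right].
- rewrite h8.
  set a1 := _ %/ 2; set b1 := _ %/ 2.
  have ea : 2 * a1 = dist a (3 * b) by rewrite /a1 /dist; lia.
  have sa : (2 * a1) * (2 * a1) + 2 * (a * (3 * b)) = a * a + (3 * b) * (3 * b) by rewrite ea dist_sq.
  have eb : 2 * b1 = a + b by rewrite /b1; lia.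
  have sb : (2 * b1) * (2 * b1) = (a + b) * (a + b) by rewrite eb.
  have eN : 1 * (a1 * a1) + 3 * (b1 * b1) = 1 * (a * a) + 3 * (b * b).
    by move: {ea eb h8} sa sb; lia.
  move: {sa sb} eN ea eb; rewrite /involution1_3 /dist; clearbody a1 b1 => eN ea eb.
  by split=> //; move: {eN} h8 oa ob ea eb; pair_lia.
- rewrite h8.
  set a1 := _ %/ 2; set b1 := _ %/ 2.
  have ea : 2 * a1 = a + 3 * b by rewrite /a1; lia.
  have sa : (2 * a1) * (2 * a1) = (a + 3 * b) * (a + 3 * b) by rewrite ea.
  have eb : 2 * b1 = dist a b by rewrite /b1 /dist; lia.
  have sb : (2 * b1) * (2 * b1) + 2 * (a * b) = a * a + b * b by rewrite eb dist_sq.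
  have eN : 1 * (a1 * a1) + 3 * (b1 * b1) = 1 * (a * a) + 3 * (b * b).
    by move: {ea eb h8} sa sb; lia.
  move: {sa sb} eN ea eb; rewrite /involution1_3 /dist; clearbody a1 b1 => eN ea eb.
  by split=> //; move: {eN} h8 oa ob ea eb; pair_lia.
Qed.

Arguments half5_3 : simpl never.
Arguments half5_3_inv : simpl never.
Arguments half15_1 : simpl never.
Arguments half15_1_inv : simpl never.
Arguments half1_7 : simpl never.
Arguments half1_7_inv : simpl never.
Arguments involution5_3 : simpl never.
Arguments involution15_1 : simpl never.
Arguments involution1_7 : simpl never.
Arguments involution1_3 : simpl never.

(** The fixed points of the involutions lie on lines z -> [h z] on which the form is c z^2; their
    parity is then a coefficient of a theta series. *)
Lemma par_theta K (R : pred (nat * nat)) (h : nat -> nat * nat) (Q : pred nat) c N :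
    0 < c -> N < K -> injective h ->
    (forall x, R x -> [/\ x.1 < K & x.2 < K]) ->
    (forall z, Q z -> c * (z * z) = N -> R (h z)) ->
    (forall x, R x -> exists z, [/\ x = h z, Q z & c * (z * z) = N]) ->
  par K R = theta Q c N.
Proof.
move=> c0 NK hI bd QR RQ; rewrite (@thetaE Q c N K) // xor_count /par.
rewrite -!size_filter -(size_map h); congr odd; apply: perm_size; apply: uniq_perm.
- by rewrite filter_uniq ?uniq_pairs.
- by rewrite map_inj_uniq // filter_uniq ?iota_uniq.
move=> x; rewrite mem_filter; apply/andP/mapP => [[Rx _]|[z]].
  have [z [-> Qz /eqP e]] := RQ _ Rx; exists z => //.
  by rewrite mem_filter Qz e mem_iota add0n /=; move/eqP: e; nia.
rewrite mem_filter => /andP[/andP[Qz /eqP e] _] ->; have Rh := QR _ Qz e.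
by rewrite mem_pairs; split=> //; apply/andP; apply: bd.
Qed.

Lemma par_empty K (R : pred (nat * nat)) : (forall x, ~~ R x) -> par K R = false.
Proof. by move=> h; rewrite /par (eq_count (a2 := pred0)) ?count_pred0 // => x; apply/negbTE. Qed.

Lemma par_eq K (R S : pred (nat * nat)) : R =1 S -> par K R = par K S.
Proof. by move=> e; rewrite /par (eq_count e). Qed.

Lemma par_xor K (R S : pred (nat * nat)) : (forall x, R x -> ~~ S x) ->
  par K (predU R S) = par K R (+) par K S.
Proof.
move=> dis; rewrite /par -oddD -count_predUI; congr odd.
by rewrite [count (predI _ _) _](@eq_count _ _ pred0) ?count_pred0 ?addn0 // => x /=;
  apply/negbTE/negP => /andP[/dis/negbTE->].
Qed.

Lemma form_mod8 p q a b : odd a -> odd b -> (p * (a * a) + q * (b * b)) %% 8 = (p + q) %% 8.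
Proof.
move=> oa ob.
have s z : odd z -> z * z %% 8 = 1.
  move=> /odd_sq_mod16 h; have -> : z * z %% 8 = (z * z %% 16) %% 8 by rewrite modn_dvdm.
  by case: h => -[_ ->].
by rewrite -modnDm -(modnMmr p) -(modnMmr q) !s // !muln1 modnDm.
Qed.

Lemma theta_mod16 (Q : pred nat) c N : (forall z, Q z -> odd z) -> 8 %| c ->
  theta Q c N -> N %% 16 = c %% 16.
Proof.
move=> oQ /dvdnP[d ->] /existsP[m /andP[/oQ om /eqP <-]].
by rewrite -modnMmr; case: (odd_sq_mod16 om) => -[_ ->]; lia.
Qed.

Lemma cop10_odd z : cop10 z -> odd z.
Proof. by rewrite cop10E => /andP[]. Qed.

(** The first form takes values 0 modulo 8, the second values 0 modulo 16. For N = 0 modulo 16 the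
    bijection [half5_3] cancels the two counts; for N = 8 modulo 16 only the first form contributes,
    and the involution leaves the points a = b, of value 8 b^2. *)
Lemma theta_level15A :
  padd (pmul (theta odd 5) (theta cop10 3)) (pmul (theta odd 30) (theta cop10 2)) =
  theta cop10 8.
Proof.
apply: functional_extensionality => N; rewrite /padd !(@theta_mul _ _ _ _ N N.+1) //.
set P1 := fun x => _; set P2 := fun x => _.
have h1 x : P1 x -> [/\ odd x.1, odd x.2, x.2 %% 5 != 0 & 5 * (x.1 * x.1) + 3 * (x.2 * x.2) = N].
  by case/and3P=> oa; rewrite cop10E => /andP[ob b5] /eqP.
have h2 x : P2 x -> [/\ odd x.1, odd x.2, x.2 %% 5 != 0 & 30 * (x.1 * x.1) + 2 * (x.2 * x.2) = N].
  by case/and3P=> oa; rewrite cop10E => /andP[ob b5] /eqP.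
have b1 x : P1 x -> [/\ x.1 < N.+1 & x.2 < N.+1] by move=> /h1[_ _ _ e]; split; nia.
have b2 x : P2 x -> [/\ x.1 < N.+1 & x.2 < N.+1] by move=> /h2[_ _ _ e]; split; nia.
have P1N x : P1 x -> N %% 8 = 0 by move=> /h1[oa ob _ <-]; rewrite form_mod8.
have P2N x : P2 x -> N %% 16 = 0.
  move=> /h2[oa ob _ <-]; rewrite form_mod16.
  by case: (odd_sq_mod16 oa) => -[_ ->]; case: (odd_sq_mod16 ob) => -[_ ->].
have [N0|[N8|N8]] : N %% 16 = 0 \/ N %% 16 = 8 \/ N %% 8 != 0 by lia.
- have -> : theta cop10 8 N = false.
    by apply/negbTE/negP => t; have := @theta_mod16 cop10 8 N cop10_odd isT t; rewrite N0.
  rewrite (@par_bij _ P1 P2 half5_3 half5_3_inv) ?addbb // => -[a b].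
    move=> /h1[/= oa ob b5 e]; have := @half5_3P a b oa ob b5; rewrite e => /(_ N0).
    case: (half5_3 _) => a1 b1' [oa1 ob1 b15 e1 ->]; split=> //.
    by rewrite /P2 /= oa1 cop10E ob1 b15 e1 eqxx.
  move=> /h2[/= oa ob b5 e]; have := @half5_3_invP a b oa ob b5; rewrite e.
  case: (half5_3_inv _) => a1 b1' [oa1 ob1 b15 e1 ->]; split=> //.
  by rewrite /P1 /= oa1 cop10E ob1 b15 e1 eqxx.
- rewrite (@par_empty _ P2) ?addbF; last by move=> x; apply/negP => /P2N; rewrite N8.
  have hr x : P1 x -> P1 (involution5_3 x) /\ involution5_3 (involution5_3 x) = x.
    case: x => a b /h1[/= oa ob b5 e]; have := @involution5_3P a b oa ob b5; rewrite e => /(_ N8).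
    case: (involution5_3 (a, b)) => a1 b1' [oa1 ob1 b15 e1 ->]; split=> //.
    by rewrite /P1 /= oa1 cop10E ob1 b15 e1 eqxx.
  rewrite (@par_involution _ P1 involution5_3 b1) => [|x /hr[]|x /hr[]] //.
  apply: (@par_theta _ _ (fun z => (z, z))) => //.
  + by move=> x y [].
  + by move=> x /andP[/b1].
  + move=> z cz e; have oz := cop10_odd cz; rewrite /P1 /= oz cz /= /involution5_3 /dist.
    have -> : ((z + z) %% 4 == 0) = false by lia.
    by apply/andP; split; apply/eqP; [lia | congr pair; lia].
  + move=> [a b] /andP[/h1[/= oa ob b5 e] /eqP]; rewrite /involution5_3 /dist => r.
    have ab : a = b by case: eqP r => h [] *; lia.
    by exists b; rewrite cop10E ob b5 -ab; split=> //; rewrite -e -ab; lia.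
- rewrite !par_empty => [|x|x]; last 2 first.
    by apply/negP => /P2N; lia.
  by apply/negP => /P1N; lia.
  by apply/esym/negbTE/negP => t; have := @theta_mod16 cop10 8 N cop10_odd isT t; lia.
Qed.

(** As for [theta_level15A]; the fixed points are now b = 3a, of value 24 a^2. *)
Lemma theta_level15B :
  padd (pmul (theta odd 15) (theta cop10 1)) (pmul (theta odd 10) (theta cop10 6)) =
  theta cop10 24.
Proof.
apply: functional_extensionality => N; rewrite /padd !(@theta_mul _ _ _ _ N N.+1) //.
set P1 := fun x => _; set P2 := fun x => _.
have h1 x : P1 x -> [/\ odd x.1, odd x.2, x.2 %% 5 != 0 & 15 * (x.1 * x.1) + 1 * (x.2 * x.2) = N].
  by case/and3P=> oa; rewrite cop10E => /andP[ob b5] /eqP.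
have h2 x : P2 x -> [/\ odd x.1, odd x.2, x.2 %% 5 != 0 & 10 * (x.1 * x.1) + 6 * (x.2 * x.2) = N].
  by case/and3P=> oa; rewrite cop10E => /andP[ob b5] /eqP.
have b1 x : P1 x -> [/\ x.1 < N.+1 & x.2 < N.+1] by move=> /h1[_ _ _ e]; split; nia.
have b2 x : P2 x -> [/\ x.1 < N.+1 & x.2 < N.+1] by move=> /h2[_ _ _ e]; split; nia.
have P1N x : P1 x -> N %% 8 = 0 by move=> /h1[oa ob _ <-]; rewrite form_mod8.
have P2N x : P2 x -> N %% 16 = 0.
  move=> /h2[oa ob _ <-]; rewrite form_mod16.
  by case: (odd_sq_mod16 oa) => -[_ ->]; case: (odd_sq_mod16 ob) => -[_ ->].
have [N0|[N8|N8]] : N %% 16 = 0 \/ N %% 16 = 8 \/ N %% 8 != 0 by lia.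
- have -> : theta cop10 24 N = false.
    by apply/negbTE/negP => t; have := @theta_mod16 cop10 24 N cop10_odd isT t; rewrite N0.
  rewrite (@par_bij _ P1 P2 half15_1 half15_1_inv) ?addbb // => -[a b].
    move=> /h1[/= oa ob b5 e]; have := @half15_1P a b oa ob b5; rewrite e => /(_ N0).
    case: (half15_1 _) => a1 b1' [oa1 ob1 b15 e1 ->]; split=> //.
    by rewrite /P2 /= oa1 cop10E ob1 b15 e1 eqxx.
  move=> /h2[/= oa ob b5 e]; have := @half15_1_invP a b oa ob b5; rewrite e.
  case: (half15_1_inv _) => a1 b1' [oa1 ob1 b15 e1 ->]; split=> //.
  by rewrite /P1 /= oa1 cop10E ob1 b15 e1 eqxx.
- rewrite (@par_empty _ P2) ?addbF; last by move=> x; apply/negP => /P2N; rewrite N8.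
  have hr x : P1 x -> P1 (involution15_1 x) /\ involution15_1 (involution15_1 x) = x.
    case: x => a b /h1[/= oa ob b5 e]; have := @involution15_1P a b oa ob b5; rewrite e => /(_ N8).
    case: (involution15_1 (a, b)) => a1 b1' [oa1 ob1 b15 e1 ->]; split=> //.
    by rewrite /P1 /= oa1 cop10E ob1 b15 e1 eqxx.
  rewrite (@par_involution _ P1 involution15_1 b1) => [|x /hr[]|x /hr[]] //.
  apply: (@par_theta _ _ (fun z => (z, 3 * z))) => //.
  + by move=> x y [].
  + by move=> x /andP[/b1].
  + move=> z cz e; have oz := cop10_odd cz; rewrite /P1 /= oz cop10E /= /involution15_1 /dist.
    have -> : ((z + 3 * z) %% 4 == 0) by lia.
    move: cz; rewrite cop10E => /andP[_ z5].
    by apply/andP; split; [apply/andP; split; [apply/andP; split; lia | apply/eqP; lia] | apply/eqP; congr pair; lia].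
  + move=> [a b] /andP[/h1[/= oa ob b5 e] /eqP]; rewrite /involution15_1 /dist => r.
    have ab : b = 3 * a by case: eqP r => h [] *; lia.
    by exists a; rewrite cop10E oa -ab; split=> //; [lia | rewrite -e ab; lia].
- rewrite !par_empty => [|x|x]; last 2 first.
    by apply/negP => /P2N; lia.
  by apply/negP => /P1N; lia.
  by apply/esym/negbTE/negP => t; have := @theta_mod16 cop10 24 N cop10_odd isT t; lia.
Qed.

(** The involution now has two lines of fixed points, a = b and a = 7b, hence two theta series on
    the right. *)
Lemma theta_level7 :
  padd (pmul (theta odd 1) (theta odd 7)) (pmul (theta odd 2) (theta odd 14)) =
  padd (theta odd 8) (theta odd 56).
Proof.
apply: functional_extensionality => N; rewrite /padd !(@theta_mul _ _ _ _ N N.+1) //.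
set P1 := fun x => _; set P2 := fun x => _.
have h1 x : P1 x -> [/\ odd x.1, odd x.2 & 1 * (x.1 * x.1) + 7 * (x.2 * x.2) = N].
  by case/and3P=> oa ob /eqP.
have h2 x : P2 x -> [/\ odd x.1, odd x.2 & 2 * (x.1 * x.1) + 14 * (x.2 * x.2) = N].
  by case/and3P=> oa ob /eqP.
have b1 x : P1 x -> [/\ x.1 < N.+1 & x.2 < N.+1] by move=> /h1[_ _ e]; split; nia.
have b2 x : P2 x -> [/\ x.1 < N.+1 & x.2 < N.+1] by move=> /h2[_ _ e]; split; nia.
have P1N x : P1 x -> N %% 8 = 0 by move=> /h1[oa ob <-]; rewrite form_mod8.
have P2N x : P2 x -> N %% 16 = 0.
  move=> /h2[oa ob <-]; rewrite form_mod16.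
  by case: (odd_sq_mod16 oa) => -[_ ->]; case: (odd_sq_mod16 ob) => -[_ ->].
have [N0|[N8|N8]] : N %% 16 = 0 \/ N %% 16 = 8 \/ N %% 8 != 0 by lia.
- have oddid z : odd z -> odd z by [].
  have -> : theta odd 8 N = false.
    by apply/negbTE/negP => t; have := @theta_mod16 odd 8 N oddid isT t; rewrite N0.
  have -> : theta odd 56 N = false.
    by apply/negbTE/negP => t; have := @theta_mod16 odd 56 N oddid isT t; rewrite N0.
  rewrite (@par_bij _ P1 P2 half1_7 half1_7_inv) ?addbb // => -[a b].
    move=> /h1[/= oa ob e]; have := @half1_7P a b oa ob; rewrite e => /(_ N0).
    case: (half1_7 _) => a1 b1' [oa1 ob1 e1 ->]; split=> //.
    by rewrite /P2 /= oa1 ob1 e1 eqxx.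
  move=> /h2[/= oa ob e]; have := @half1_7_invP a b oa ob; rewrite e.
  case: (half1_7_inv _) => a1 b1' [oa1 ob1 e1 ->]; split=> //.
  by rewrite /P1 /= oa1 ob1 e1 eqxx.
- rewrite (@par_empty _ P2) ?addbF; last by move=> x; apply/negP => /P2N; rewrite N8.
  have hr x : P1 x -> P1 (involution1_7 x) /\ involution1_7 (involution1_7 x) = x.
    case: x => a b /h1[/= oa ob e]; have := @involution1_7P a b oa ob; rewrite e => /(_ N8).
    case: (involution1_7 (a, b)) => a1 b1' [oa1 ob1 e1 ->]; split=> //.
    by rewrite /P1 /= oa1 ob1 e1 eqxx.
  rewrite (@par_involution _ P1 involution1_7 b1) => [|x /hr[]|x /hr[]] //.
  rewrite (@par_eq _ _ (predU (fun x => P1 x && (x.1 == x.2)) (fun x => P1 x && (x.1 == 7 * x.2)))).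
    rewrite par_xor.
    congr addb.
    + apply: (@par_theta _ _ (fun z => (z, z))) => //.
      * by move=> x y [].
      * by move=> x /andP[/b1].
      * by move=> z oz e; rewrite /P1 /= oz eqxx andbT; apply/eqP; lia.
      * move=> [a b] /andP[/h1[/= oa ob e] /eqP ab].
        by exists b; rewrite ob ab; split=> //; rewrite -e ab; lia.
    + apply: (@par_theta _ _ (fun z => (7 * z, z))) => //.
      * by move=> x y [].
      * by move=> x /andP[/b1].
      * by move=> z oz e; rewrite /P1 /= oz eqxx andbT oddM oz /=; apply/eqP; lia.
      * move=> [a b] /andP[/h1[/= oa ob e] /eqP ab].
        by exists b; rewrite ob ab; split=> //; rewrite -e ab; lia.
    move=> [a b] /andP[/h1[/= oa ob _] /eqP ->]; apply/negP => /andP[_ /eqP]; lia.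
  move=> [a b] /=; case P1x: (P1 (a, b)) => //=.
  move/h1: P1x => [/= oa ob e]; rewrite /involution1_7 /dist.
  apply/eqP/orP => [r|[/eqP ab|/eqP ab]].
  + suff [->|->] : a = b \/ a = 7 * b by [rewrite eqxx; left|rewrite eqxx; right].
    by case: eqP r => h [] *; lia.
  + by case: eqP => h; congr pair; lia.
  + by case: eqP => h; congr pair; lia.
- rewrite !par_empty => [|x|x]; last 2 first.
    by apply/negP => /P2N; lia.
  by apply/negP => /P1N; lia.
  have oddid z : odd z -> odd z by [].
  have -> : theta odd 8 N = false.
    by apply/negbTE/negP => t; have := @theta_mod16 odd 8 N oddid isT t; lia.
  apply/esym/negbTE/negP => t; have := @theta_mod16 odd 56 N oddid isT t; lia.
Qed.

(** The unit involution acts on all representations, whatever N is; its fixed points are a = b and a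
    = 3b. *)
Lemma theta_level3 :
  pmul (theta odd 1) (theta odd 3) = padd (theta odd 4) (theta odd 12).
Proof.
apply: functional_extensionality => N; rewrite /padd !(@theta_mul _ _ _ _ N N.+1) //.
set P1 := fun x => _.
have h1 x : P1 x -> [/\ odd x.1, odd x.2 & 1 * (x.1 * x.1) + 3 * (x.2 * x.2) = N].
  by case/and3P=> oa ob /eqP.
have b1 x : P1 x -> [/\ x.1 < N.+1 & x.2 < N.+1] by move=> /h1[_ _ e]; split; nia.
have hr x : P1 x -> P1 (involution1_3 x) /\ involution1_3 (involution1_3 x) = x.
  case: x => a b /h1[/= oa ob e]; have := @involution1_3P a b oa ob; rewrite e.
  case: (involution1_3 (a, b)) => a1 b1' [oa1 ob1 e1 ->]; split=> //.
  by rewrite /P1 /= oa1 ob1 e1 eqxx.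
rewrite (@par_involution _ P1 involution1_3 b1) => [|x /hr[]|x /hr[]] //.
rewrite (@par_eq _ _ (predU (fun x => P1 x && (x.1 == x.2)) (fun x => P1 x && (x.1 == 3 * x.2)))).
  rewrite par_xor.
  congr addb.
  + apply: (@par_theta _ _ (fun z => (z, z))) => //.
    * by move=> x y [].
    * by move=> x /andP[/b1].
    * by move=> z oz e; rewrite /P1 /= oz eqxx andbT; apply/eqP; lia.
    * move=> [a b] /andP[/h1[/= oa ob e] /eqP ab].
      by exists b; rewrite ob ab; split=> //; rewrite -e ab; lia.
  + apply: (@par_theta _ _ (fun z => (3 * z, z))) => //.
    * by move=> x y [].
    * by move=> x /andP[/b1].
    * by move=> z oz e; rewrite /P1 /= oz eqxx andbT oddM oz /=; apply/eqP; lia.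
    * move=> [a b] /andP[/h1[/= oa ob e] /eqP ab].
      by exists b; rewrite ob ab; split=> //; rewrite -e ab; lia.
  move=> [a b] /andP[/h1[/= oa ob _] /eqP ->]; apply/negP => /andP[_ /eqP]; lia.
move=> [a b] /=; case P1x: (P1 (a, b)) => //=.
move/h1: P1x => [/= oa ob e]; rewrite /involution1_3 /dist.
apply/eqP/orP => [r|[/eqP ab|/eqP ab]].
+ suff [->|->] : a = b \/ a = 3 * b by [rewrite eqxx; left|rewrite eqxx; right].
  by case: eqP r => h [] *; lia.
+ by case: eqP => h; congr pair; lia.
+ by case: eqP => h; congr pair; lia.
Qed.

(** * Hecke operators *)

(** V_p substitutes x^p for x, and U_p is its left inverse. *)
Definition Vp (p : nat) (f : ps) : ps := fun n => (p %| n) && f (n %/ p).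
Definition Up (p : nat) (f : ps) : ps := fun n => f (p * n).

Lemma TpE p f : Tp p f = padd (Up p f) (Vp p f).
Proof. by []. Qed.

Lemma VpD p f g : Vp p (padd f g) = padd (Vp p f) (Vp p g).
Proof. by apply: functional_extensionality => n; rewrite /Vp /padd andb_addr. Qed.

Lemma UpD p f g : Up p (padd f g) = padd (Up p f) (Up p g).
Proof. by []. Qed.

Lemma Vp0 p : Vp p pzero = pzero.
Proof. by apply: functional_extensionality => n; rewrite /Vp andbF. Qed.

Lemma xor_multiples p n (E : nat -> bool) : 0 < p ->
  \big[addb/false]_(0 <= i < (p * n).+1) ((p %| i) && E i) =
  \big[addb/false]_(0 <= j < n.+1) E (p * j).
Proof.
move=> p0; elim: n => [|n IH]; first by rewrite muln0 !big_nat1 dvdn0 muln0.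
rewrite [RHS]big_nat_recr //= -IH.
rewrite (@big_cat_nat _ _ _ (p * n).+1) //=; last by nia.
have -> : p * n.+1 = p * n + p by lia.
congr addb; rewrite big_nat_recr /=; last by lia.
rewrite big_nat big1 => [|i /andP[i1 i2]]; first by rewrite dvdn_addr ?dvdn_mulr ?dvdnn.
case: dvdnP => // -[k e]; case: (leqP k n) => kn; nia.
Qed.

(** Projection formula: U_p is linear over series in x^p. With the multiplicativity of V_p it turns
    a relation between g and g(x^p) that is symmetric in the two into a recurrence for T_p. *)
Lemma Up_mul p f g : 0 < p -> Up p (pmul (Vp p g) f) = pmul g (Up p f).
Proof.
move=> p0; apply: functional_extensionality => n; rewrite /Up /pmul.
rewrite -(big_mkord xpredT (fun i => Vp p g i && f (p * n - i))).
rewrite -(big_mkord xpredT (fun i => g i && f (p * (n - i)))).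
under eq_bigr => i _ do rewrite /Vp -andbA.
rewrite (@xor_multiples p n (fun i => g (i %/ p) && f (p * n - i))) //.
by apply: eq_bigr => i _; rewrite mulKn // mulnBr.
Qed.

Lemma UpVp p f : 0 < p -> Up p (Vp p f) = f.
Proof.
by move=> p0; apply: functional_extensionality => n; rewrite /Up /Vp dvdn_mulr // mulKn.
Qed.

Lemma Vp_inj_on p (f : ps) : 0 < p -> (forall n, f n -> p %| n) -> f = Vp p (Up p f).
Proof.
move=> p0 h; apply: functional_extensionality => n; rewrite /Vp /Up.
have [pn|pn] /= := boolP (p %| n); first by rewrite mulnC divnK.
by apply: contraNF pn => /h.
Qed.

Lemma VpM p f g : 0 < p -> Vp p (pmul f g) = pmul (Vp p f) (Vp p g).
Proof.
move=> p0; rewrite [RHS](@Vp_inj_on p) ?Up_mul ?UpVp // => n.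
rewrite /pmul => h; apply: contraTT h => pn; apply/negP; rewrite big1 // => i _.
apply: contraNF pn; rewrite /Vp => /andP[/andP[pi _] /andP[pni _]].
have le_in : i <= n by rewrite -ltnS ltn_ord.
by rewrite -(subnK le_in) dvdn_add.
Qed.

Lemma Vp1 p : 0 < p -> Vp p pone = pone.
Proof.
move=> p0; apply: functional_extensionality => n; rewrite /Vp /pone.
case: n => [|n]; first by rewrite div0n dvdn0.
by case: dvdnP => //= -[k e]; rewrite e mulnK //; case: k e => [|k] e //; lia.
Qed.

Lemma VpX p f n : 0 < p -> Vp p (ppow f n) = ppow (Vp p f) n.
Proof.
move=> p0; elim: n => [|n IH]; first exact: Vp1.
by rewrite /ppow /= -!/(ppow _ _) VpM // IH.
Qed.

Lemma Vp_theta p A c : 0 < p -> Vp p (theta A c) = theta A (p * c).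
Proof.
move=> p0; apply: functional_extensionality => n; rewrite /Vp.
apply/andP/existsP => [[/dvdnP[k ->]]|[m /andP[Am /eqP e]]].
  rewrite mulnK // => /existsP[m /andP[Am /eqP e]].
  have lm : m < (k * p).+1 by have := ltn_ord m; nia.
  by exists (Ordinal lm); rewrite /= Am -mulnA e mulnC eqxx.
rewrite -e -mulnA dvdn_mulr //= mulKn //; split=> //.
case: (posnP m) => [m0|m0].
  apply/existsP; exists (Ordinal (ltn0Sn _)); rewrite /= -{1}m0 Am /= m0 muln0 //.
case: (posnP c) => [c0|c0].
  have n0 : n = 0 by rewrite -e c0; lia.
  by move: (ltn_ord m); rewrite {2}n0; lia.
have lm : m < (c * (m * m)).+1 by nia.
by apply/existsP; exists (Ordinal lm); rewrite /= Am eqxx.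
Qed.

(** Frobenius: exchanging the two factors pairs off the terms of coefficient n, except the middle
    one when n is even. *)
Lemma pmul_sq f : pmul f f = Vp 2 f.
Proof.
apply: functional_extensionality => n; rewrite /pmul.
rewrite -(big_mkord xpredT (fun i => f i && f (n - i))) xor_count -size_filter.
rewrite (@odd_size_involution _ (fun i => n - i)).
- rewrite count_filter -xor_count /Vp.
  have [/dvdnP[k ->]|odd_n] /= := boolP (2 %| n).
    rewrite mulnK // (@xor_single _ _ k) ?iota_uniq ?mem_index_iota //=; last 2 first.
    + by lia.
    + by move=> i _ /andP[/eqP]; lia.
    by rewrite (_ : k * 2 - k = k) ?eqxx ?andbb /=; [case: (f k) | lia].
  rewrite big_seq big1 // => i; rewrite mem_index_iota => ri.
  by apply: contraNF odd_n => /andP[/eqP e _]; rewrite dvdn2; lia.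
- by rewrite filter_uniq ?iota_uniq.
- move=> i; rewrite !mem_filter !mem_index_iota => /andP[/andP[fi fn] ri].
  by rewrite subKn ?fi ?fn; lia.
- by move=> i; rewrite mem_filter mem_index_iota => /andP[_ ri]; rewrite subKn; lia.
Qed.

(** Squaring is substitution of x^2, which for odd p commutes with U_p and V_p. *)
Lemma Tp_sq p f : odd p -> Tp p (pmul f f) = pmul (Tp p f) (Tp p f).
Proof.
move=> op; rewrite !pmul_sq !TpE VpD; congr padd; apply: functional_extensionality => n.
  rewrite /Up /Vp Euclid_dvdM // [2 %| p]dvdn2 op /=.
  by have [/dvdnP[k ->]|//] := boolP (2 %| n); rewrite mulnA !mulnK.
rewrite /Vp; have [/dvdnP[k ->]|pn] /= := boolP (p %| n).
  rewrite mulnK ?odd_gt0 // Euclid_dvdM // [2 %| p]dvdn2 op orbF.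
  have [/dvdnP[j ->]|//] := boolP (2 %| k).
  have -> : j * 2 * p = (j * p) * 2 by lia.
  by rewrite !mulnK ?dvdn_mull // odd_gt0.
have [/dvdnP[k e]|//] := boolP (2 %| n).
rewrite e mulnK //=; apply/esym/negbTE; apply: contraNN pn => /andP[pk _].
by rewrite e dvdn_mulr.
Qed.

Lemma TpD p f g : Tp p (padd f g) = padd (Tp p f) (Tp p g).
Proof. by rewrite !TpE VpD UpD; ring. Qed.

Lemma Tp0 p : Tp p pzero = pzero.
Proof. by rewrite TpE Vp0; apply: padd0. Qed.

Lemma Tp_comm p q f : prime p -> prime q -> p != q -> Tp p (Tp q f) = Tp q (Tp p f).
Proof.
move=> pp pq npq; apply: functional_extensionality => n; rewrite /Tp.
have cpq : coprime p q by rewrite prime_coprime // dvdn_prime2.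
have p0 := prime_gt0 pp; have q0 := prime_gt0 pq.
have e1 : (q %| p * n) = (q %| n) by rewrite Gauss_dvdr // coprime_sym.
have e2 : (p %| q * n) = (p %| n) by rewrite Gauss_dvdr.
rewrite e1 e2 (_ : q * (p * n) = p * (q * n)); last by lia.
rewrite [(n %/ q) %/ p]divnAC.
case pn: (p %| n); case qn: (q %| n) => //=.
- rewrite -!muln_divA //.
  have -> : p %| n %/ q by rewrite dvdn_divRL // Gauss_dvd // pn qn.
  have -> : q %| n %/ p by rewrite dvdn_divRL // mulnC Gauss_dvd // pn qn.
  by case: (f _); case: (f _); case: (f _); case: (f _).
- rewrite -muln_divA //.
  have -> : (q %| n %/ p) = false by rewrite dvdn_divRL // mulnC Gauss_dvd // pn qn.
  by rewrite !addbF.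
- rewrite -muln_divA //.
  have -> : (p %| n %/ q) = false by rewrite dvdn_divRL // Gauss_dvd // pn qn.
  by rewrite !addbF.
Qed.

(** * Modular equations *)

(** The x-adic valuation, a relation because zero has none. Leading coefficients are 1, so two
    series of equal valuation have a sum of larger valuation. *)
Definition lead (a : nat) (f : ps) : Prop := (forall i, i < a -> f i = false) /\ f a = true.

Lemma lead_uniq a b f : lead a f -> lead b f -> a = b.
Proof.
move=> [a0 a1] [b0 b1]; case: (ltngtP a b) => // h.
  by rewrite b0 in a1.
by rewrite a0 in b1.
Qed.

Lemma lead_exists f : f <> pzero -> exists a, lead a f.
Proof.
move=> nz; have ex : exists n, f n.
  apply: NNPP => h; apply: nz; apply: functional_extensionality => n.
  by apply/negP => fn; apply: h; exists n.
exists (ex_minn ex); case: ex_minnP => a fa mn; split=> // i lt_ia.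
by apply/negP => /mn; rewrite leqNgt lt_ia.
Qed.

Lemma lead_mul a b f g : lead a f -> lead b g -> lead (a + b) (pmul f g).
Proof.
move=> [a0 a1] [b0 b1]; split=> [n lt_n|].
  rewrite /pmul big1 // => i _; case: (ltnP i a) => h; first by rewrite a0.
  by rewrite [g _]b0 ?andbF //; have := ltn_ord i; lia.
rewrite /pmul -(big_mkord xpredT (fun i => f i && g (a + b - i))).
rewrite (@xor_single _ _ a) ?iota_uniq ?mem_index_iota //.
- by rewrite addKn a1 b1.
- by lia.
move=> i; rewrite mem_index_iota => ri /andP[fi gi].
case: (ltngtP i a) => // h; first by rewrite a0 in fi.
by rewrite b0 in gi; lia.
Qed.

Lemma lead_pow a f n : lead a f -> lead (n * a) (ppow f n).
Proof.
move=> la; elim: n => [|n IH]; first by split.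
by rewrite mulSn; apply: lead_mul.
Qed.

Lemma lead_addl a b f g : lead a f -> lead b g -> a < b -> lead a (padd f g).
Proof.
move=> [a0 a1] [b0 b1] ab; rewrite /padd; split=> [i lt_i|]; last by rewrite a1 b0.
by rewrite a0 // b0 //; apply: ltn_trans ab.
Qed.

Lemma lead_nz a f : lead a f -> f <> pzero.
Proof. by move=> [_ fa] e; rewrite e in fa. Qed.

Lemma pmul_eq0 f g : pmul f g = pzero -> f = pzero \/ g = pzero.
Proof.
move=> e; case: (classic (f = pzero)) => [|/lead_exists[a la]]; first by left.
case: (classic (g = pzero)) => [|/lead_exists[b lb]]; first by right.
by case: (lead_nz (lead_mul la lb)).
Qed.

Lemma padd_eq0 f g : padd f g = pzero -> f = g.
Proof. by move=> e; rewrite -[LHS]padd0 -e; ring. Qed.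

Lemma pmulI f g h : f <> pzero -> pmul f g = pmul f h -> g = h.
Proof.
move=> nz e; apply: padd_eq0; case: (@pmul_eq0 f (padd g h)) => //.
by have -> : pmul f (padd g h) = padd (pmul f g) (pmul f h) by [ring]; rewrite e paddff.
Qed.

Lemma lead_theta (A : pred nat) c : 0 < c -> A 1 -> ~~ A 0 -> lead c (theta A c).
Proof.
move=> c0 A1 A0; split=> [i lt_i|].
  apply/negbTE/negP => /existsP[[m ltm] /= /andP[Am /eqP e]].
  by case: m Am e {ltm} => [|m] // Am e; [rewrite Am in A0 | nia].
have lt1 : 1 < c.+1 by [].
by apply/existsP; exists (Ordinal lt1); rewrite /= A1 !muln1 eqxx.
Qed.

Local Open Scope ps_scope.

Lemma sq_theta A c : theta A c ^ 2 = theta A (2 * c).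
Proof. by have -> : theta A c ^ 2 = theta A c * theta A c by [ring]; rewrite pmul_sq Vp_theta. Qed.

Definition g5 := theta odd 5.
Definition g15 := theta odd 15.
Definition g35 := theta odd 35.
Definition d1 := theta cop10 1.
Definition d3 := theta cop10 3.

Lemma lead_g5 : lead 5 g5. Proof. exact: lead_theta. Qed.
Lemma lead_g15 : lead 15 g15. Proof. exact: lead_theta. Qed.
Lemma lead_g35 : lead 35 g35. Proof. exact: lead_theta. Qed.
Lemma lead_d1 : lead 1 d1. Proof. exact: lead_theta. Qed.
(** [theta_level3] read with G in place of F: V_5 passes from F to G, and [sq_theta] turns the
    powers of 2 in the parameters into powers of the series. *)
Lemma modular3 : g15 ^ 4 = g5 ^ 4 + g5 * g15.
Proof.
have := congr1 (Vp 5) theta_level3; rewrite VpM // VpD !Vp_theta // -/g5 -/g15.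
have -> : theta odd (5 * 4) = g5 ^ 4.
  by rewrite -[(5 * 4)%N]/(2 * (2 * 5))%N -!sq_theta -/g5; ring.
have -> : theta odd (5 * 12) = g15 ^ 4.
  by rewrite -[(5 * 12)%N]/(2 * (2 * 15))%N -!sq_theta -/g15; ring.
by move=> ->; ring.
Qed.

Lemma modular7 : g35 ^ 8 = g5 ^ 8 + g5 * g35 + g5 ^ 2 * g35 ^ 2.
Proof.
have := congr1 (Vp 5) theta_level7; rewrite !VpD !VpM // !Vp_theta // -/g5 -/g35.
have -> : theta odd (5 * 2) = g5 ^ 2 by rewrite sq_theta.
have -> : theta odd (5 * 14) = g35 ^ 2 by rewrite sq_theta.
have -> : theta odd (5 * 8) = g5 ^ 8.
  by rewrite -[(5 * 8)%N]/(2 * (2 * (2 * 5)))%N -!sq_theta -/g5; ring.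
have -> : theta odd (5 * 56) = g35 ^ 8.
  by rewrite -[(5 * 56)%N]/(2 * (2 * (2 * 35)))%N -!sq_theta -/g35; ring.
move=> e; apply: padd_eq0; transitivity (g5 * g35 + g5 ^ 2 * g35 ^ 2 + (g5 ^ 8 + g35 ^ 8)); first by ring.
by rewrite -e paddff.
Qed.

(** Since [d3] is D(x^3), this expresses D(x^3) by D, G and G(x^3); [level15B] expresses D by D(x^3)
    in the same way. *)
Lemma level15A : g5 * d3 = d1 ^ 8 + g15 ^ 2 * d1 ^ 2.
Proof.
have := theta_level15A; rewrite -/g5 -/d3.
have -> : theta odd 30 = g15 ^ 2 by rewrite sq_theta.
have -> : theta cop10 2 = d1 ^ 2 by rewrite sq_theta.
have -> : theta cop10 8 = d1 ^ 8.
  by rewrite -[theta cop10 8]/(theta cop10 (2 * (2 * (2 * 1)))) -!sq_theta -/d1; ring.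
by move=> <-; ring.
Qed.

Lemma level15B : g15 * d1 = d3 ^ 8 + g5 ^ 2 * d3 ^ 2.
Proof.
have := theta_level15B; rewrite -/g15 -/d1.
have -> : theta odd 10 = g5 ^ 2 by rewrite sq_theta.
have -> : theta cop10 6 = d3 ^ 2 by rewrite sq_theta.
have -> : theta cop10 24 = d3 ^ 8.
  by rewrite -[theta cop10 24]/(theta cop10 (2 * (2 * (2 * 3)))) -!sq_theta -/d3; ring.
by move=> <-; ring.
Qed.

(** Eliminating D(x^3) from the two relations of level 15 gives Z^4 = G^5 G(x^3) Z for the defect Z.
    If Z were nonzero, its lowest exponent z would satisfy 4z = 40 + z. *)
Lemma d1_relation : d1 ^ 16 = g5 ^ 4 * d1 ^ 4 + g5 ^ 3 * d1.
Proof.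
pose Z := d1 ^ 16 + g5 ^ 4 * d1 ^ 4 + g5 ^ 3 * d1.
suff Z0 : Z = 0 by apply: padd_eq0; rewrite -Z0 /Z; ring.
apply: NNPP => nz; have [z lz] := lead_exists nz.
have e : Z ^ 4 = g5 ^ 5 * g15 * Z.
  have e1 : g5 ^ 8 * (g15 * d1) = (g5 * d3) ^ 8 + g5 ^ 8 * (g5 * d3) ^ 2.
    by rewrite level15B; ring.
  apply: padd_eq0; transitivity (g5 ^ 8 * (g15 * d1) + ((g5 * d3) ^ 8 + g5 ^ 8 * (g5 * d3) ^ 2)).
    by rewrite level15A /Z; ring [modular3].
  by rewrite e1 paddff.
have l1 := lead_pow 4 lz; rewrite e in l1.
have := lead_uniq l1 (lead_mul (lead_mul (lead_pow 5 lead_g5) lead_g15) lz); lia.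
Qed.

Lemma G_theta : G = g5.
Proof.
suff FE : F = theta odd 1 by rewrite /g5 -[5]/(5 * 1)%N -Vp_theta // -FE.
by apply: functional_extensionality => N; apply: eq_existsb => m; rewrite mul1n.
Qed.

Lemma D_theta : D = d1.
Proof.
by apply: functional_extensionality => N; apply: eq_existsb => m; rewrite mul1n /cop10 -andbA.
Qed.

Definition d7 := theta cop10 7.
Lemma lead_d7 : lead 7 d7. Proof. exact: lead_theta. Qed.

Lemma ppow_neq0 f n : f <> 0 -> f ^ n <> 0.
Proof. by move=> /lead_exists[a la]; apply: lead_nz (lead_pow n la). Qed.

Lemma pmul_neq0 f g : f <> 0 -> g <> 0 -> f * g <> 0.
Proof. by move=> /lead_exists[a la] /lead_exists[b lb]; apply: lead_nz (lead_mul la lb). Qed.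

(* Comparing lowest exponents in y^15 = A y^3 + B. *)
Lemma root_lead A B f alpha beta a :
    lead alpha A -> lead beta B ->
    (forall a, 12 * a <> alpha)%N -> (forall a, alpha + 3 * a <> beta)%N ->
    f <> 0 -> f ^ 16 = A * f ^ 4 + B * f -> lead a f -> (15 * a)%N = beta.
Proof.
move=> lA lB h1 h2 nz e la.
have e15 : f ^ 15 = A * f ^ 3 + B.
  by apply: (@pmulI f) => //; transitivity (f ^ 16); [ring | rewrite e; ring].
have l15 := lead_pow 15 la.
have lA3 := lead_mul lA (lead_pow 3 la).
have [h|h|h] := ltngtP (alpha + 3 * a) beta.
- have l := lead_addl lA3 lB h; rewrite -e15 in l.
  by have := lead_uniq l l15; have := h1 a; lia.
- have l := lead_addl lB lA3 h; rewrite paddC -e15 in l.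
  by have := lead_uniq l l15; lia.
- by case: (h2 a).
Qed.

(** The equation is additive, so the sum of two roots is a root. All nonzero roots share one lowest
    exponent, at which the leading terms of f and g cancel in f + g. *)
Lemma root_uniq A B f g alpha beta :
    lead alpha A -> lead beta B ->
    (forall a, 12 * a <> alpha)%N -> (forall a, alpha + 3 * a <> beta)%N ->
    f <> 0 -> g <> 0 ->
    f ^ 16 = A * f ^ 4 + B * f -> g ^ 16 = A * g ^ 4 + B * g -> f = g.
Proof.
move=> lA lB h1 h2 nf ng ef eg; apply: padd_eq0; apply: NNPP => nz.
have [[a la] [b lb] [c lc]] := And3 (lead_exists nf) (lead_exists ng) (lead_exists nz).
have ea := root_lead lA lB h1 h2 nf ef la.
have eb := root_lead lA lB h1 h2 ng eg lb.
have es : (f + g) ^ 16 = A * (f + g) ^ 4 + B * (f + g).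
  by transitivity (f ^ 16 + g ^ 16); [ring | rewrite ef eg; ring].
have ec := root_lead lA lB h1 h2 nz es lc.
case: lc => _; rewrite /padd.
have <- : a = c by lia.
case: la => _ ->; have -> : a = b by lia.
by case: lb => _ ->.
Qed.

(* A root of the same equation y^16 = A y^4 + B y as [g ^ 2 * D(x^7)]; that equation has a single
   nonzero root. *)
Definition cand7 (g k d : ps) : ps :=
  (g ^ 5 + k ^ 3 + k ^ 4 * g) * d ^ 8 +
  (g ^ 3 + k * g ^ 4 + k ^ 2 * g ^ 5 + k ^ 6 * g) * d ^ 2.

(** By additivity the equation splits into one identity for the coefficient of d^8 and one for that
    of d^2, once d^32 and d^128 are reduced by the equation of d. These identities, [c8] and [c2],
    follow from the modular equation. *)
Lemma cand7_root g k d :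
    k ^ 8 = g ^ 8 + g * k + g ^ 2 * k ^ 2 -> d ^ 16 = g ^ 4 * d ^ 4 + g ^ 3 * d ->
  cand7 g k d ^ 16 = k ^ 4 * g ^ 24 * cand7 g k d ^ 4 + k ^ 3 * g ^ 30 * cand7 g k d.
Proof.
move=> hk hd; rewrite /cand7.
set a := g ^ 5 + _ + _; set b := g ^ 3 + _ + _ + _.
have d32 : d ^ 32 = g ^ 8 * d ^ 8 + g ^ 6 * d ^ 2.
  by transitivity ((d ^ 16) ^ 2); [ring | rewrite hd; ring].
have d128 : d ^ 128 = (g ^ 40 + g ^ 24) * d ^ 8 + g ^ 38 * d ^ 2.
  transitivity ((d ^ 16) ^ 8); first by ring.
  rewrite hd; transitivity (g ^ 32 * d ^ 32 + g ^ 24 * d ^ 8); first by ring.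
  by rewrite d32; ring.
have c8 : a ^ 16 * (g ^ 40 + g ^ 24) + b ^ 16 * g ^ 8 =
          k ^ 4 * g ^ 24 * (a ^ 4 * g ^ 8 + b ^ 4) + k ^ 3 * g ^ 30 * a.
  by rewrite /a /b; ring [hk].
have c2 : a ^ 16 * g ^ 38 + b ^ 16 * g ^ 6 =
          k ^ 4 * g ^ 24 * a ^ 4 * g ^ 6 + k ^ 3 * g ^ 30 * b.
  by rewrite /a /b; ring [hk].
transitivity (a ^ 16 * d ^ 128 + b ^ 16 * d ^ 32); first by ring.
transitivity ((a ^ 16 * (g ^ 40 + g ^ 24) + b ^ 16 * g ^ 8) * d ^ 8 +
              (a ^ 16 * g ^ 38 + b ^ 16 * g ^ 6) * d ^ 2).
  by rewrite d128 d32; ring.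
rewrite c8 c2; transitivity (k ^ 4 * g ^ 24 * (a ^ 4 * d ^ 32 + b ^ 4 * d ^ 8) +
  k ^ 3 * g ^ 30 * (a * d ^ 8 + b * d ^ 2)); first by rewrite d32; ring.
by ring.
Qed.

(** Over Z/2 both modular equations are symmetric, so each relation is also available with G and
    G(x^p) exchanged: one version serves V_p, the other U_p. *)
Lemma modular7_conj : g5 ^ 8 = g35 ^ 8 + g35 * g5 + g35 ^ 2 * g5 ^ 2.
Proof. by rewrite modular7; ring. Qed.

Lemma modular3_conj : g5 ^ 4 = g15 ^ 4 + g15 * g5.
Proof. by rewrite modular3; ring. Qed.

Lemma d3_relation : d3 ^ 16 = g15 ^ 4 * d3 ^ 4 + g15 ^ 3 * d3.
Proof. by have := congr1 (Vp 3) d1_relation; rewrite VpX // VpD !(@VpM 3 (_ ^ _)) // !VpX // !Vp_theta. Qed.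

Lemma d7_relation : d7 ^ 16 = g35 ^ 4 * d7 ^ 4 + g35 ^ 3 * d7.
Proof. by have := congr1 (Vp 7) d1_relation; rewrite VpX // VpD !(@VpM 7 (_ ^ _)) // !VpX // !Vp_theta. Qed.

Lemma scaled_root g k e : e ^ 16 = k ^ 4 * e ^ 4 + k ^ 3 * e ->
  (g ^ 2 * e) ^ 16 = k ^ 4 * g ^ 24 * (g ^ 2 * e) ^ 4 + k ^ 3 * g ^ 30 * (g ^ 2 * e).
Proof.
by move=> h; transitivity (g ^ 32 * e ^ 16); [ring | rewrite h; ring].
Qed.

(** Both sides are nonzero roots of one additive equation. The parameters 260 = 4*35 + 24*5 and 255
    = 3*35 + 30*5 are the lowest exponents of its coefficients. *)
Lemma level35A : g5 ^ 2 * d7 = cand7 g5 g35 d1.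
Proof.
have lg := lead_g5; have lk := lead_g35; have ld := lead_d1.
apply: (@root_uniq (g35 ^ 4 * g5 ^ 24) (g35 ^ 3 * g5 ^ 30) _ _ 260 255).
- exact: (lead_mul (lead_pow 4 lk) (lead_pow 24 lg)).
- exact: (lead_mul (lead_pow 3 lk) (lead_pow 30 lg)).
- by lia.
- by lia.
- exact: lead_nz (lead_mul (lead_pow 2 lg) lead_d7).
- rewrite /cand7 paddC; apply: lead_nz (lead_addl (b := 33) (a := 17) _ _ _) => //.
    apply: (lead_mul (a := 15) (b := 2)); last exact: (lead_pow 2 ld).
    apply: (lead_addl (b := 215)); [|exact: (lead_mul (lead_pow 6 lk) lg)|by []].
    apply: (lead_addl (b := 95)); [|exact: (lead_mul (lead_pow 2 lk) (lead_pow 5 lg))|by []].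
    apply: (lead_addl (b := 55)); [|exact: (lead_mul lk (lead_pow 4 lg))|by []].
    exact: (lead_pow 3 lg).
  apply: (lead_mul (a := 25) (b := 8)); last exact: (lead_pow 8 ld).
  apply: (lead_addl (b := 145)); [|exact: (lead_mul (lead_pow 4 lk) lg)|by []].
  apply: (lead_addl (b := 105)); [|exact: (lead_pow 3 lk)|by []].
  exact: (lead_pow 5 lg).
- exact: scaled_root d7_relation.
- exact: cand7_root modular7 d1_relation.
Qed.

Lemma level35B : g35 ^ 2 * d1 = cand7 g35 g5 d7.
Proof.
have lg := lead_g5; have lk := lead_g35; have ld := lead_d7.
apply: (@root_uniq (g5 ^ 4 * g35 ^ 24) (g5 ^ 3 * g35 ^ 30) _ _ 860 1065).
- exact: (lead_mul (lead_pow 4 lg) (lead_pow 24 lk)).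
- exact: (lead_mul (lead_pow 3 lg) (lead_pow 30 lk)).
- by lia.
- by lia.
- exact: lead_nz (lead_mul (lead_pow 2 lk) lead_d1).
- rewrite /cand7; apply: lead_nz (lead_addl (a := 71) (b := 79) _ _ _) => //.
    apply: (lead_mul (a := 15) (b := 56)); last exact: (lead_pow 8 ld).
    have -> : g35 ^ 5 + g5 ^ 3 + g5 ^ 4 * g35 = g5 ^ 3 + g5 ^ 4 * g35 + g35 ^ 5 by ring.
    apply: (lead_addl (b := 175)); [|exact: (lead_pow 5 lk)|by []].
    apply: (lead_addl (b := 55)); [|exact: (lead_mul (lead_pow 4 lg) lk)|by []].
    exact: (lead_pow 3 lg).
  apply: (lead_mul (a := 65) (b := 14)); last exact: (lead_pow 2 ld).
  rewrite paddC; apply: (lead_addl (b := 105)); first exact: (lead_mul (lead_pow 6 lg) lk).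
    apply: (lead_addl (b := 185)); [|exact: (lead_mul (lead_pow 2 lg) (lead_pow 5 lk))|by []].
    apply: (lead_addl (b := 145)); [|exact: (lead_mul lg (lead_pow 4 lk))|by []].
    exact: (lead_pow 3 lk).
  by [].
- exact: scaled_root d1_relation.
- exact: cand7_root modular7_conj d7_relation.
Qed.

(* [(e, a, j)] stands for the term k^e g^a s_j. *)
Definition conj3 (rho : nat) : seq (nat * nat * nat) :=
  nth [::] ([:: [:: (0, 2, 1); (2, 0, 2)];
               [:: (3, 1, 0); (0, 2, 3)];
               [:: (1, 3, 0); (2, 0, 3)];
               [:: (3, 1, 1); (1, 3, 2)]]%N) rho.
Definition conj7 (rho : nat) : seq (nat * nat * nat) :=
  nth [::] ([:: [:: (0, 6, 1); (3, 1, 1); (4, 2, 1); (0, 2, 2); (1, 3, 2); (2, 4, 2); (6, 0, 2)];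
               [:: (0, 6, 0); (1, 7, 0); (5, 3, 0); (0, 6, 3); (2, 0, 3); (3, 1, 3); (4, 2, 3)];
               [:: (2, 4, 0); (3, 5, 0); (7, 1, 0); (1, 3, 3); (2, 4, 3); (6, 0, 3)];
               [:: (1, 7, 1); (4, 2, 1); (5, 3, 1); (3, 5, 2); (6, 0, 2); (7, 1, 2)]]%N) rho.

(** D_1, D_3, D_7, D_9 built from any g, d in place of G, D, with s for d^8 / g, so that the
    conjugates under x -> x^p are instances too. *)
Definition quad (g d s : ps) (rho : nat) : ps :=
  nth pzero [:: d; s; d ^ 2 * g; d ^ 4 * g] rho.

Definition conj_sum (L : seq (nat * nat * nat)) (g k : ps) (s : nat -> ps) : ps :=
  \big[padd/pzero]_(x <- L) (k ^ x.1.1 * g ^ x.1.2 * s x.2).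

Ltac expand_sum := rewrite /conj_sum !big_cons big_nil /quad /=.

(** Stated for arbitrary g and k, in order to be applied to G, G(x^3) and to G(x^3), G. The factor
    g^2 clears the denominators coming from g e = d^8 + k^2 d^2. *)
Lemma conj3P g k d e s s' rho :
    g <> 0 -> k <> 0 -> k ^ 4 = g ^ 4 + g * k -> d ^ 16 = g ^ 4 * d ^ 4 + g ^ 3 * d ->
    g * e = d ^ 8 + k ^ 2 * d ^ 2 -> s * g = d ^ 8 -> s' * k = e ^ 8 -> rho < 4 ->
  g ^ 2 * quad k e s' rho = conj_sum (conj3 rho) g k (quad g d s).
Proof.
move=> ng nk hk hd he hs hs'.
case: rho => [|[|[|[|//]]]] _; expand_sum.
- transitivity (g * (g * e)); first by ring.
  by rewrite he; ring [hs].
- apply: (@pmulI (k * g ^ 6)); first by apply: pmul_neq0; last exact: ppow_neq0.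
  transitivity ((g * e) ^ 8); first by ring [hs'].
  by rewrite he; ring [hk hd].
- transitivity ((g * e) ^ 2 * k); first by ring.
  by rewrite he; ring [hk hd].
- apply: (@pmulI (g ^ 2)); first exact: ppow_neq0.
  transitivity ((g * e) ^ 4 * k); first by ring.
  by rewrite he; ring [hk hd hs].
Qed.

Lemma conj7P g k d e s s' rho :
    g <> 0 -> k <> 0 -> k ^ 8 = g ^ 8 + g * k + g ^ 2 * k ^ 2 ->
    d ^ 16 = g ^ 4 * d ^ 4 + g ^ 3 * d ->
    g ^ 2 * e = cand7 g k d -> s * g = d ^ 8 -> s' * k = e ^ 8 -> rho < 4 ->
  g ^ 2 * quad k e s' rho = conj_sum (conj7 rho) g k (quad g d s).
Proof.
rewrite /cand7 => ng nk hk hd he hs hs'.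
case: rho => [|[|[|[|//]]]] _; expand_sum.
- by rewrite he; ring [hs].
- apply: (@pmulI (k * g ^ 14)); first by apply: pmul_neq0; last exact: ppow_neq0.
  transitivity ((g ^ 2 * e) ^ 8); first by ring [hs'].
  by rewrite he; ring [hk hd].
- apply: (@pmulI (g ^ 2)); first exact: ppow_neq0.
  transitivity ((g ^ 2 * e) ^ 2 * k); first by ring.
  by rewrite he; ring [hk hd].
- apply: (@pmulI (g ^ 6)); first exact: ppow_neq0.
  transitivity ((g ^ 2 * e) ^ 4 * k); first by ring.
  by rewrite he; ring [hk hd hs].
Qed.

(** In V_p(g^n f) the powers of k = V_p g join V_p(g^n); in U_p the projection formula pulls out
    V_p(g^a s_j). Both leave g^a s_j outside and g^(n+e) inside, so T_p is known once its values on
    powers of g are. *)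
Lemma T_of_conjugates p g (L : seq (nat * nat * nat)) (s s' : nat -> ps) f f' n :
    0 < p -> (forall j, s' j = Vp p (s j)) -> f' = Vp p f ->
    g ^ 2 * f' = conj_sum L g (Vp p g) s ->
    Vp p g ^ 2 * f = conj_sum L (Vp p g) g s' ->
  g ^ 2 * Tp p (g ^ n * f) =
  \big[padd/pzero]_(x <- L) (g ^ x.1.2 * Tp p (g ^ (n + x.1.1)) * s x.2).
Proof.
move=> p0 es ef e1 e2.
have eV : g ^ 2 * Vp p (g ^ n * f) =
  \big[padd/pzero]_(x <- L) (g ^ x.1.2 * Vp p (g ^ (n + x.1.1)) * s x.2).
  rewrite VpM // -ef; transitivity (Vp p (g ^ n) * (g ^ 2 * f')); first by ring.
  rewrite e1 /conj_sum VpX //; elim: {e1 e2} L => [|x L IH]; rewrite ?big_nil ?big_cons.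
    by ring.
  by rewrite -IH VpX // ppowD; ring.
have eU : g ^ 2 * Up p (g ^ n * f) =
  \big[padd/pzero]_(x <- L) (g ^ x.1.2 * Up p (g ^ (n + x.1.1)) * s x.2).
  rewrite -Up_mul // VpX //.
  have -> : Vp p g ^ 2 * (g ^ n * f) = g ^ n * (Vp p g ^ 2 * f) by ring.
  rewrite e2 /conj_sum; elim: {e1 e2 eV} L => [|x L IH]; rewrite ?big_nil ?big_cons.
    by have -> : g ^ n * 0 = 0 by ring.
  rewrite -IH -VpX // es -[s x.2]/(s x.2).
  have -> : g ^ n * (g ^ x.1.1 * Vp p (g ^ x.1.2) * Vp p (s x.2) +
      \big[padd/0]_(j <- L) (g ^ j.1.1 * Vp p g ^ j.1.2 * s' j.2)) =
    Vp p (g ^ x.1.2 * s x.2) * g ^ (n + x.1.1) +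
      g ^ n * \big[padd/0]_(j <- L) (g ^ j.1.1 * Vp p g ^ j.1.2 * s' j.2).
    by rewrite VpM // ppowD; ring.
  by rewrite UpD Up_mul //; ring.
transitivity (g ^ 2 * Up p (g ^ n * f) + g ^ 2 * Vp p (g ^ n * f)); first by rewrite TpE; ring.
rewrite eU eV -big_split /=; apply: eq_bigr => x _; rewrite TpE; ring.
Qed.

(** * Recurrences for T_3 and T_7 *)

Lemma Vp3_g5 : Vp 3 g5 = g15. Proof. exact: Vp_theta. Qed.
Lemma Vp7_g5 : Vp 7 g5 = g35. Proof. exact: Vp_theta. Qed.
Lemma g5_neq0 : g5 <> 0. Proof. exact: lead_nz lead_g5. Qed.
Lemma g15_neq0 : g15 <> 0. Proof. exact: lead_nz lead_g15. Qed.
Lemma g35_neq0 : g35 <> 0. Proof. exact: lead_nz lead_g35. Qed.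

Lemma T3_rec f : T3 (g5 ^ 4 * f) = g5 ^ 4 * T3 f + g5 * T3 (g5 * f).
Proof.
rewrite /T3 !TpE.
have -> : Up 3 (g5 ^ 4 * f) = g5 ^ 4 * Up 3 f + g5 * Up 3 (g5 * f).
  have -> : g5 ^ 4 * f = Vp 3 (g5 ^ 4) * f + Vp 3 g5 * (g5 * f).
    by rewrite VpX // Vp3_g5 modular3_conj; ring.
  by rewrite UpD !Up_mul.
have -> : Vp 3 (g5 ^ 4 * f) = g5 ^ 4 * Vp 3 f + g5 * Vp 3 (g5 * f).
  by rewrite (@VpM 3 (_ ^ _)) // VpM // VpX // Vp3_g5 modular3; ring.
ring.
Qed.

Lemma T7_rec f :
  T7 (g5 ^ 8 * f) = g5 ^ 8 * T7 f + g5 * T7 (g5 * f) + g5 ^ 2 * T7 (g5 ^ 2 * f).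
Proof.
rewrite /T7 !TpE.
have -> : Up 7 (g5 ^ 8 * f) =
    g5 ^ 8 * Up 7 f + g5 * Up 7 (g5 * f) + g5 ^ 2 * Up 7 (g5 ^ 2 * f).
  have -> : g5 ^ 8 * f =
      Vp 7 (g5 ^ 8) * f + Vp 7 g5 * (g5 * f) + Vp 7 (g5 ^ 2) * (g5 ^ 2 * f).
    by rewrite !VpX // Vp7_g5 modular7_conj; ring.
  by rewrite !UpD !Up_mul.
have -> : Vp 7 (g5 ^ 8 * f) =
    g5 ^ 8 * Vp 7 f + g5 * Vp 7 (g5 * f) + g5 ^ 2 * Vp 7 (g5 ^ 2 * f).
  by rewrite !(@VpM 7 (_ ^ _)) // VpM // !VpX // Vp7_g5 modular7; ring.
ring.
Qed.

(** U_p and V_p both send the series of parameter c to that of parameter p c, because p | c m^2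
    forces p | m; they cancel. *)
Lemma Tp_theta_odd p c : prime p -> odd p -> coprime p c -> 0 < c ->
  Tp p (theta odd c) = pzero.
Proof.
move=> pp op cp c0; have p0 := prime_gt0 pp.
rewrite TpE Vp_theta //; suff -> : Up p (theta odd c) = theta odd (p * c) by rewrite paddff.
apply: functional_extensionality => n; rewrite /Up.
apply/existsP/existsP => -[m /andP[om /eqP e]].
  have pm : p %| m.
    have : (p %| c * (m * m))%N by rewrite e dvdn_mulr.
    by rewrite Gauss_dvdr // Euclid_dvdM // orbb.
  case/dvdnP: pm => k ek; rewrite ek in om e.
  have en : (p * c * (k * k) = n)%N by apply/eqP; rewrite -(eqn_pmul2l p0) -e; lia.
  have lk : k < n.+1.
    rewrite -en ltnS; apply: (@leq_trans (k * k)%N); first by case: (k) => // j; nia.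
    by rewrite leq_pmull // muln_gt0 p0 c0.
  by exists (Ordinal lk); rewrite /= en eqxx andbT; move: om; rewrite oddM op andbT.
have lm : (m * p < (p * n).+1)%N by have := ltn_ord m; nia.
by exists (Ordinal lm); rewrite /= oddM om op /=; apply/eqP; move: e; clear; nia.
Qed.

Lemma Tp_one p : 0 < p -> Tp p 1 = 0.
Proof. by move=> p0; rewrite TpE -{1}(Vp1 p0) UpVp // Vp1 // paddff. Qed.

Lemma Tp_pow2 p f : odd p -> Tp p (f ^ 2) = Tp p f ^ 2.
Proof.
move=> op; have sq h : h ^ 2 = h * h by ring.
by rewrite !sq Tp_sq.
Qed.

Lemma T3_pow0 : T3 (g5 ^ 0) = 0. Proof. exact: Tp_one. Qed.
Lemma T3_pow1 : T3 (g5 ^ 1) = 0.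
Proof. by have -> : g5 ^ 1 = g5 by [ring]; apply: Tp_theta_odd. Qed.
Lemma T3_pow2 : T3 (g5 ^ 2) = 0.
Proof.
rewrite /T3 Tp_pow2 //; have -> : Tp 3 g5 = 0 by apply: Tp_theta_odd.
by ring.
Qed.

Lemma idempotent_cases g y : y ^ 2 = g * y -> y = 0 \/ y = g.
Proof.
move=> e; have : y * (y + g) = 0 by transitivity (y ^ 2 + g * y); [ring | rewrite e paddff].
by move=> /pmul_eq0[|/padd_eq0]; [left | right].
Qed.

(** Computing T_3 G^6 both as a square and by the recurrence gives y^2 = G y for y = T_3 G^3. The
    coefficient of x^15 in G^3 excludes y = 0. *)
Lemma T3_pow3 : T3 (g5 ^ 3) = g5.
Proof.
have e : T3 (g5 ^ 3) ^ 2 = g5 * T3 (g5 ^ 3).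
  rewrite /T3 -Tp_pow2 //.
  have -> : (g5 ^ 3) ^ 2 = g5 ^ 4 * g5 ^ 2 by ring.
  rewrite -/T3 T3_rec T3_pow2 -/T3; have -> : g5 * g5 ^ 2 = g5 ^ 3 by ring.
  by ring.
case: (idempotent_cases e) => // y0.
have : T3 (g5 ^ 3) 5 = true.
  rewrite /T3 /Tp; have [_ ->] : lead (3 * 5) (g5 ^ 3) := lead_pow 3 lead_g5.
  by rewrite addbF.
by rewrite y0.
Qed.

Lemma T7_pow0 : T7 (g5 ^ 0) = 0. Proof. exact: Tp_one. Qed.
Lemma T7_pow1 : T7 (g5 ^ 1) = 0.
Proof. by have -> : g5 ^ 1 = g5 by [ring]; apply: Tp_theta_odd. Qed.
Lemma T7_pow_double n : T7 (g5 ^ (2 * n)) = T7 (g5 ^ n) ^ 2.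
Proof.
by rewrite /T7 -Tp_pow2 //; congr Tp; rewrite mul2n -addnn ppowD; ring.
Qed.
Lemma T7_pow_rec n :
  T7 (g5 ^ (n + 8)) = g5 ^ 8 * T7 (g5 ^ n) + g5 * T7 (g5 ^ n.+1) + g5 ^ 2 * T7 (g5 ^ n.+2).
Proof.
by rewrite addnC ppowD T7_rec -[n.+2]add2n -[n.+1]add1n !ppowD; have -> : g5 ^ 1 = g5 by ring.
Qed.
Lemma T3_pow_rec n :
  T3 (g5 ^ (n + 4)) = g5 ^ 4 * T3 (g5 ^ n) + g5 * T3 (g5 ^ n.+1).
Proof.
by rewrite addnC ppowD T3_rec -[n.+1]add1n !ppowD; have -> : g5 ^ 1 = g5 by ring.
Qed.

Lemma T7_pow2 : T7 (g5 ^ 2) = 0.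
Proof. by rewrite (T7_pow_double 1) T7_pow1; ring. Qed.
Lemma T7_pow4 : T7 (g5 ^ 4) = 0.
Proof. by rewrite (T7_pow_double 2) T7_pow2; ring. Qed.

(** Doubling exponents gives z^2 = G y and y^4 = G z + G^2 y^2. Lowest exponents a of y and b of z
    would satisfy 2b = 5 + a and 4a = 5 + b, hence 7a = 15. *)
Lemma T7_pow35 : T7 (g5 ^ 3) = 0 /\ T7 (g5 ^ 5) = 0.
Proof.
set y := T7 (g5 ^ 3); set z := T7 (g5 ^ 5).
have e1 : z ^ 2 = g5 * y.
  by rewrite /z -T7_pow_double -[(2 * 5)%N]/(2 + 8)%N T7_pow_rec T7_pow2 T7_pow4 -/y; ring.
have e2 : y ^ 4 = g5 * z + g5 ^ 2 * y ^ 2.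
  have -> : y ^ 4 = T7 (g5 ^ 12).
    by rewrite (T7_pow_double 6) (T7_pow_double 3) -/y; ring.
  by rewrite -[12]/(4 + 8)%N T7_pow_rec T7_pow4 (T7_pow_double 3) -/y -/z; ring.
suff y0 : y = 0.
  split=> //; have : z * z = 0 by transitivity (z ^ 2); [ring | rewrite e1 y0; ring].
  by case/pmul_eq0.
apply: NNPP => nz; have [a la] := lead_exists nz.
have z0 : z <> 0.
  move=> z0; apply: (pmul_neq0 g5_neq0 nz); rewrite -e1 z0; ring.
have [b lb] := lead_exists z0.
have l1 := lead_pow 2 lb; rewrite e1 in l1.
have := lead_uniq l1 (lead_mul lead_g5 la) => eb.
have l2 := lead_addl (lead_mul lead_g5 lb) (lead_mul (lead_pow 2 lead_g5) (lead_pow 2 la)).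
have {}l2 := l2 ltac:(lia); rewrite -e2 in l2.
have := lead_uniq l2 (lead_pow 4 la); lia.
Qed.

Lemma T7_pow3 : T7 (g5 ^ 3) = 0. Proof. by case: T7_pow35. Qed.
Lemma T7_pow5 : T7 (g5 ^ 5) = 0. Proof. by case: T7_pow35. Qed.
Lemma T7_pow6 : T7 (g5 ^ 6) = 0.
Proof. by rewrite (T7_pow_double 3) T7_pow3; ring. Qed.
Lemma T7_pow7 : T7 (g5 ^ 7) = g5.
Proof.
have e : T7 (g5 ^ 7) ^ 2 = g5 * T7 (g5 ^ 7).
  rewrite -T7_pow_double -[(2 * 7)%N]/(6 + 8)%N T7_pow_rec T7_pow6.
  by rewrite (T7_pow_rec 0) T7_pow0 T7_pow1 T7_pow2; ring.
case: (idempotent_cases e) => // y0.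
have : T7 (g5 ^ 7) 5 = true.
  rewrite /T7 /Tp; have [_ ->] : lead (7 * 5) (g5 ^ 7) := lead_pow 7 lead_g5.
  by rewrite addbF.
by rewrite y0.
Qed.

(** * The basis of W_a *)

Definition reduce2 (T : eqType) (L : seq T) : seq T :=
  [seq x <- undup L | odd (count_mem x L)].

Lemma sum_reduce2 (T : eqType) (E : T -> ps) (L : seq T) :
  \big[padd/pzero]_(x <- reduce2 L) E x = \big[padd/pzero]_(x <- L) E x.
Proof.
rewrite -[RHS]big_undup_iterop_count /reduce2 big_filter big_mkcond /=.
apply: eq_bigr => x _; case: (count_mem x L) => [|n] //=.
by elim: n => [|n IH] //=; rewrite -IH; case: (odd n); rewrite /= ?paddff // paddC padd0.
Qed.

Definition eval_g (L : seq nat) : ps := \big[padd/pzero]_(i <- L) g5 ^ i.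

Lemma eval_g_cat L M : eval_g (L ++ M) = eval_g L + eval_g M.
Proof. exact: big_cat. Qed.

Lemma eval_g_shift a L : eval_g (map (addn a) L) = g5 ^ a * eval_g L.
Proof.
rewrite /eval_g big_map; elim: L => [|x L IH]; rewrite ?big_nil ?big_cons; first by ring.
by rewrite IH ppowD; ring.
Qed.

Lemma eval_g_reduce2 L : eval_g (reduce2 L) = eval_g L.
Proof. exact: sum_reduce2. Qed.

(* Heads of the lists: the exponents in T_p(g^n) for the largest [n] reached. *)
Definition q3_step (l : seq (seq nat)) : seq (seq nat) :=
  reduce2 (map (addn 4) (nth [::] l 3) ++ map (addn 1) (nth [::] l 2)) :: l.
Definition q3_table (n : nat) := iter n q3_step [:: [:: 1%N]; [::]; [::]; [::]].
Definition q7_step (l : seq (seq nat)) : seq (seq nat) :=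
  reduce2 (map (addn 8) (nth [::] l 7) ++ map (addn 1) (nth [::] l 6)
    ++ map (addn 2) (nth [::] l 5)) :: l.
Definition q7_table (n : nat) :=
  iter n q7_step [:: [:: 1%N]; [::]; [::]; [::]; [::]; [::]; [::]; [::]].

Lemma q3_tableP n i : i < n + 4 -> T3 (g5 ^ (n + 3 - i)) = eval_g (nth [::] (q3_table n) i).
Proof.
elim: n i => [|n IH] i lt_i.
  rewrite /q3_table /=; case: i lt_i => [|[|[|[|//]]]] _;
    rewrite /eval_g /= ?big_nil ?big_seq1.
  - by rewrite T3_pow3; ring.
  - exact: T3_pow2.
  - exact: T3_pow1.
  - exact: T3_pow0.
case: i lt_i => [_|i lt_i]; last by rewrite -IH //; congr (T3 (_ ^ _)); lia.
rewrite /q3_table iterS -/(q3_table n) /q3_step [nth _ _ 0]/= eval_g_reduce2.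
rewrite eval_g_cat !eval_g_shift -!IH; try lia.
rewrite (_ : (n.+1 + 3 - 0 = n + 4)%N) ?T3_pow_rec; last by lia.
rewrite (_ : (n + 3 - 3 = n)%N); last by lia.
rewrite (_ : (n + 3 - 2 = n.+1)%N); last by lia.
by ring.
Qed.

Lemma q7_tableP n i : i < n + 8 -> T7 (g5 ^ (n + 7 - i)) = eval_g (nth [::] (q7_table n) i).
Proof.
elim: n i => [|n IH] i lt_i.
  rewrite /q7_table /=; case: i lt_i => [|[|[|[|[|[|[|[|//]]]]]]]] _;
    rewrite /eval_g /= ?big_nil ?big_seq1.
  - by rewrite T7_pow7; ring.
  - exact: T7_pow6.
  - exact: T7_pow5.
  - exact: T7_pow4.
  - exact: T7_pow3.
  - exact: T7_pow2.
  - exact: T7_pow1.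
  - exact: T7_pow0.
case: i lt_i => [_|i lt_i]; last by rewrite -IH //; congr (T7 (_ ^ _)); lia.
rewrite /q7_table iterS -/(q7_table n) /q7_step [nth _ _ 0]/= eval_g_reduce2.
rewrite !eval_g_cat !eval_g_shift -!IH; try lia.
rewrite (_ : (n.+1 + 7 - 0 = n + 8)%N) ?T7_pow_rec; last by lia.
rewrite (_ : (n + 7 - 7 = n)%N); last by lia.
rewrite (_ : (n + 7 - 6 = n.+1)%N); last by lia.
rewrite (_ : (n + 7 - 5 = n.+2)%N); last by lia.
by ring.
Qed.

(* The quotient D^8 / G exists because it is T_3 (D^4 G). *)
Lemma D8_quotient : T3 (d1 ^ 4 * g5) * g5 = d1 ^ 8.
Proof.
(* The relation of [conj3] for D_9, with g times d^8 / g written as d^8: the existence of the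
   quotient is what is being proved. *)
pose L := ([:: (3, 0, 0); (1, 3, 1)]%N : seq (nat * nat * nat)).
pose s := nth pzero [:: d1 ^ 8; d1 ^ 2 * g5].
pose s' := nth pzero [:: d3 ^ 8; d3 ^ 2 * g15].
have es j : s' j = Vp 3 (s j).
  case: j => [|[|j]]; rewrite /s /s' /= ?nth_nil ?Vp0 //.
    by rewrite VpX // Vp_theta.
  by rewrite (@VpM 3 (_ ^ _)) // VpX // !Vp_theta.
have ef : d3 ^ 4 * g15 = Vp 3 (d1 ^ 4 * g5).
  by rewrite (@VpM 3 (_ ^ _)) // VpX // !Vp_theta.
have e1 g k d e : g <> 0 -> k ^ 4 = g ^ 4 + g * k ->
    d ^ 16 = g ^ 4 * d ^ 4 + g ^ 3 * d -> g * e = d ^ 8 + k ^ 2 * d ^ 2 ->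
    g ^ 2 * (e ^ 4 * k) = conj_sum L g k (nth pzero [:: d ^ 8; d ^ 2 * g]).
  move=> ng hk hd he; rewrite /L; expand_sum; apply: (@pmulI (g ^ 2)); first exact: ppow_neq0.
  transitivity ((g * e) ^ 4 * k); first by ring.
  by rewrite he; ring [hk hd].
have := @T_of_conjugates 3 g5 L s s' (d1 ^ 4 * g5) (d3 ^ 4 * g15) 0 isT es ef.
rewrite Vp3_g5 => /(_ (e1 _ _ _ _ g5_neq0 modular3 d1_relation level15A)).
have e2 : g15 * d1 = d3 ^ 8 + g5 ^ 2 * d3 ^ 2 := level15B.
move=> /(_ (e1 _ _ _ _ g15_neq0 modular3_conj d3_relation e2)).
have one h : g5 ^ 0 * h = h by ring.
rewrite one !big_cons big_nil /= !add0n -!/T3 T3_pow3.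
have -> : T3 (g5 ^ 1) = 0 by exact: T3_pow1.
move=> e; apply: (@pmulI g5); first exact: g5_neq0.
transitivity (g5 ^ 2 * T3 (d1 ^ 4 * g5)); first by ring.
by rewrite e /s /=; ring.
Qed.

Definition Dr := quad g5 d1 (Dbase 3).

Lemma Dbase3 : Dbase 3 * g5 = d1 ^ 8.
Proof.
rewrite /Dbase /= /pdiv D_theta G_theta.
exact: (epsilon_spec (inhabits pzero) (fun h => pmul h g5 = d1 ^ 8) (ex_intro _ _ D8_quotient)).
Qed.

Lemma sD_base rho : rho < 4 -> Dr rho = Dbase (nth 0%N [:: 1; 3; 7; 9]%N rho).
Proof.
by case: rho => [|[|[|[|//]]]] _; rewrite /Dr /quad /= /Dbase /= ?D_theta ?G_theta.
Qed.

Lemma Vp_quad p g d s rho : 0 < p ->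
  Vp p (quad g d s rho) = quad (Vp p g) (Vp p d) (Vp p s) rho.
Proof.
move=> p0; case: rho => [|[|[|[|rho]]]]; rewrite /quad /= ?nth_nil ?Vp0 //.
- by rewrite (@VpM p (_ ^ _)) // VpX.
- by rewrite (@VpM p (_ ^ _)) // VpX.
Qed.

Lemma T3_conj n rho : rho < 4 ->
  g5 ^ 2 * T3 (g5 ^ n * Dr rho) =
  \big[padd/pzero]_(x <- conj3 rho) (g5 ^ x.1.2 * T3 (g5 ^ (n + x.1.1)) * Dr x.2).
Proof.
move=> h; pose s3 := Vp 3 (Dbase 3).
have hs' : s3 * g15 = d3 ^ 8.
  by have := congr1 (Vp 3) Dbase3; rewrite VpM // VpX // !Vp_theta.
have sE j : quad g15 d3 s3 j = Vp 3 (Dr j) by rewrite Vp_quad // !Vp_theta.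
have := @T_of_conjugates 3 g5 (conj3 rho) Dr (quad g15 d3 s3) (Dr rho)
  (quad g15 d3 s3 rho) n isT sE (sE rho).
rewrite Vp3_g5 => red.
exact: (red (conj3P g5_neq0 g15_neq0 modular3 d1_relation level15A Dbase3 hs' h)
  (conj3P g15_neq0 g5_neq0 modular3_conj d3_relation level15B hs' Dbase3 h)).
Qed.

Lemma T7_conj n rho : rho < 4 ->
  g5 ^ 2 * T7 (g5 ^ n * Dr rho) =
  \big[padd/pzero]_(x <- conj7 rho) (g5 ^ x.1.2 * T7 (g5 ^ (n + x.1.1)) * Dr x.2).
Proof.
move=> h; pose s7 := Vp 7 (Dbase 3).
have hs' : s7 * g35 = d7 ^ 8.
  by have := congr1 (Vp 7) Dbase3; rewrite VpM // VpX // !Vp_theta.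
have sE j : quad g35 d7 s7 j = Vp 7 (Dr j) by rewrite Vp_quad // !Vp_theta.
have := @T_of_conjugates 7 g5 (conj7 rho) Dr (quad g35 d7 s7) (Dr rho)
  (quad g35 d7 s7 rho) n isT sE (sE rho).
rewrite Vp7_g5 => red.
exact: (red (conj7P g5_neq0 g35_neq0 modular7 d1_relation level35A Dbase3 hs' h)
  (conj7P g35_neq0 g5_neq0 modular7_conj d7_relation level35B hs' Dbase3 h)).
Qed.

(* [basis c] is D_k for the c-th index k of W_a. *)
Definition basis (c : nat) : ps := g5 ^ (4 * (c %/ 4)) * Dr (c %% 4).

Definition eval_pairs (L : seq (nat * nat)) : ps := \big[padd/pzero]_(x <- L) (g5 ^ x.1 * Dr x.2).

(** A pair (u, v) stands for g^u D_v and still carries the factor g^2 of the conjugate relations;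
    hence the u - 2 in [image_codes] and the test 4 | u - 2 in [image_ok], which says that the image
    is a combination of the [basis]. *)
Definition image_pairs (conj : nat -> seq (nat * nat * nat)) (q : nat -> seq nat) (c : nat) :=
  reduce2 (flatten [seq [seq ((x.1.2 + i)%N, x.2) | i <- q (4 * (c %/ 4) + x.1.1)%N] | x <- conj (c %% 4)]).

Definition image_codes conj q c : seq nat :=
  [seq (x.1 - 2 + x.2)%N | x <- image_pairs conj q c].

Definition image_ok conj q c : bool :=
  all (fun x : nat * nat => [&& 2 <= x.1, 4 %| x.1 - 2 & x.2 < 4]) (image_pairs conj q c).

Lemma image_codesP p conj q c :
    (forall n, n < 80 -> Tp p (g5 ^ n) = eval_g (q n)) ->
    (forall x, x \in conj (c %% 4) -> x.1.1 < 8) -> c < 64 ->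
    (forall n, g5 ^ 2 * Tp p (g5 ^ n * Dr (c %% 4)) = 
      \big[padd/pzero]_(x <- conj (c %% 4)) (g5 ^ x.1.2 * Tp p (g5 ^ (n + x.1.1)) * Dr x.2)) ->
    image_ok conj q c ->
  Tp p (basis c) = \big[padd/pzero]_(c' <- image_codes conj q c) basis c'.
Proof.
move=> hq hc c64 hT /allP ok; apply: (@pmulI (g5 ^ 2)); first exact: ppow_neq0 g5_neq0.
rewrite /basis hT; transitivity (eval_pairs (image_pairs conj q c)).
  rewrite /eval_pairs /image_pairs sum_reduce2 big_flatten /= big_map.
  rewrite big_seq [RHS]big_seq; apply: eq_bigr => x xc; rewrite big_map /=.
  rewrite hq; last by (have h1 : (4 * (c %/ 4) <= 63)%N by lia); move: (hc x xc) => h2; apply: (@leq_ltn_trans (63 + 7)%N) => //; apply: leq_add.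
  rewrite /eval_g; elim: (q _) => [|i L IH]; rewrite ?big_nil ?big_cons; first by ring.
  by rewrite -IH ppowD; ring.
rewrite /image_codes big_map /eval_pairs; move: ok.
elim: (image_pairs conj q c) => [|x L IH] ok; rewrite ?big_nil ?big_cons; first by ring.
rewrite IH; last by move=> y yL; apply: ok; rewrite inE yL orbT.
have /and3P[h2 /dvdnP[m em] h4] := ok x (mem_head _ _).
case: x h2 em h4 {ok} => u v /= h2 em h4.
rewrite (_ : ((u - 2 + v) %/ 4)%N = m); last by lia.
rewrite (_ : ((u - 2 + v) %% 4)%N = v); last by lia.
rewrite (_ : u = (2 + 4 * m)%N) ?ppowD; last by lia.
by ring.
Qed.

Definition q3_list := Eval vm_compute in rev (q3_table 80).
Definition q7_list := Eval vm_compute in rev (q7_table 80).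
Definition q3 (n : nat) : seq nat := nth [::] q3_list n.
Definition q7 (n : nat) : seq nat := nth [::] q7_list n.

Lemma size_q3_table n : size (q3_table n) = (n + 4)%N.
Proof. by elim: n => [|n IH] //; rewrite /q3_table iterS /= -/(q3_table n) IH. Qed.
Lemma size_q7_table n : size (q7_table n) = (n + 8)%N.
Proof. by elim: n => [|n IH] //; rewrite /q7_table iterS /= -/(q7_table n) IH. Qed.

Lemma q3P n : n < 80 -> T3 (g5 ^ n) = eval_g (q3 n).
Proof.
move=> lt_n; rewrite /q3 (_ : q3_list = rev (q3_table 80)) ?nth_rev ?size_q3_table; [| lia | by vm_compute].
by rewrite -q3_tableP; [congr (T3 (_ ^ _)) |]; lia.
Qed.

Lemma q7P n : n < 80 -> T7 (g5 ^ n) = eval_g (q7 n).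
Proof.
move=> lt_n; rewrite /q7 (_ : q7_list = rev (q7_table 80)) ?nth_rev ?size_q7_table; [| lia | by vm_compute].
by rewrite -q7_tableP; [congr (T7 (_ ^ _)) |]; lia.
Qed.

Definition T3_list := Eval vm_compute in map (image_codes conj3 q3) (iota 0 64).
Definition T7_list := Eval vm_compute in map (image_codes conj7 q7) (iota 0 64).

Definition sum_basis (L : seq nat) : ps := \big[padd/pzero]_(c <- L) basis c.

Lemma T3_basis c : c < 64 -> T3 (basis c) = sum_basis (nth [::] T3_list c).
Proof.
move=> lt_c.
have -> : T3_list = map (image_codes conj3 q3) (iota 0 64) by vm_compute.
rewrite (nth_map 0%N) ?size_iota // nth_iota // add0n; apply: image_codesP => //.
- exact: q3P.
- by move=> x; have : c %% 4 < 4 by [rewrite ltn_mod]; case: (c %% 4) => [|[|[|[|//]]]] _;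
    rewrite !inE; do 1?[case/orP]; do ?[case/orP]; move=> /eqP->.
- by move=> n; apply: T3_conj; rewrite ltn_mod.
have : all (image_ok conj3 q3) (iota 0 64) by vm_compute.
by move/allP; apply; rewrite mem_iota.
Qed.

Lemma T7_basis c : c < 64 -> T7 (basis c) = sum_basis (nth [::] T7_list c).
Proof.
move=> lt_c.
have -> : T7_list = map (image_codes conj7 q7) (iota 0 64) by vm_compute.
rewrite (nth_map 0%N) ?size_iota // nth_iota // add0n; apply: image_codesP => //.
- exact: q7P.
- have /allP h : all (fun x : nat * nat * nat => x.1.1 < 8) (flatten (map conj7 (iota 0 4))) by [].
  move=> x xc; apply: h; apply/flattenP; exists (conj7 (c %% 4)) => //.
  by apply: map_f; rewrite mem_iota add0n ltn_mod.
- by move=> n; apply: T7_conj; rewrite ltn_mod.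
have : all (image_ok conj7 q7) (iota 0 64) by vm_compute.
by move/allP; apply; rewrite mem_iota.
Qed.

Lemma basis_shift m c : g5 ^ (4 * m) * basis c = basis (c + 4 * m)%N.
Proof.
rewrite /basis [(c + _)%N]addnC mulnC -[(m * 4 + c)%N]/(m * 4 + c)%N.
rewrite divnMDl // modnMDl mulnDr ppowD [(m * 4)%N]mulnC; ring.
Qed.

Definition idx (c : nat) : nat := 20 * (c %/ 4) + nth 0%N [:: 1; 3; 7; 9]%N (c %% 4).

Lemma Dk_basis c : Dk (idx c) = basis c.
Proof.
rewrite /Dk /basis; have h : c %% 4 < 4 by rewrite ltn_mod.
rewrite (sD_base h) G_theta.
have [e1 e2] : (idx c %/ 10 = 2 * (c %/ 4))%N /\
    (idx c %% 10 = nth 0 [:: 1; 3; 7; 9] (c %% 4))%N.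
  by rewrite /idx; move: (c %/ 4) h => m; case: (c %% 4) => [|[|[|[|]]]] //= _; split; lia.
have e3 : (2 * (2 * (c %/ 4)) = 4 * (c %/ 4))%N by lia.
rewrite e1 e2 e3; reflexivity.
Qed.

Lemma idx_idx_a c : idx_a (idx c).
Proof.
rewrite /idx_a /idx (mulnC 20%N) modnMDl; have : c %% 4 < 4 by rewrite ltn_mod.
by case: (c %% 4) => [|[|[|[|//]]]].
Qed.

(** * Heights *)

Local Close Scope ps_scope.

(* Each base-4 digit is weighted 0, 1, 1, 2: bit [e] of the argument contributes [2 ^ (e / 2)]. *)
Definition digit_weight (d : nat) : nat := nth 0 [:: 0; 1; 1; 2] d.

Fixpoint height_rec (fuel n : nat) : nat :=
  if fuel is k.+1 then
    if n == 0 then 0 else digit_weight (n %% 4) + 2 * height_rec k (n %/ 4)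
  else 0.
Definition height (n : nat) : nat := height_rec n n.

Lemma height_rec_fuel k n : n <= k -> height_rec k n = height_rec n n.
Proof.
elim/ltn_ind: n k => n IH [|k]; first by rewrite leqn0 => /eqP->.
case: n IH => [|n] IH //= le_nk; congr (_ + 2 * _).
by rewrite IH ?[in RHS]IH //; lia.
Qed.

Lemma heightE n : height n = digit_weight (n %% 4) + 2 * height (n %/ 4).
Proof.
rewrite /height; case: n => [|n] //=; congr (_ + 2 * _).
by rewrite height_rec_fuel //; lia.
Qed.

Lemma height4 n : height (4 * n) = 2 * height n.
Proof. by rewrite heightE mulnC modnMl mulnK. Qed.

Lemma heightS n : height n.+1 <= (height n).+1.
Proof.
elim/ltn_ind: n => n IH; rewrite heightE [height n]heightE.
have h : n %% 4 < 4 by rewrite ltn_mod.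
have [e|ne] := eqVneq (n %% 4) 3.
  rewrite (_ : n.+1 %% 4 = 0) 1?(_ : n.+1 %/ 4 = (n %/ 4).+1) ?e; try lia.
  by have := IH (n %/ 4); rewrite /digit_weight /=; lia.
rewrite (_ : n.+1 %/ 4 = n %/ 4) 1?(_ : n.+1 %% 4 = (n %% 4).+1); try lia.
by case: (n %% 4) h ne => [|[|[|[|]]]] //= _ _; rewrite /digit_weight /=; lia.
Qed.

(** The digit weights 0, 1, 1, 2 are subadditive, and a carry, which costs at most 2 by [heightS],
    is paid for by the two digits that produce it. *)
Lemma heightD a b : height (a + b) <= height a + height b.
Proof.
elim/ltn_ind: a b => a IH b.
have [->|a0] := posnP a; first by rewrite add0n leq_addl.
rewrite heightE [height a]heightE [height b]heightE.
have ha : a %% 4 < 4 by rewrite ltn_mod.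
have hb : b %% 4 < 4 by rewrite ltn_mod.
have lt_a : a %/ 4 < a by lia.
have i0 := IH _ lt_a (b %/ 4).
have i1 := heightS (a %/ 4 + b %/ 4).
have [h|h] := ltnP (a %% 4 + b %% 4) 4.
  rewrite (_ : (a + b) %/ 4 = a %/ 4 + b %/ 4); last by lia.
  rewrite (_ : (a + b) %% 4 = a %% 4 + b %% 4); last by lia.
  move: ha hb h i0 {IH i1 lt_a a0}; move: (height _) (height _) (height _) => x y z.
  by case: (a %% 4) => [|[|[|[|]]]] //=; case: (b %% 4) => [|[|[|[|]]]] //= *;
    rewrite /digit_weight /=; lia.
rewrite (_ : (a + b) %/ 4 = (a %/ 4 + b %/ 4).+1); last by lia.
rewrite (_ : (a + b) %% 4 = a %% 4 + b %% 4 - 4); last by lia.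
move: ha hb h i0 i1 {IH lt_a a0}; move: (height _) (height _) (height _) (height _) => x y z t.
by case: (a %% 4) => [|[|[|[|]]]] //=; case: (b %% 4) => [|[|[|[|]]]] //= *;
  rewrite /digit_weight /=; lia.
Qed.

Lemma height_top e c : c < 2 ^ e -> height (2 ^ e + c) = 2 ^ (e %/ 2) + height c.
Proof.
elim/ltn_ind: e c => -[|[|e]] IH c lt_c.
- by case: c lt_c.
- by case: c lt_c => [|[|]].
rewrite heightE [height c]heightE.
have e4 : 2 ^ e.+2 = 4 * 2 ^ e by rewrite !expnS; lia.
rewrite e4 in lt_c *.
rewrite (_ : (4 * 2 ^ e + c) %/ 4 = 2 ^ e + c %/ 4); last by lia.
rewrite (_ : (4 * 2 ^ e + c) %% 4 = c %% 4); last by lia.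
rewrite IH //; last by lia.
rewrite (_ : e.+2 %/ 2 = (e %/ 2).+1); last by lia.
by rewrite expnS; lia.
Qed.

Lemma height_pow e : height (2 ^ e) = 2 ^ (e %/ 2).
Proof. by rewrite -[2 ^ e]addn0 height_top ?addn0 // expn_gt0. Qed.

Lemma top_bit c : 0 < c -> exists e c', c = 2 ^ e + c' /\ c' < 2 ^ e.
Proof.
move=> c0; have /andP[h1 h2] := trunc_log_bounds (isT : 1 < 2) c0.
exists (trunc_log 2 c), (c - 2 ^ trunc_log 2 c); split; first by lia.
by move: h2; rewrite expnS; lia.
Qed.

Lemma exp2_half e : (2 ^ (e.+2 %/ 2) = 2 * 2 ^ (e %/ 2)) * (2 * 2 ^ (e %/ 2) <= 2 ^ (e.+3 %/ 2)).
Proof.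
split; first by rewrite (_ : e.+2 %/ 2 = (e %/ 2).+1) ?expnS //; lia.
by rewrite -expnS leq_exp2l //; lia.
Qed.

Local Open Scope ps_scope.

(** The bound is strict, so that [span 0] is zero and each of T_3 and T_7 maps [span d.+1] to
    [span d]. *)
Definition span (d : nat) (f : ps) : Prop :=
  exists2 L, all (fun c => height c < d) L & f = sum_basis L.

Lemma sum_basis_cat L M : sum_basis (L ++ M) = sum_basis L + sum_basis M.
Proof. exact: big_cat. Qed.

Lemma sum_basis1 c : sum_basis [:: c] = basis c.
Proof. exact: big_seq1. Qed.

Lemma sum_basis_shift m L : g5 ^ (4 * m) * sum_basis L = sum_basis (map (addn (4 * m)) L).
Proof.
rewrite /sum_basis big_map; elim: L => [|c L IH]; rewrite ?big_nil ?big_cons; first by ring.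
by rewrite -IH [(4 * m + c)%N]addnC -basis_shift; ring.
Qed.

Lemma span_pzero d : span d 0.
Proof. by exists [::] => //; rewrite /sum_basis big_nil. Qed.

Lemma span_add d f g : span d f -> span d g -> span d (f + g).
Proof.
by move=> [L hL ->] [M hM ->]; exists (L ++ M); rewrite ?all_cat ?hL // sum_basis_cat.
Qed.

Lemma span_leq d d' f : d <= d' -> span d f -> span d' f.
Proof.
move=> le_d [L /allP hL ->]; exists L => //; apply/allP => c /hL h; exact: leq_trans h le_d.
Qed.

Lemma span0 f : span 0 f -> f = 0.
Proof. by move=> [[|c L] //= _ ->]; rewrite /sum_basis big_nil. Qed.

Lemma span_basis d c : height c < d -> span d (basis c).
Proof. by move=> h; exists [:: c]; rewrite /= ?h // sum_basis1. Qed.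

Lemma span_mul_pow d m f : span d f -> span (d + height (4 * m)) (g5 ^ (4 * m) * f).
Proof.
move=> [L /allP hL ->]; exists (map (addn (4 * m)) L); last exact: sum_basis_shift.
rewrite all_map; apply/allP => c /hL h /=; have := heightD (4 * m) c; lia.
Qed.

Lemma span_pow2 d e f : 2 <= e -> span d f -> span (d + 2 ^ (e %/ 2)) (g5 ^ (2 ^ e) * f).
Proof.
move=> e2 h; have -> : (2 ^ e = 4 * 2 ^ (e - 2))%N.
  by rewrite -[in LHS](subnK e2) addnC expnD.
have := span_mul_pow (2 ^ (e - 2)) h.
by rewrite (_ : (4 * 2 ^ (e - 2) = 2 ^ e)%N) ?height_pow // -[in RHS](subnK e2) addnC expnD.
Qed.

Lemma basis_pow2 e c : 2 <= e -> g5 ^ (2 ^ e) * basis c = basis (2 ^ e + c)%N.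
Proof.
move=> e2; have -> : (2 ^ e = 4 * 2 ^ (e - 2))%N.
  by rewrite -[in LHS](subnK e2) addnC expnD.
by rewrite basis_shift addnC.
Qed.

Definition additive_map (O : ps -> ps) : Prop :=
  O 0 = 0 /\ forall f g, O (f + g) = O f + O g.

Lemma additive_sum O L : additive_map O -> O (sum_basis L) = \big[padd/pzero]_(c <- L) O (basis c).
Proof.
move=> [O0 OD]; elim: L => [|c L IH]; rewrite /sum_basis ?big_nil ?big_cons //.
by rewrite OD -IH.
Qed.

Lemma span_image O d d' f : additive_map O ->
  (forall c, height c < d -> span d' (O (basis c))) -> span d f -> span d' (O f).
Proof.
move=> aO hO [L hL ->]; rewrite additive_sum //.
elim: L hL => [|c L IH] /=; first by rewrite big_nil => _; apply: span_pzero.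
by move=> /andP[hc hL]; rewrite big_cons; apply: span_add; [apply: hO | apply: IH].
Qed.

Lemma T3_additive : additive_map T3.
Proof. by split; [apply: Tp0 | move=> f g; apply: TpD]. Qed.
Lemma T7_additive : additive_map T7.
Proof. by split; [apply: Tp0 | move=> f g; apply: TpD]. Qed.

(** Let L and R multiply by u after and before T_3. These commute, and the recurrence says that R^4
    + L^4 + L R kills T_3; squaring this polynomial gives the recurrence for u^2. [T7_rec2] is the
    same with R^8 + L^8 + L R + L^2 R^2. *)
Lemma T3_rec2 s f :
  T3 (g5 ^ (2 ^ s.+2) * f) = g5 ^ (2 ^ s.+2) * T3 f + g5 ^ (2 ^ s) * T3 (g5 ^ (2 ^ s) * f).
Proof.
have -> : (2 ^ s.+2 = 2 ^ s * 4)%N by rewrite !expnS; lia.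
elim: s f => [|s IH] f.
  rewrite expn0 mul1n T3_rec; have -> : g5 ^ 1 = g5 by ring.
  by [].
have powM m n : g5 ^ (m * n) = (g5 ^ m) ^ n.
  by elim: n => [|n IHn]; rewrite ?muln0 // mulnS ppowD IHn.
move: IH; rewrite expnS [(2 * 2 ^ s)%N]mulnC !powM; set u := g5 ^ (2 ^ s) => IH.
have -> : (u ^ 2) ^ 4 * f = u ^ 4 * (u ^ 4 * f) by ring.
rewrite IH [T3 (u ^ 4 * f)]IH.
have -> : u * (u ^ 4 * f) = u ^ 4 * (u * f) by ring.
rewrite IH; have -> : u ^ 2 * f = u * (u * f) by ring.
by ring.
Qed.

Lemma T7_rec2 s f :
  T7 (g5 ^ (2 ^ s.+3) * f) = g5 ^ (2 ^ s.+3) * T7 f +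
    g5 ^ (2 ^ s) * T7 (g5 ^ (2 ^ s) * f) + g5 ^ (2 ^ s.+1) * T7 (g5 ^ (2 ^ s.+1) * f).
Proof.
have -> : (2 ^ s.+3 = 2 ^ s * 8)%N by rewrite !expnS; lia.
have -> : (2 ^ s.+1 = 2 ^ s * 2)%N by rewrite !expnS; lia.
have powM m n : g5 ^ (m * n) = (g5 ^ m) ^ n.
  by elim: n => [|n IHn]; rewrite ?muln0 // mulnS ppowD IHn.
elim: s f => [|s IH] f.
  rewrite expn0 !mul1n T7_rec; have -> : g5 ^ 1 = g5 by ring.
  by [].
move: IH; rewrite expnS [(2 * 2 ^ s)%N]mulnC !powM; set u := g5 ^ (2 ^ s) => IH.
have -> : (u ^ 2) ^ 8 * f = u ^ 8 * (u ^ 8 * f) by ring.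
rewrite IH [T7 (u ^ 8 * f)]IH.
have -> : u * (u ^ 8 * f) = u ^ 8 * (u * f) by ring.
have -> : u ^ 2 * (u ^ 8 * f) = u ^ 8 * (u ^ 2 * f) by ring.
rewrite !IH.
have -> : u * (u ^ 2 * f) = u ^ 3 * f by ring.
have -> : u ^ 2 * (u * f) = u ^ 3 * f by ring.
have -> : u * (u * f) = u ^ 2 * f by ring.
have -> : u ^ 2 * (u ^ 2 * f) = (u ^ 2) ^ 2 * f by ring.
by ring.
Qed.

(** Induction on the code, splitting off its top bit e: the recurrence replaces it by bit e-2 once
    inside and once outside T_3, and these two weights add up to that of e. *)
Lemma T3_span_basis c : span (height c) (T3 (basis c)).
Proof.
elim/ltn_ind: c => c IH; have [lt_c|le_c] := ltnP c 16.
  rewrite T3_basis; last by exact: leq_trans lt_c _.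
  exists (nth [::] T3_list c) => //.
  have /allP h : all (fun c => all (fun b => height b < height c) (nth [::] T3_list c)) (iota 0 16).
    by vm_compute.
  by apply: h; rewrite mem_iota.
have c0 : 0 < c by lia.
have [e [c' [ec lt_c']]] := top_bit c0.
(* Then bits e and e-2 are both multiples of 4, that is, powers of t acting on codes. *)
have e4 : 4 <= e.
  by rewrite leqNgt; apply/negP => h; have : 2 ^ e <= 2 ^ 3 by [rewrite leq_exp2l]; lia.
case: e e4 ec lt_c' => [|[|[|[|s]]]] // _ ec lt_c'; have [hv1 _] := exp2_half s.+2.
have p1 : 0 < 2 ^ s by rewrite expn_gt0.
have p2 : (2 ^ s.+4 = 16 * 2 ^ s)%N by rewrite !expnS; lia.
have p3 : (2 ^ s.+2 = 4 * 2 ^ s)%N by rewrite !expnS; lia.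
rewrite ec height_top // -basis_pow2 // T3_rec2 basis_pow2 // addnC.
apply: span_add; first by apply: span_pow2 => //; apply: IH; lia.
have hD := heightD (2 ^ s.+2) c'; rewrite height_pow in hD.
have := @span_pow2 _ s.+2 _ isT (IH (2 ^ s.+2 + c')%N _).
move=> h; apply: span_leq (h _); lia.
Qed.

(** Same induction: twice the weight of bit e-2 is the weight of bit e, and twice that of bit e-3 is
    at most that. *)
Lemma T7_span_basis c : span (height c) (T7 (basis c)).
Proof.
elim/ltn_ind: c => c IH; have [lt_c|le_c] := ltnP c 32.
  rewrite T7_basis; last by exact: leq_trans lt_c _.
  exists (nth [::] T7_list c) => //.
  have /allP h : all (fun c => all (fun b => height b < height c) (nth [::] T7_list c)) (iota 0 32).
    by vm_compute.
  by apply: h; rewrite mem_iota.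
have c0 : 0 < c by lia.
have [e [c' [ec lt_c']]] := top_bit c0.
have e5 : 5 <= e.
  by rewrite leqNgt; apply/negP => h; have : 2 ^ e <= 2 ^ 4 by [rewrite leq_exp2l]; lia.
case: e e5 ec lt_c' => [|[|[|[|[|s]]]]] // _ ec lt_c'; have [hv1 hv2] := exp2_half s.+2.
have [hv3 _] := exp2_half s.+3.
have p1 : 0 < 2 ^ s by rewrite expn_gt0.
have p2 : (2 ^ s.+4.+1 = 32 * 2 ^ s)%N by rewrite !expnS; lia.
have p3 : (2 ^ s.+2 = 4 * 2 ^ s)%N by rewrite !expnS; lia.
have p4 : (2 ^ s.+3 = 8 * 2 ^ s)%N by rewrite !expnS; lia.
rewrite ec height_top // -basis_pow2 // T7_rec2 !basis_pow2 // addnC.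
apply: span_add; first apply: span_add.
- by apply: span_pow2 => //; apply: IH; lia.
- have hD := heightD (2 ^ s.+2) c'; rewrite height_pow in hD.
  have h := @span_pow2 _ s.+2 _ isT (IH (2 ^ s.+2 + c')%N _).
  apply: span_leq (h _); lia.
have hD := heightD (2 ^ s.+3) c'; rewrite height_pow in hD.
have h := @span_pow2 _ s.+3 _ isT (IH (2 ^ s.+3 + c')%N _).
apply: span_leq (h _); lia.
Qed.

Lemma T3_span d f : span d.+1 f -> span d (T3 f).
Proof.
apply: span_image T3_additive _ => c h; apply: span_leq (T3_span_basis c); exact: h.
Qed.

Lemma T7_span d f : span d.+1 f -> span d (T7 f).
Proof.
apply: span_image T7_additive _ => c h; apply: span_leq (T7_span_basis c); exact: h.
Qed.

(** * Commutators with multiplication by powers of G *)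

Definition shift (m : nat) (f : ps) : ps := g5 ^ (4 * m) * f.

Lemma shift_additive m : additive_map (shift m).
Proof. by split=> [|f g]; rewrite /shift; ring. Qed.

Lemma shiftD m f g : shift m (f + g) = shift m f + shift m g.
Proof. by rewrite /shift; ring. Qed.

Lemma shift_shift m n f : shift m (shift n f) = shift (m + n) f.
Proof. by rewrite /shift mulnDr ppowD; ring. Qed.

Lemma shiftC m n f : shift m (shift n f) = shift n (shift m f).
Proof. by rewrite /shift; ring. Qed.

Lemma shift0 f : shift 0 f = f.
Proof. by rewrite /shift muln0 pmul1. Qed.

Lemma shift_basis m c : shift m (basis c) = basis (4 * m + c)%N.
Proof. by rewrite /shift basis_shift addnC. Qed.

Lemma shift_sum_basis m L : shift m (sum_basis L) = sum_basis (map (addn (4 * m)) L).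
Proof. exact: sum_basis_shift. Qed.

Lemma span_shift d m f : span d f -> span (d + 2 * height m) (shift m f).
Proof. by move=> h; rewrite -height4; apply: span_mul_pow. Qed.

Lemma T3_shift s f :
  T3 (shift (4 * 2 ^ s) f) = shift (4 * 2 ^ s) (T3 f) + shift (2 ^ s) (T3 (shift (2 ^ s) f)).
Proof.
have := T3_rec2 s.+2 f; rewrite /shift.
have -> : (2 ^ s.+4 = 4 * (4 * 2 ^ s))%N by rewrite !expnS; lia.
have -> : (2 ^ s.+2 = 4 * 2 ^ s)%N by rewrite !expnS; lia.
by [].
Qed.

Lemma T7_shift s f :
  T7 (shift (8 * 2 ^ s) f) = shift (8 * 2 ^ s) (T7 f) + shift (2 ^ s) (T7 (shift (2 ^ s) f)) +
    shift (2 * 2 ^ s) (T7 (shift (2 * 2 ^ s) f)).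
Proof.
have := T7_rec2 s.+2 f; rewrite /shift.
have -> : (2 ^ s.+4.+1 = 4 * (8 * 2 ^ s))%N by rewrite !expnS; lia.
have -> : (2 ^ s.+3 = 4 * (2 * 2 ^ s))%N by rewrite !expnS; lia.
have -> : (2 ^ s.+2 = 4 * 2 ^ s)%N by rewrite !expnS; lia.
by [].
Qed.

(** T_3 t^l T_7. It obeys the T_3 recurrence in l, by [K_rec], and the T_7 recurrence in its
    argument, by [K_shift]. *)
Definition K (l : nat) (f : ps) : ps := T3 (shift l (T7 f)).

Lemma K_rec s l f :
  K (l + 4 * 2 ^ s) f = shift (4 * 2 ^ s) (K l f) + shift (2 ^ s) (K (l + 2 ^ s) f).
Proof. by rewrite /K addnC -shift_shift T3_shift shift_shift addnC. Qed.

Lemma T3_add f g : T3 (f + g) = T3 f + T3 g. Proof. exact: TpD. Qed.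
Lemma T7_add f g : T7 (f + g) = T7 f + T7 g. Proof. exact: TpD. Qed.

Lemma K_shift s l f :
  K l (shift (8 * 2 ^ s) f) = K (l + 8 * 2 ^ s) f + K (l + 2 ^ s) (shift (2 ^ s) f) +
    K (l + 2 * 2 ^ s) (shift (2 * 2 ^ s) f).
Proof. by rewrite /K T7_shift !shiftD !T3_add !shift_shift. Qed.

(* [commL l] is, up to smaller heights, the commutator of [K l] with [shift 1]; it obeys the same
   recurrence in [l] as [K l]. *)
Definition commL_base (l c : nat) : seq nat :=
  match l with
  | 0 => [:: c]
  | 1 => [:: (4 + c)%N]
  | 2 => (8 + c)%N :: match c %% 4 with 1 => [:: (4 + c).+1] | 2 => [:: (c + 3)%N] | _ => [::] end
  | _ => (12 + c)%N :: match c %% 4 with 0 => [:: (c + 7)%N] | _ => [::] end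
  end.

(** Adding 16 and 4 to a code is multiplication by t^4 and t, the two factors in the T_3
    recurrence. *)
Fixpoint commL_codes (l c : nat) : seq nat :=
  match l with
  | S (S (S ((S m) as m1))) => map (addn 16) (commL_codes m c) ++ map (addn 4) (commL_codes m1 c)
  | _ => commL_base l c
  end.
Definition commL (l c : nat) : ps := sum_basis (commL_codes l c).

Lemma ind4 (Q : nat -> Prop) : (forall l, l < 4 -> Q l) ->
  (forall l, Q l -> Q l.+1 -> Q (l + 4)%N) -> forall l, Q l.
Proof.
move=> hb hs; elim/ltn_ind => l IH; have [/hb //|h] := ltnP l 4.
by rewrite -(subnK h); apply: hs; apply: IH; lia.
Qed.

Lemma commL_codes4 l c :
  commL_codes (l + 4) c = map (addn 16) (commL_codes l c) ++ map (addn 4) (commL_codes l.+1 c).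
Proof. by rewrite addn4. Qed.

Lemma commL_rec0 l c : commL (l + 4) c = shift 4 (commL l c) + shift 1 (commL l.+1 c).
Proof. by rewrite /commL commL_codes4 sum_basis_cat !shift_sum_basis. Qed.

Lemma commL_codes_shift l m c :
  commL_codes l (4 * m + c) = map (addn (4 * m)) (commL_codes l c).
Proof.
elim/ind4: l => [l h4|l h0 h1].
  have e : ((4 * m + c) %% 4 = c %% 4)%N by lia.
  case: l h4 => [|[|[|[|//]]]] _; rewrite /= /commL_base ?e //=.
  - by congr [:: _]; lia.
  - by case: (c %% 4) => [|[|[|k]]] /=; do ?[congr (_ :: _)]; lia.
  by case: (c %% 4) => [|k] /=; do ?[congr (_ :: _)]; lia.
rewrite !commL_codes4 h0 h1 map_cat -!map_comp.
by congr (_ ++ _); apply: eq_map => x /=; lia.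
Qed.

Lemma commL_shift l m c : commL l (4 * m + c) = shift m (commL l c).
Proof. by rewrite /commL commL_codes_shift shift_sum_basis. Qed.

(** Passing from 2^s to 2^(s+1) squares the recurrence polynomial; the cross terms cancel. *)
Lemma commL_rec s l c :
  commL (l + 4 * 2 ^ s) c = shift (4 * 2 ^ s) (commL l c) + shift (2 ^ s) (commL (l + 2 ^ s) c).
Proof.
elim: s l => [|s IH] l; first by rewrite muln1 addn1 commL_rec0.
have -> : (l + 4 * 2 ^ s.+1 = (l + 4 * 2 ^ s) + 4 * 2 ^ s)%N by rewrite expnS; lia.
rewrite IH [commL (l + _) c]IH.
have -> : (l + 4 * 2 ^ s + 2 ^ s = (l + 2 ^ s) + 4 * 2 ^ s)%N by lia.
rewrite [commL (l + 2 ^ s + _) c]IH !shiftD !shift_shift.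
have -> : (l + 2 ^ s + 2 ^ s = l + 2 ^ s.+1)%N by rewrite expnS; lia.
have -> : (2 ^ s + 2 ^ s = 2 ^ s.+1)%N by rewrite expnS; lia.
have -> : (4 * 2 ^ s + 4 * 2 ^ s = 4 * 2 ^ s.+1)%N by rewrite expnS; lia.
by rewrite [(4 * 2 ^ s + 2 ^ s)%N]addnC; ring.
Qed.

(* The bound on a family satisfying the recurrence of [T3] only needs checking at [l < 4]. *)
Lemma span_of_rec (E : nat -> ps) d :
    (forall s l, E (l + 4 * 2 ^ s)%N = shift (4 * 2 ^ s) (E l) + shift (2 ^ s) (E (l + 2 ^ s)%N)) ->
    (forall l, l < 4 -> span (2 * height l + d) (E l)) ->
  forall l, span (2 * height l + d) (E l).
Proof.
move=> hrec hbase; elim/ltn_ind => l IH; have [/hbase //|le_l] := ltnP l 4.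
have l0 : 0 < l by lia.
have [e [l' [el lt_l']]] := top_bit l0.
have e2 : 2 <= e.
  by rewrite leqNgt; apply/negP => h; have : 2 ^ e <= 2 ^ 1 by [rewrite leq_exp2l]; lia.
case: e e2 el lt_l' => [|[|s]] // _ el lt_l'; have [hv _] := exp2_half s.
have p1 : 0 < 2 ^ s by rewrite expn_gt0.
have p2 : (2 ^ s.+2 = 4 * 2 ^ s)%N by rewrite !expnS; lia.
have -> : l = (l' + 4 * 2 ^ s)%N by lia.
have hl : (height (l' + 4 * 2 ^ s) = 2 * 2 ^ (s %/ 2) + height l')%N.
  by rewrite addnC -p2 height_top // hv.
rewrite hrec hl.
have h1 := heightD (2 ^ s) l'; rewrite height_pow in h1.
have h2 : height (4 * 2 ^ s) = (2 * 2 ^ (s %/ 2))%N by rewrite height4 height_pow.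
have h3 := height_pow s.
apply: span_add.
- have i1 : (l' < l)%N by lia.
  have := span_shift (4 * 2 ^ s) (IH _ i1); rewrite h2 => h.
  apply: span_leq h; lia.
have i1 : (l' + 2 ^ s < l)%N by lia.
have := span_shift (2 ^ s) (IH _ i1); rewrite h3 => h.
rewrite addnC in h1; apply: span_leq h; lia.
Qed.

Lemma height_mod c : (height c = height (c %% 4) + 2 * height (c %/ 4))%N.
Proof.
have h : c %% 4 < 4 by rewrite ltn_mod.
rewrite heightE; congr (_ + _)%N.
by case: (c %% 4) h => [|[|[|[|]]]].
Qed.

Lemma commL_span l c : span (2 * height l + (height c).+1) (commL l c).
Proof.
have -> : commL l c = shift (c %/ 4) (commL l (c %% 4)).
  by rewrite -commL_shift; congr commL; lia.
rewrite (height_mod c).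
suff h : span (2 * height l + (height (c %% 4)).+1) (commL l (c %% 4)).
  by apply: span_leq (span_shift (c %/ 4) h); lia.
apply: (@span_of_rec (fun l => commL l (c %% 4))) => [s k|k k4]; first exact: commL_rec.
have h4 : c %% 4 < 4 by rewrite ltn_mod.
exists (commL_codes k (c %% 4)) => //; move: k k4 (c %% 4) h4.
by move=> [|[|[|[|//]]]] _ [|[|[|[|//]]]] _; vm_compute.
Qed.

Lemma height_add2 m n : 2 * height (m + n) <= 2 * height m + 2 * height n.
Proof. by have := heightD m n; lia. Qed.

(** Subadditivity alone gives 5 in place of 4. The unit gained is what [commL_shift_span] requires
    for even s. *)
Lemma commL_next_span l c : span (2 * height l + (4 + height c)) (shift 1 (commL l.+1 c)).
Proof.
have -> : commL l.+1 c = shift (c %/ 4) (commL l.+1 (c %% 4)).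
  by rewrite -commL_shift; congr commL; lia.
rewrite (height_mod c) shiftC.
suff h : span (2 * height l + (4 + height (c %% 4))) (shift 1 (commL l.+1 (c %% 4))).
  by apply: span_leq (span_shift (c %/ 4) h); lia.
apply: (@span_of_rec (fun l => shift 1 (commL l.+1 (c %% 4)))) => [s k|k k4].
  by rewrite -addSn commL_rec shiftD shiftC [shift 1 (shift _ _)]shiftC.
have h4 : c %% 4 < 4 by rewrite ltn_mod.
rewrite /commL shift_sum_basis.
exists (map (addn (4 * 1)) (commL_codes k.+1 (c %% 4))) => //; move: k k4 (c %% 4) h4.
by move=> [|[|[|[|//]]]] _ [|[|[|[|//]]]] _; vm_compute.
Qed.

(** The target 2^((s+5)/2) is the weight of code bit s+5, the one peeled off in [commB_step].
    Subadditivity gives 4 * 2^(s/2) + 1, which exceeds it by one for even s; so the sharper case s =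
    0 is propagated in steps of two. *)
Lemma commL_shift_span s l c :
  span (2 * height l + (2 ^ ((s + 5) %/ 2) + height c)) (shift (2 ^ s) (commL (l + 2 ^ s) c)).
Proof.
have base k l' : span (2 * height l' + (4 * 2 ^ (k %/ 2) + height c).+1)
    (shift (2 ^ k) (commL (l' + 2 ^ k) c)).
  have := span_shift (2 ^ k) (commL_span (l' + 2 ^ k) c).
  have := height_add2 l' (2 ^ k); rewrite height_pow => h1 h2; apply: span_leq h2; lia.
elim/ltn_ind: s => s IH; case: s IH => [|[|s]] IH.
- by rewrite addn1; apply: commL_next_span.
- apply: span_leq (base 1%N l); have -> : (2 ^ ((1 + 5) %/ 2) = 8)%N by [].
  have -> : (2 ^ (1 %/ 2) = 1)%N by [].
  lia.
have e1 : ((s.+2 + 5) %/ 2 = ((s + 3) %/ 2).+2)%N by lia.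
have e3 : ((s + 5) %/ 2 = ((s + 3) %/ 2).+1)%N by lia.
have e2 : (2 ^ s.+2 = 4 * 2 ^ s)%N by rewrite !expnS; lia.
have p1 : 0 < 2 ^ ((s + 3) %/ 2) by rewrite expn_gt0.
have p2 : (2 * 2 ^ (s %/ 2) <= 2 ^ ((s + 3) %/ 2))%N.
  by rewrite -expnS leq_exp2l //; lia.
have h6 : height (4 * 2 ^ s) = (2 * 2 ^ (s %/ 2))%N by rewrite height4 height_pow.
have h8 : height (4 * 2 ^ s + 4 * 2 ^ s) = (2 ^ ((s + 3) %/ 2))%N.
  by rewrite -height_pow; congr height; rewrite addn3 !expnS; lia.
rewrite e1 e2 commL_rec shiftD !expnS; apply: span_add.
  have := span_shift (4 * 2 ^ s + 4 * 2 ^ s) (commL_span l c).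
  rewrite shift_shift h8 => h; apply: span_leq h; lia.
have lt_s : s < s.+2 by lia.
have := span_shift (4 * 2 ^ s) (IH s lt_s).
rewrite h6 e3 expnS => h; apply: span_leq h; lia.
Qed.

(** The error made in replacing the commutator of [K l] with t^u by [commL (l + delta)]. *)
Definition commB (u delta l c : nat) : ps :=
  K l (shift u (basis c)) + shift u (K l (basis c)) + commL (l + delta) c.

Lemma commB_rec u delta c s l :
  commB u delta (l + 4 * 2 ^ s) c =
  shift (4 * 2 ^ s) (commB u delta l c) + shift (2 ^ s) (commB u delta (l + 2 ^ s) c).
Proof.
rewrite /commB !K_rec addnAC commL_rec [(l + 2 ^ s + delta)%N]addnAC !shiftD.
by rewrite ![shift u (shift _ _)]shiftC; ring.
Qed.

(** [K] obeys both recurrences, [commL] only that of T_3; the last term is the amount by which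
    [commL] violates that of T_7. *)
Lemma commB_step u delta s l c :
  commB u delta l (4 * (8 * 2 ^ s) + c) =
    commB u delta (l + 8 * 2 ^ s) c + commB u delta (l + 2 ^ s) (4 * 2 ^ s + c) +
    commB u delta (l + 2 * 2 ^ s) (4 * (2 * 2 ^ s) + c) +
    shift (2 ^ s) (commL (l + delta + 2 ^ s) c).
Proof.
rewrite /commB -!shift_basis ![shift u (shift _ (basis _))]shiftC !K_shift !shiftD.
rewrite !commL_shift [(l + _ + delta)%N]addnAC [(l + 2 ^ s + delta)%N]addnAC.
rewrite [(l + 2 * 2 ^ s + delta)%N]addnAC.
have -> : (8 * 2 ^ s = 4 * 2 ^ s.+1)%N by rewrite expnS; lia.
have -> : (2 * 2 ^ s = 2 ^ s.+1)%N by rewrite expnS.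
by rewrite commL_rec; ring.
Qed.

Definition K_codes (l c : nat) : seq nat :=
  flatten [seq nth [::] T3_list (4 * l + x) | x <- nth [::] T7_list c].
Definition K_ok (l c : nat) : bool :=
  (c < 64) && all (fun x => 4 * l + x < 64) (nth [::] T7_list c).

Lemma K_basis l c : K_ok l c -> K l (basis c) = sum_basis (K_codes l c).
Proof.
case/andP=> lt_c; rewrite /K /K_codes T7_basis // shift_sum_basis.
rewrite /sum_basis big_map.
elim: (nth _ _ c) => [|x L IH] /=; first by rewrite !big_nil (proj1 T3_additive).
by case/andP=> hx /IH hL; rewrite big_cons T3_add hL big_cat T3_basis.
Qed.

Definition commB_codes (u delta l c : nat) : seq nat :=
  reduce2 (K_codes l (4 * u + c) ++ map (addn (4 * u)) (K_codes l c) ++ commL_codes (l + delta) c).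

Lemma commB_codesP u delta l c : K_ok l (4 * u + c) -> K_ok l c ->
  commB u delta l c = sum_basis (commB_codes u delta l c).
Proof.
move=> h1 h2; rewrite /commB shift_basis !K_basis // shift_sum_basis /commB_codes.
by rewrite /sum_basis sum_reduce2 !big_cat /= -/(sum_basis _) paddA.
Qed.

Definition commB_check (u delta k : nat) : bool :=
  all (fun l => all (fun c => [&& K_ok l (4 * u + c), K_ok l c &
    all (fun x => height x < 2 * height l + height c + k) (commB_codes u delta l c)]) (iota 0 32)) (iota 0 4).

(** The T_3 recurrence reduces l to l < 4 and [commB_step] reduces c to c < 32, leaving a finite
    check. The slack k absorbs the height of delta in the extra term of [commB_step]. *)
Lemma commB_span u delta k : 2 * height delta <= k -> commB_check u delta k ->
  forall l c, span (2 * height l + (height c + k)) (commB u delta l c).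
Proof.
move=> hdelta hcheck l c; elim/ltn_ind: c l => c IH l.
have [lt_c|le_c] := ltnP c 32.
  apply: (@span_of_rec (fun l => commB u delta l c)) => {l} [s l|l l4].
    exact: commB_rec.
  have lI : l \in iota 0 4 by rewrite mem_iota.
  have cI : c \in iota 0 32 by rewrite mem_iota.
  have /and3P[ok1 ok2 hL] := allP (allP hcheck l lI) c cI.
  exists (commB_codes u delta l c); first by rewrite addnA.
  exact: commB_codesP.
have c0 : 0 < c by lia.
have [e [c' [ec lt_c']]] := top_bit c0.
have e5 : 5 <= e.
  by rewrite leqNgt; apply/negP => h; have : 2 ^ e <= 2 ^ 4 by [rewrite leq_exp2l]; lia.
case: e e5 ec lt_c' => [|[|[|[|[|s]]]]] // _ ec lt_c'.
have p1 : 0 < 2 ^ s by rewrite expn_gt0.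
have p2 : (2 ^ s.+4.+1 = 32 * 2 ^ s)%N by rewrite !expnS; lia.
have hc : height c = (2 ^ ((s + 5) %/ 2) + height c')%N by rewrite ec height_top // [(s + 5)%N]addnC.
have q1 : (2 ^ ((s + 5) %/ 2) = 2 * 2 ^ ((s + 3) %/ 2))%N.
  by rewrite -expnS; congr expn; lia.
have q2 : (2 ^ ((s + 3) %/ 2) = 2 * 2 ^ ((s + 1) %/ 2))%N.
  by rewrite -expnS; congr expn; lia.
have q3 : (2 ^ (s %/ 2) <= 2 ^ ((s + 1) %/ 2))%N by rewrite leq_exp2l //; lia.
have r0 := height_pow s.
have r1 : height (2 * 2 ^ s) = (2 ^ ((s + 1) %/ 2))%N by rewrite -expnS height_pow addn1.
have r3 : height (8 * 2 ^ s) = (2 ^ ((s + 3) %/ 2))%N.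
  by rewrite -height_pow; congr height; rewrite addn3 !expnS; lia.
have r4 : height (4 * 2 ^ s) = (2 * 2 ^ (s %/ 2))%N by rewrite height4 r0.
have r5 : height (4 * (2 * 2 ^ s)) = (2 * 2 ^ ((s + 1) %/ 2))%N by rewrite height4 r1.
have a0 := heightD l (2 ^ s); have a1 := heightD l (2 * 2 ^ s).
have a3 := heightD l (8 * 2 ^ s); have b0 := heightD (4 * 2 ^ s) c'.
have b1 := heightD (4 * (2 * 2 ^ s)) c'; have d := heightD l delta.
have -> : c = (4 * (8 * 2 ^ s) + c')%N by lia.
have hc' : height (4 * (8 * 2 ^ s) + c') = (2 ^ ((s + 5) %/ 2) + height c')%N.
  by rewrite -hc; congr height; lia.
rewrite commB_step hc'.
apply: span_add; first (apply: span_add; first apply: span_add).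
- have i : c' < c by lia.
  apply: span_leq (IH _ i _); lia.
- have i : (4 * 2 ^ s + c' < c)%N by lia.
  apply: span_leq (IH _ i _); lia.
- have i : (4 * (2 * 2 ^ s) + c' < c)%N by lia.
  apply: span_leq (IH _ i _); lia.
apply: span_leq (commL_shift_span s (l + delta) c'); lia.
Qed.

Lemma commB_check1 : commB_check 1 0 0. Proof. by vm_compute. Qed.
Lemma commB_check4 : commB_check 4 1 2. Proof. by vm_compute. Qed.

(** * Spread powers *)

Lemma K_basis_span l c : span (2 * height l + height c) (K l (basis c)).
Proof.
have h := span_shift l (T7_span_basis c); rewrite /K.
case: (posnP (2 * height l + height c)) => [e0|pos].
  have h0 : span 0 (shift l (T7 (basis c))) by apply: span_leq h; lia.
  by rewrite (span0 h0) (proj1 T3_additive); apply: span_pzero.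
rewrite -(prednK pos); apply: (@span_leq (2 * height l + height c).-1) => //.
by apply: T3_span; apply: span_leq h; lia.
Qed.

(* [(4^j - 1) / 3], whose base-4 digits are [j] ones. *)
Fixpoint sigma (j : nat) : nat := if j is i.+1 then (4 ^ i + sigma i)%N else 0%N.

Lemma height_pow4 j : height (4 ^ j) = (2 ^ j)%N.
Proof. by rewrite -[4]/(2 ^ 2)%N -expnM height_pow mulKn. Qed.

Lemma height_2pow4 j : height (2 * 4 ^ j) = (2 ^ j)%N.
Proof.
rewrite -[4]/(2 ^ 2)%N -expnM -expnS height_pow; congr expn; lia.
Qed.

Lemma sigma_height j : height (sigma j) <= 2 ^ j - 1.
Proof.
elim: j => [|j IH] //=; have := heightD (4 ^ j) (sigma j).
have p : 0 < 2 ^ j by rewrite expn_gt0.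
rewrite height_pow4 expnS; lia.
Qed.

Lemma pow4 j : (4 ^ j = 2 ^ (2 * j))%N. Proof. by rewrite expnM. Qed.

(** Both recurrences at once turn the commutator with t^(4^(j+2)) at l into that with t^(4^(j+1)) at
    l + 4^(j+1), up to a small term. The shifts of l accumulate to sigma; j = 0 and j = 1, out of
    reach of this step, are the computed cases. *)
Lemma comm_span j l c :
  span (2 * height l + (height c + (2 ^ j.+1 - 2)))
    (K l (shift (4 ^ j) (basis c)) + shift (4 ^ j) (K l (basis c)) + commL (l + sigma j) c).
Proof.
elim: j l => [|j IH] l.
  by have := @commB_span 1 0 0 isT commB_check1 l c; rewrite /commB.
case: j IH => [|j] IH.
  by have := @commB_span 4 1 2 isT commB_check4 l c; rewrite /commB.
(* The same number as 4 * 4^(j+1), for the T_3 recurrence, and as 8 * 2^(2j+1), for that of T_7. *)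
have e0 : (4 ^ j.+2 = 4 * 4 ^ j.+1)%N by rewrite expnS.
have e1 : (4 ^ j.+2 = 8 * 2 ^ (2 * j).+1)%N by rewrite pow4 -[8]/(2 ^ 3)%N -expnD; congr expn; lia.
have e2 : (4 ^ j.+1 = 2 ^ (2 * j).+2)%N by rewrite pow4; congr expn; lia.
have e3 : (2 * 2 ^ (2 * j).+1 = 4 ^ j.+1)%N by rewrite e2 -expnS.
have step : K l (shift (4 ^ j.+2) (basis c)) =
    K (l + 4 ^ j.+2) (basis c) + K (l + 2 ^ (2 * j).+1) (shift (2 ^ (2 * j).+1) (basis c)) +
    K (l + 4 ^ j.+1) (shift (4 ^ j.+1) (basis c)).
  by rewrite {1}e1 K_shift -e1 e3.
have Krec : K (l + 4 ^ j.+2) (basis c) =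
    shift (4 ^ j.+2) (K l (basis c)) + shift (4 ^ j.+1) (K (l + 4 ^ j.+1) (basis c)).
  by rewrite e0 e2 K_rec.
have -> : K l (shift (4 ^ j.+2) (basis c)) + shift (4 ^ j.+2) (K l (basis c)) +
    commL (l + sigma j.+2) c =
  (K (l + 4 ^ j.+1) (shift (4 ^ j.+1) (basis c)) +
    shift (4 ^ j.+1) (K (l + 4 ^ j.+1) (basis c)) + commL (l + 4 ^ j.+1 + sigma j.+1) c) +
  K (l + 2 ^ (2 * j).+1) (shift (2 ^ (2 * j).+1) (basis c)).
  rewrite step Krec [sigma j.+2]/= -[(4 ^ j + sigma j)%N]/(sigma j.+1) addnA; ring.
have p : 0 < 2 ^ j by rewrite expn_gt0.
have q : (2 ^ j.+3 = 8 * 2 ^ j)%N by rewrite !expnS; lia.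
have q2 : (2 ^ j.+2 = 4 * 2 ^ j)%N by rewrite !expnS; lia.
have hp : height (4 ^ j.+1) = (2 * 2 ^ j)%N by rewrite height_pow4 expnS.
apply: span_add.
  have := heightD l (4 ^ j.+1); rewrite hp => h; apply: span_leq (IH _).
  move: h; rewrite q q2; move: (height (l + _)) => x h; lia.
set a := (2 ^ (2 * j).+1)%N.
have ha : height a = (2 ^ j)%N by rewrite height_pow; congr expn; lia.
rewrite shift_basis.
have h1 := heightD (4 * a) c; rewrite height4 in h1.
have h2 := heightD l a.
apply: span_leq (K_basis_span _ _); lia.
Qed.

(** The recurrence yields the main term and a term at sigma (j+1) + 4^j. There the top base-4 digit
    1 has become 2, which has the same weight, so that term is small. *)
Lemma commL_sigma_span j c :
  span (height c + (2 ^ j.+1 - 2)) (commL (sigma j) c + shift (sigma j) (basis c)).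
Proof.
elim: j => [|j IH].
  rewrite /= shift0 /commL /= sum_basis1 paddff; exact: span_pzero.
case: j IH => [|j] IH.
  rewrite /= -[(4 ^ 0 + 0)%N]/1%N /commL /= sum_basis1 shift_basis paddff; exact: span_pzero.
have e2 : (4 ^ j = 2 ^ (2 * j))%N by rewrite pow4.
have e : sigma j.+2 = (sigma j.+1 + 4 * 2 ^ (2 * j))%N.
  by rewrite [LHS]/= -[(4 ^ j + sigma j)%N]/(sigma j.+1) addnC expnS e2.
rewrite e commL_rec -e2.
have -> : shift (sigma j.+1 + 4 * 4 ^ j) (basis c) = shift (4 * 4 ^ j) (shift (sigma j.+1) (basis c)).
  by rewrite shift_shift addnC.
have -> : forall x y z, x + y + z = (x + z) + y by move=> *; ring.
rewrite -shiftD; apply: span_add.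
  have := span_shift (4 * 4 ^ j) IH; rewrite height4 height_pow4 => h.
  apply: span_leq h; rewrite !expnS; have : 0 < 2 ^ j by rewrite expn_gt0.
  lia.
have h1 : (sigma j.+1 + 4 ^ j = 2 * 4 ^ j + sigma j)%N by rewrite /=; lia.
have h2 := heightD (2 * 4 ^ j) (sigma j); rewrite height_2pow4 in h2.
have h3 := sigma_height j.
have := span_shift (4 ^ j) (commL_span (sigma j.+1 + 4 ^ j) c); rewrite h1 height_pow4 => h.
apply: span_leq h; rewrite !expnS; have : 0 < 2 ^ j by rewrite expn_gt0.
lia.
Qed.

Definition T37 (f : ps) : ps := T3 (T7 f).

Lemma T37_K f : T37 f = K 0 f.
Proof. by rewrite /K shift0. Qed.

Lemma T37_pow4_span j c :
  span (height c + (2 ^ j.+1 - 2))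
    (T37 (shift (4 ^ j) (basis c)) + shift (4 ^ j) (T37 (basis c)) + shift (sigma j) (basis c)).
Proof.
have h := span_add (comm_span j 0 c) (commL_sigma_span j c).
rewrite !T37_K; move: h; rewrite add0n.
set x := K 0 _; set y := shift _ (K 0 _); set z := commL _ _; set w := shift _ (basis c).
by have -> : x + y + z + (z + w) = x + y + w by ring.
Qed.

Fixpoint spread_rec (fuel n : nat) : nat :=
  if fuel is k.+1 then (odd n + 4 * spread_rec k n./2)%N else 0%N.
(* The binary digits of [n] read in base 4. *)
Definition spread (n : nat) : nat := spread_rec n n.

Lemma spread_rec_fuel k n : n <= k -> spread_rec k n = spread_rec n n.
Proof.
elim/ltn_ind: n k => n IH k; case: n IH => [|n] IH.
  by move=> _; elim: k => [|k IHk] //=; rewrite IHk.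
case: k => [//|k] le_nk; rewrite /= -/(odd n.+1) -/(n.+1./2).
congr (_ + 4 * _)%N; rewrite IH; [| lia | lia].
by symmetry; apply: IH; lia.
Qed.

Lemma spreadE n : spread n = (odd n + 4 * spread n./2)%N.
Proof.
by case: n => [|n] //; rewrite /spread [LHS]/= spread_rec_fuel //; lia.
Qed.

Lemma height_low b n : b <= 2 -> height (b + 4 * n) = ((0 < b) + 2 * height n)%N.
Proof.
move=> b2; rewrite height_mod (_ : ((b + 4 * n) %% 4 = b)%N) 1?(_ : ((b + 4 * n) %/ 4 = n)%N); try lia.
by case: b b2 => [|[|[|//]]].
Qed.

Lemma height_spread n : height (spread n) = n.
Proof.
elim/ltn_ind: n => n IH; case: (posnP n) => [-> //|n0].
by rewrite spreadE height_low ?IH; try lia.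
Qed.

Lemma spread_top j n : n < 2 ^ j -> spread (2 ^ j + n) = (4 ^ j + spread n)%N.
Proof.
elim: j n => [|j IH] n lt_n; first by case: n lt_n.
rewrite expnS in lt_n; rewrite spreadE [spread n]spreadE.
have -> : odd (2 ^ j.+1 + n) = odd n by rewrite expnS; lia.
have -> : (2 ^ j.+1 + n)./2 = (2 ^ j + n./2)%N by rewrite expnS; lia.
by rewrite IH; rewrite ?[(4 ^ j.+1)%N]expnS; lia.
Qed.

Lemma spread_sigma j : spread (2 ^ j - 1) = sigma j.
Proof.
elim: j => [|j IH] //=; have p : 0 < 2 ^ j by rewrite expn_gt0.
rewrite -IH -spread_top; last by lia.
by congr spread; rewrite expnS; lia.
Qed.

(** All base-4 digits of the sum are 1 or 2, both of weight 1. *)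
Lemma sigma_spread_height j n : n < 2 ^ j -> height (sigma j + spread n) <= 2 ^ j - 1.
Proof.
elim: j n => [|j IH] n lt_n; first by case: n lt_n.
rewrite expnS in lt_n; have p : 0 < 2 ^ j by rewrite expn_gt0.
have e : sigma j.+1 = (1 + 4 * sigma j)%N.
  rewrite -!spread_sigma spreadE; have -> : odd (2 ^ j.+1 - 1) by rewrite expnS; lia.
  by have -> : ((2 ^ j.+1 - 1)./2 = 2 ^ j - 1)%N by rewrite expnS; lia.
have i : n./2 < 2 ^ j by lia.
have h := IH _ i; rewrite e spreadE.
have -> : (1 + 4 * sigma j + (odd n + 4 * spread n./2) =
  (odd n).+1 + 4 * (sigma j + spread n./2))%N by lia.
rewrite height_low ?expnS /=; last by case: (odd n).
move: h; move: (height _) => x; lia.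
Qed.

Lemma T37_add f g : T37 (f + g) = T37 f + T37 g.
Proof. by rewrite /T37 T7_add T3_add. Qed.

(** For n = 2^j + m, Leibniz on t^(4^j) t^sp(m) gives t^(4^j) t^sp(m-1) and t^(sigma j) t^sp(m). If
    m > 0 the first is the main term and the second is small by [sigma_spread_height]; if m = 0 only
    t^(sigma j) = t^sp(n-1) occurs. *)
Lemma T37_spread_span n c : 0 < n ->
  span (height c + (2 * n - 2))
    (T37 (shift (spread n) (basis c)) + shift (spread n) (T37 (basis c)) +
     shift (spread n.-1) (basis c)).
Proof.
elim/ltn_ind: n => n IH n0; have [j [m [en lt_m]]] := top_bit n0.
have p : 0 < 2 ^ j by rewrite expn_gt0.
have [m0|m0] := posnP m.
  have e1 : spread n = (4 ^ j)%N by rewrite en spread_top // m0 addn0.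
  have e2 : spread n.-1 = sigma j by rewrite -spread_sigma; congr spread; lia.
  have := T37_pow4_span j c; rewrite e1 e2 expnS => h; apply: span_leq h; lia.
have e1 : spread n = (4 ^ j + spread m)%N by rewrite en spread_top.
have e2 : spread n.-1 = (4 ^ j + spread m.-1)%N.
  by rewrite -spread_top; [congr spread |]; lia.
have hm := height_spread m.
pose c' := (4 * spread m + c)%N.
have hc' : height c' <= height c + 2 * m.
  by have := heightD (4 * spread m) c; rewrite height4 hm -/c'; lia.
have ltmn : m < n by lia.
have h1 := T37_pow4_span j c'.
have h2 := span_shift (4 ^ j) (IH m ltmn m0).
have h3 : span (2 * (2 ^ j - 1) + (height c).+1) (shift (sigma j + spread m) (basis c)).
  have := sigma_spread_height lt_m => h; rewrite shift_basis; apply: span_basis.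
  have := heightD (4 * (sigma j + spread m)) c; rewrite height4; lia.
rewrite e1 e2.
have -> : T37 (shift (4 ^ j + spread m) (basis c)) + shift (4 ^ j + spread m) (T37 (basis c)) +
    shift (4 ^ j + spread m.-1) (basis c) =
  (T37 (shift (4 ^ j) (basis c')) + shift (4 ^ j) (T37 (basis c')) + shift (sigma j) (basis c')) +
  shift (4 ^ j) (T37 (shift (spread m) (basis c)) + shift (spread m) (T37 (basis c)) +
     shift (spread m.-1) (basis c)) + shift (sigma j + spread m) (basis c).
  by rewrite /c' -shift_basis !shiftD !shift_shift; ring.
rewrite height_pow4 in h2; rewrite expnS in h1.
apply: span_add; first apply: span_add.
- apply: span_leq h1; lia.
- apply: span_leq h2; lia.
apply: span_leq h3; lia.
Qed.

Lemma T37_span d f : span d.+2 f -> span d (T37 f).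
Proof. by move=> h; apply/T3_span/T7_span. Qed.

Lemma T37_iter_span d n f : span (d + 2 * n) f -> span d (iter n T37 f).
Proof.
elim: n f => [|n IH] f; first by rewrite muln0 addn0.
by rewrite iterSr => h; apply/IH/T37_span; apply: span_leq h; lia.
Qed.

Lemma T37_iter_add n f g : iter n T37 (f + g) = iter n T37 f + iter n T37 g.
Proof. by elim: n => [|n IH] //; rewrite !iterS IH T37_add. Qed.

(** The first of n+1 applications makes an error in [span (height c + 2 * n)], which the n remaining
    ones, each lowering by 2, bring into [span (height c)]. *)
Lemma T37_iter_spread n c : T37 (basis c) = 0 ->
  span (height c) (iter n T37 (shift (spread n) (basis c)) + basis c).
Proof.
move=> h0; elim: n => [|n IH].
  by rewrite /= shift0 paddff; apply: span_pzero.
have := @T37_spread_span n.+1 c isT; rewrite h0 (proj1 (shift_additive _)) [n.+1.-1]/=.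
set x := T37 _; set y := shift _ _; have -> : x + 0 + y = x + y by ring.
move=> h.
have -> : iter n.+1 T37 (shift (spread n.+1) (basis c)) + basis c =
    iter n T37 (x + y) + (iter n T37 y + basis c).
  by rewrite iterSr -/x !T37_iter_add; ring.
apply: span_add => //; apply: T37_iter_span; apply: span_leq h; lia.
Qed.

(** * A seed killed by T_3 *)

Local Open Scope nat_scope.

(** The term of index j - k of the sequence a_i = f(7^i), extended symmetrically about -1 with
    a_(-1) = 0. On the extended sequence T_7 is a_(j+1) + a_(j-1) without boundary case. *)
Definition reflected (f : ps) (j k : nat) : bool :=
  if k <= j then f (7 ^ (j - k))%N else if k == j.+1 then false else f (7 ^ (k - j - 2))%N.

(* On the coefficients at powers of 7, [T7] is a sum of two inverse shifts, and squaring is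
   additive in characteristic 2. *)
Lemma T7_iter_pow2 n f j :
  iter (2 ^ n) T7 f (7 ^ j)%N = f (7 ^ (j + 2 ^ n))%N (+) reflected f j (2 ^ n).
Proof.
elim: n f j => [|n IH] f j.
  rewrite /= /T7 /Tp /reflected addn1 -expnS; case: j => [|j] //=.
  have -> : 7 %| 7 ^ j.+1 by apply: dvdn_exp.
  by have -> : (7 ^ j.+1 %/ 7 = 7 ^ j)%N by [rewrite expnS mulKn]; rewrite expn0 subn1.
have e : (2 ^ n.+1 = 2 ^ n + 2 ^ n)%N by rewrite expnS; lia.
have r : reflected f (j + 2 ^ n) (2 ^ n) = f (7 ^ j) by rewrite /reflected leq_addl addnK.
rewrite e iterD IH IH r addnA /reflected.
have [h|h] := leqP (2 ^ n) j.
  rewrite IH subnK // /reflected.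
  have -> : (2 ^ n <= j - 2 ^ n) = (2 ^ n + 2 ^ n <= j) by lia.
  have -> : (2 ^ n == (j - 2 ^ n).+1) = (2 ^ n + 2 ^ n == j.+1) by apply/eqP/eqP; lia.
  rewrite (_ : (2 ^ n - (j - 2 ^ n) - 2 = 2 ^ n + 2 ^ n - j - 2)%N); last by lia.
  rewrite (_ : (j - 2 ^ n - 2 ^ n = j - (2 ^ n + 2 ^ n))%N); last by lia.
  by move: (f _) (f (7 ^ j)) (if _ then _ else _) => [] [] [].
rewrite leqNgt (_ : j < 2 ^ n + 2 ^ n) /=; last by lia.
have -> : (2 ^ n + 2 ^ n == j.+1) = false by apply/eqP; lia.
case: eqP => [e1|ne].
  by rewrite (_ : (2 ^ n + 2 ^ n - j - 2 = j)%N) ?addbF //; lia.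
rewrite IH /reflected leqNgt (_ : 2 ^ n - j - 2 < 2 ^ n) /=; last by lia.
have -> : (2 ^ n == (2 ^ n - j - 2).+1) = false by apply/eqP; lia.
rewrite (_ : (2 ^ n - (2 ^ n - j - 2) - 2 = j)%N); last by lia.
rewrite (_ : (2 ^ n - j - 2 + 2 ^ n = 2 ^ n + 2 ^ n - j - 2)%N); last by lia.
by case: (f _) (f _) (f _) => [] [] [].
Qed.

(** * Representations of powers of 7 by 10 * 4^n b^2 + a^2 *)

Lemma dvd7_sq a : (7 %| a * a) = (7 %| a).
Proof. by rewrite Euclid_dvdM // orbb. Qed.

Definition rep7 (n k : nat) (x : nat * nat) : bool :=
  [&& odd x.1, cop10 x.2 & 10 * 4 ^ n * (x.1 * x.1) + 1 * (x.2 * x.2) == 7 ^ k].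

Lemma dvd7_rep n x k : rep7 n k.+1 x -> (7 %| x.1) = (7 %| x.2).
Proof.
case/and3P=> _ _ /eqP e.
have h : 7 %| 10 * 4 ^ n * (x.1 * x.1) + x.2 * x.2.
  by rewrite -[x.2 * x.2]mul1n e expnS dvdn_mulr.
have hM : (7 %| 10 * 4 ^ n * (x.1 * x.1)) = (7 %| x.1).
  rewrite !Euclid_dvdM // orbb -[4]/(2 ^ 2) -expnM.
  by have -> : (7 %| 2 ^ (2 * n)) = false by apply/negbTE; rewrite Euclid_dvdX.
by rewrite -hM -(dvd7_sq x.2); apply/idP/idP => h'; [rewrite -(dvdn_addr _ h') | rewrite -(dvdn_addl _ h')].
Qed.

(** Start from 40 + 9 = 49 and square a + b sqrt(-M): the 2 in 2ab is absorbed by passing from M to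
    4M while the exponent of 7 doubles. Were 7 to divide a^2 - M b^2, it would divide 2a^2. *)
Lemma rep7_exists n : exists x, rep7 n.+1 (2 ^ n.+1) x && ~~ (7 %| x.2).
Proof.
elim: n => [|n [[b a]]]; first by exists (1, 3).
rewrite /rep7 /= cop10E => /andP[/and3P[ob /andP[oa a5] /eqP e] a7].
pose X := 10 * 4 ^ n.+1 * (b * b).
have eX : X + a * a = 7 ^ 2 ^ n.+1 by rewrite -e mul1n.
exists (a * b, dist (a * a) X); rewrite /rep7 /= cop10E.
have hs := dist_sq (a * a) X.
have X10 : X = 10 * (4 ^ n.+1 * (b * b)) by rewrite /X -mulnA.
have e2 : 7 ^ 2 ^ n.+2 = 7 ^ 2 ^ n.+1 * 7 ^ 2 ^ n.+1 by rewrite -expnD expnS; congr expn; lia.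
have cases : dist (a * a) X = a * a - X /\ X <= a * a \/ dist (a * a) X = X - a * a /\ a * a <= X.
  rewrite /dist; lia.
have oaa : odd (a * a) by rewrite oddM oa.
have a55 : (a * a) %% 5 != 0.
  by apply: contraNneq a5 => h; rewrite -/(5 %| a) -[5 %| a]orbb -Euclid_dvdM // /dvdn h.
have s7 : 7 %| X + a * a.
  rewrite eX; apply: dvdn_exp => //; exact: expn_gt0.
have a77 : ~~ (7 %| a * a) by rewrite dvd7_sq.
have e3 : 10 * 4 ^ n.+2 * (a * b * (a * b)) = 4 * (X * (a * a)).
  by rewrite /X expnS; move: (4 ^ n.+1) => z; nia.
clearbody X; rewrite oddM oa ob /=; apply/andP; split; first (apply/andP; split; first (apply/andP; split)).
- case: cases => -[-> h]; move: oaa X10 h; move: (4 ^ _ * _) (a * a) => z y; clear; lia.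
- apply: contraNneq a55.
  case: cases => -[-> h]; move: X10 h; move: (4 ^ _ * _) (a * a) => z y; clear; lia.
- rewrite mul1n e2 -eX; apply/eqP.
  rewrite e3; move: hs; move: (a * a) (dist _ _) => y z; clear; nia.
apply: contra a77.
case: cases => -[-> h]; move: s7 h; move: (a * a) => y; clear; lia.
Qed.

(** From the composition identity q^2 = (a a' - M b b')^2 + M (a b' + a' b)^2. *)
Lemma cross_bound M q a b a' b' : M * (b * b) + a * a = q -> M * (b' * b') + a' * a' = q ->
  M * ((a * b' + a' * b) * (a * b' + a' * b)) <= q * q.
Proof.
move=> e e'; have := nat_Cauchy (a * a') (M * (b * b')); rewrite -!mulnn.
have -> : q * q = (a * a') * (a * a') + (M * (b * b')) * (M * (b * b')) +
    M * ((a * b') * (a * b') + (a' * b) * (a' * b)) by rewrite -{1}e -e'; nia.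
have -> : M * ((a * b' + a' * b) * (a * b' + a' * b)) =
    2 * ((a * a') * (M * (b * b'))) + M * ((a * b') * (a * b') + (a' * b) * (a' * b)) by nia.
by rewrite leq_add2r => -[].
Qed.

(** The power q of 7 divides (a b')^2 - (a' b)^2 = q (b'^2 - b^2), and 7 cannot divide both a b' -
    a' b and a b' + a' b, so q divides one of them. Both are less than q by [cross_bound], hence one
    vanishes. *)
Lemma cross_eq M k a b a' b' : 1 < M ->
    M * (b * b) + a * a = 7 ^ k.+1 -> M * (b' * b') + a' * a' = 7 ^ k.+1 ->
    ~~ (7 %| a) -> ~~ (7 %| b') -> a' * b <= a * b' ->
  a * b' = a' * b.
Proof.
move=> M1 e e' na nb h; have bd := cross_bound e e'.
have q0 : 0 < 7 ^ k.+1 by rewrite expn_gt0.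
have cop u : ~~ (7 %| u) -> coprime (7 ^ k.+1) u.
  by move=> nu; rewrite coprimeXl // prime_coprime.
have lt_u : a * b' + a' * b < 7 ^ k.+1.
  rewrite ltnNge; apply/negP => hu; have := leq_mul hu hu; move: bd.
  have := leq_mul2r ((a * b' + a' * b) * (a * b' + a' * b)) 2 M; rewrite M1 orbT.
  have : 0 < 7 ^ k.+1 * 7 ^ k.+1 by rewrite muln_gt0 q0.
  move: (_ * (_ + _)) (_ * _ ^ _) => u2 q2; clear; lia.
have dv : 7 ^ k.+1 %| (a * b' - a' * b) * (a * b' + a' * b).
  rewrite -subn_sqr -!mulnn.
  have -> : a * b' * (a * b') - a' * b * (a' * b) = 7 ^ k.+1 * (b' * b') - 7 ^ k.+1 * (b * b).
    by rewrite -{1}e -e'; nia.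
  by rewrite -mulnBr dvdn_mulr.
have [h7|h7] := boolP (7 %| a * b' - a' * b).
  have n7 : ~~ (7 %| a * b' + a' * b).
    apply/negP => h8; have := dvdn_add h7 h8.
    have -> : a * b' - a' * b + (a * b' + a' * b) = 2 * (a * b') by lia.
    by rewrite !Euclid_dvdM // (negbTE na) (negbTE nb).
  move: dv; rewrite Gauss_dvdl; last exact: cop.
  by move=> /dvdn_leq h9; move: h9 lt_u; move: (a * b') (a' * b) (7 ^ _) h => x y q; clear; lia.
move: dv; rewrite Gauss_dvdr; last exact: cop.
have [u0|u0] := posnP (a * b' + a' * b); first by move: u0; clear; lia.
by move=> /(dvdn_leq u0); rewrite leqNgt lt_u.
Qed.

Lemma cross_inj M k a b a' b' : 1 < M -> 0 < a ->
    M * (b * b) + a * a = 7 ^ k -> M * (b' * b') + a' * a' = 7 ^ k ->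
    a * b' = a' * b -> a = a' /\ b = b'.
Proof.
move=> M1 a0 e e' h; have q0 : 0 < 7 ^ k by rewrite expn_gt0.
have eb : b = b'.
  apply: sq_inj; apply/eqP; rewrite -(eqn_pmul2l q0) -{1}e' -e; apply/eqP.
  have : a * b' * (a * b') = a' * b * (a' * b) by rewrite h.
  nia.
split=> //; apply: sq_inj; move: e e'; rewrite eb; lia.
Qed.

Lemma rep7_unique n k x y : rep7 n k.+1 x -> ~~ (7 %| x.2) -> rep7 n k.+1 y -> ~~ (7 %| y.2) ->
  x = y.
Proof.
move=> rx nx ry ny; have dx := dvd7_rep rx; have dy := dvd7_rep ry.
case: x y rx nx ry ny dx dy => [b a] [b' a'] /= rx nx ry ny dx dy.
move: rx ry => /and3P[/= ob oa /eqP ex] /and3P[/= ob' oa' /eqP ey].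
rewrite mul1n in ex; rewrite mul1n in ey.
have M1 : 1 < 10 * 4 ^ n by have : 0 < 4 ^ n by [rewrite expn_gt0]; lia.
have a0 : 0 < a by case/andP: oa.
have a0' : 0 < a' by case/andP: oa'.
have [h|/ltnW h] := leqP (a' * b) (a * b').
  by have [-> ->] := cross_inj M1 a0 ex ey (cross_eq M1 ex ey nx (etrans (congr1 negb dy) ny) h).
by have [-> ->] := cross_inj M1 a0' ey ex (cross_eq M1 ey ex ny (etrans (congr1 negb dx) nx) h).
Qed.

Lemma par_split K (P Q : pred (nat * nat)) :
  par K P = par K (fun x => P x && Q x) (+) par K (fun x => P x && ~~ Q x).
Proof.
rewrite /par -oddD; congr odd; rewrite -(count_predUI (predI P Q)).
have -> : count (predI (predI P Q) (fun x => P x && ~~ Q x)) (pairs K) = 0.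
  by apply/eqP; rewrite -leqn0 leqNgt -has_count; apply/hasP => -[x _ /=]; case: (P x) (Q x) => [] [].
by rewrite addn0; apply: eq_count => x /=; case: (P x) (Q x) => [] [].
Qed.

Lemma par_unique K (P : pred (nat * nat)) x : P x -> (forall y, P y -> y = x) ->
  x.1 < K -> x.2 < K -> par K P = true.
Proof.
move=> Px ux h1 h2; rewrite /par -size_filter.
rewrite (perm_size (s2 := [:: x])) //; apply: uniq_perm; rewrite ?filter_uniq ?uniq_pairs //.
move=> y; rewrite mem_filter mem_pairs inE; apply/andP/eqP => [[/ux]|->] //.
by rewrite h1 h2.
Qed.

Lemma rep7_bound n k K x : 7 ^ k < K -> rep7 n k x -> x.1 < K /\ x.2 < K.
Proof.
case: x => b a hK /and3P[/= _ _ /eqP e].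
have M0 : 0 < 10 * 4 ^ n by rewrite muln_gt0 expn_gt0.
have h : b * b <= 10 * 4 ^ n * (b * b) by rewrite leq_pmull.
rewrite mul1n in e; split; nia.
Qed.

Lemma rep7_nonprimitive n k K : 7 ^ k.+2 < K ->
  par K (fun x => rep7 n k.+2 x && (7 %| x.2)) = par K (rep7 n k).
Proof.
move=> hK; have hk : 7 ^ k < K by apply: leq_trans hK; rewrite ltnS leq_exp2l //; lia.
have cop7 a : cop10 (7 * a) = cop10 a.
  by rewrite /cop10 muln_gt0 coprimeMl.
apply: (@par_bij _ _ _ (fun x => (x.1 %/ 7, x.2 %/ 7)) (fun x => (7 * x.1, 7 * x.2))).
- by move=> x /andP[hx _]; apply: rep7_bound hx.
- by move=> x hx; apply: rep7_bound hx.
- move=> [b a] /andP[hx /= h7]; have h7' := dvd7_rep hx; rewrite /= h7 in h7'.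
  case/dvdnP: h7 hx => a' ->; case/dvdnP: (h7') => b' ->; rewrite !mulnK // => hx.
  split; last by rewrite ![7 * _]mulnC.
  case/and3P: hx; rewrite /rep7 /= ![_ * 7]mulnC cop7 oddM => /= -> -> /eqP e; apply/eqP.
  move: e; rewrite !expnS; move: (4 ^ n) (7 ^ k) => M q; clear; nia.
- move=> [b a] hx; split; last by rewrite /= !mulKn.
  rewrite /= dvdn_mulr // andbT; case/and3P: hx; rewrite /rep7 /= cop7 oddM => -> -> /eqP e /=.
  apply/eqP; move: e; rewrite !expnS; move: (4 ^ n) (7 ^ k) => M q; clear; nia.
Qed.

Lemma rep7_parity n K : 7 ^ (2 ^ n.+1) < K ->
  par K (rep7 n.+1 (2 ^ n.+1)) (+) par K (rep7 n.+1 (2 ^ n.+1 - 2)) = true.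
Proof.
have [x /andP[rx nx]] := rep7_exists n.
have e : 2 ^ n.+1 = (2 ^ n.+1 - 2).+2.
  by have : 0 < 2 ^ n by [rewrite expn_gt0]; rewrite expnS; lia.
move: rx; rewrite e; move: (2 ^ n.+1 - 2) => k rx hK; rewrite -[k.+2 - 2]/(k - 0) subn0.
rewrite (par_split _ _ (fun x => 7 %| x.2)) rep7_nonprimitive // addbAC addbb addFb.
have [h1 h2] := rep7_bound hK rx.
apply: (@par_unique _ _ x); rewrite ?rx ?nx // => y /andP[ry ny].
exact: rep7_unique ry ny rx nx.
Qed.

Local Open Scope ps_scope.

Definition seed (n : nat) : nat := 8 * 4 ^ n.

Lemma seed_theta n : basis (seed n) = theta odd (10 * 4 ^ n.+1) * theta cop10 1.
Proof.
have e : seed n = (4 * (2 * 4 ^ n) + 0)%N by rewrite /seed; lia.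
rewrite /basis e (_ : (_ %/ 4)%N = (2 * 4 ^ n)%N); last by lia.
rewrite (_ : (_ %% 4)%N = 0%N); last by lia.
have -> : Dr 0%N = theta cop10 1 by [].
congr (_ * _); rewrite (_ : (4 * (2 * 4 ^ n) = 2 ^ (2 * n + 3))%N); last first.
  by rewrite expnD expnM -[(2 ^ 2)%N]/4 -[(2 ^ 3)%N]/8; lia.
have pw k : g5 ^ (2 ^ k) = theta odd (5 * 2 ^ k).
  elim: k => [|k IH]; first by rewrite expn0 muln1 -/g5; ring.
  rewrite (_ : (2 ^ k.+1 = 2 ^ k + 2 ^ k)%N); last by rewrite expnS; lia.
  rewrite ppowD IH (_ : (5 * (2 ^ k + 2 ^ k) = 2 * (5 * 2 ^ k))%N) -?sq_theta; last by lia.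
  ring.
by rewrite pw expnD expnM [(4 ^ n.+1)%N]expnS -[(2 ^ 2)%N]/4 -[(2 ^ 3)%N]/8; congr theta; lia.
Qed.

Lemma height_seed n : height (seed n) = (2 ^ n.+1)%N.
Proof. by rewrite /seed -[8]/(4 * 2)%N -mulnA height4 height_2pow4 expnS. Qed.

(** The coefficient of x is the sum of those of theta at 7^H and 7^(H-2). Representations of 7^H
    with entries divisible by 7 correspond to those of 7^(H-2) and cancel; the unique primitive one
    remains. *)
Lemma T7_seed n : iter (2 ^ n.+1) T7 (basis (seed n)) 1%N = true.
Proof.
rewrite -[1%N]/(7 ^ 0)%N T7_iter_pow2 add0n /reflected.
have h : 0 < 2 ^ n by rewrite expn_gt0.
rewrite leqNgt expn_gt0 /= (_ : (2 ^ n.+1 == 1)%N = false); last by rewrite expnS; lia.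
rewrite subn0 seed_theta -[RHS](@rep7_parity n (7 ^ 2 ^ n.+1).+1) //.
by congr addb; rewrite (@theta_mul _ _ _ _ _ (7 ^ 2 ^ n.+1).+1) // ?muln_gt0 ?expn_gt0 // ltnS leq_exp2l // leq_subr.
Qed.

(** T_3 kills D, so the recurrence reduces t^(4m) D to t^m D for m a power of 2. *)
Lemma T3_seed n : T3 (basis (seed n)) = 0.
Proof.
have h0 : T3 (basis 0%N) = 0 by rewrite T3_basis //= /sum_basis big_nil.
elim: n => [|n IH]; first by rewrite T3_basis //= /sum_basis big_nil.
have e k : (seed k = 4 * (2 ^ (2 * k).+1) + 0)%N by rewrite /seed expnS expnM -[(2 ^ 2)%N]/4; lia.
rewrite e -shift_basis (_ : (2 ^ (2 * n.+1).+1 = 4 * 2 ^ (2 * n).+1)%N); last first.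
  by rewrite mulnS !expnS; lia.
have IH' : T3 (shift (2 ^ (2 * n).+1) (basis 0%N)) = 0 by rewrite shift_basis -e.
by rewrite T3_shift h0 IH' !(proj1 (shift_additive _)) padd0.
Qed.

(** * Faithfulness *)

Lemma T3_T7 f : T3 (T7 f) = T7 (T3 f).
Proof. exact: Tp_comm. Qed.

Lemma mono_act_comp a b i j f :
  mono_act a b (mono_act i j f) = mono_act (a + i) (b + j) f.
Proof.
have comm1 g n : iter n T7 (T3 g) = T3 (iter n T7 g).
  by elim: n => [|n IH] //; rewrite !iterS IH T3_T7.
have comm m g n : iter n T7 (iter m T3 g) = iter m T3 (iter n T7 g).
  by elim: m => [|m IH] //; rewrite !iterS comm1 IH.
by rewrite /mono_act comm -!iterD.
Qed.

Lemma mono_act_additive i j : additive_map (mono_act i j).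
Proof.
have iter_additive (T : ps -> ps) n : additive_map T -> additive_map (iter n T).
  move=> [T0 TD]; split; first by elim: n => [|n IH] //; rewrite iterS IH.
  by move=> f g; elim: n => [|n IH] //; rewrite !iterS IH TD.
have [a0 aD] := iter_additive _ i T3_additive; have [b0 bD] := iter_additive _ j T7_additive.
by split=> [|f g]; rewrite /mono_act ?b0 ?a0 // bD aD.
Qed.

Lemma mono_act_span d i j f : span (d + (i + j)) f -> span d (mono_act i j f).
Proof.
move=> h; have h7 : span (d + i) (iter j T7 f).
  elim: j f h => [|j IH] f h; first by rewrite addn0 in h.
  by rewrite iterSr; apply/IH/T7_span; apply: span_leq h; lia.
rewrite /mono_act; elim: i (iter j T7 f) h7 {h} => [|i IH] g h; first by rewrite addn0 in h.
by rewrite iterSr; apply/IH/T3_span; apply: span_leq h; lia.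
Qed.

Lemma mono_act_eq0 d i j f : span d f -> d <= i + j -> mono_act i j f = 0.
Proof. by move=> h le_d; apply/span0/mono_act_span; apply: span_leq h; rewrite add0n. Qed.

Lemma T37_iterE n f : iter n T37 f = mono_act n n f.
Proof.
elim: n f => [|n IH] f //; rewrite iterSr IH (_ : T37 f = mono_act 1 1 f) // mono_act_comp.
by rewrite !addn1.
Qed.

Lemma basis_Wa c : in_Wa (basis c).
Proof. by exists [:: idx c]; rewrite /= idx_idx_a big_seq1 Dk_basis. Qed.

(** A height bound shows that some value meets the specification of the [epsilon] in [nil_bound]. *)
Lemma nil_boundP d w i j : span d w -> nil_bound w <= i + j -> mono_act i j w = 0.
Proof.
move=> h; apply: (epsilon_spec (inhabits 0%N)
  (fun N => forall i j, N <= i + j -> mono_act i j w = pzero)).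
by exists d => k l; apply: mono_act_eq0.
Qed.

Lemma actE P w : act P w = \big[padd/pzero]_(i < nil_bound w) \big[padd/pzero]_(j < nil_bound w)
  if P i j && (i + j < nil_bound w) then mono_act i j w else 0.
Proof.
have ev n I (r : seq I) (E : I -> ps) :
  (\big[padd/pzero]_(i <- r) E i) n = \big[addb/false]_(i <- r) E i n.
  by elim: r => [|i r IH]; rewrite ?big_nil // !big_cons -IH.
apply: functional_extensionality => n; rewrite /act ev; apply: eq_bigr => i _.
rewrite ev; apply: eq_bigr => j _.
by case: (P i j); case: (_ < _).
Qed.

Lemma mono_act_act a b P w : mono_act a b (act P w) =
  \big[padd/pzero]_(i < nil_bound w) \big[padd/pzero]_(j < nil_bound w)
    if P i j && (i + j < nil_bound w) then mono_act (a + i) (b + j) w else 0.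
Proof.
have [m0 mD] := mono_act_additive a b; rewrite actE.
rewrite (big_morph _ mD m0); apply: eq_bigr => i _.
rewrite (big_morph _ mD m0); apply: eq_bigr => j _.
by case: ifP => _ //; rewrite mono_act_comp.
Qed.

(** Least total degree and, within it, least power of X; every other term of that degree then has X
    to a higher power. *)
Lemma lowest_term (P : ps2) : (exists i j, P i j) ->
  exists i j, P i j /\ forall i' j', P i' j' ->
    i + j < i' + j' \/ exists e, e <= j /\ (i' = i + e /\ j' = j - e)%N.
Proof.
move=> [i1 [j1 h1]].
have ex1 : exists d, [exists i : 'I_d.+1, P i (d - i)%N].
  exists (i1 + j1)%N; apply/existsP; exists (inord i1).
  by rewrite inordK ?addKn // ltnS leq_addr.
case: (ex_minnP ex1) => d /existsP[i0 h0] dmin {i1 j1 h1 ex1}.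
have ex2 : exists i, (i <= d) && P i (d - i)%N.
  by exists i0; rewrite h0 andbT -ltnS.
case: (ex_minnP ex2) => i /andP[le_i Pi] imin {i0 h0 ex2}.
exists i, (d - i)%N; split=> // i' j' h.
have hd : d <= i' + j'.
  apply: dmin; apply/existsP; exists (inord i').
  by rewrite inordK ?addKn // ltnS leq_addr.
have [lt|ge] := ltnP d (i' + j'); first by left; lia.
have e : (j' = d - i')%N by lia.
have hi : i <= i' by apply: imin; rewrite -e h andbT; lia.
right; exists (i' - i)%N; split; lia.
Qed.

Section Witness.
Variables d n : nat.
Let H : nat := 2 ^ n.+1.
Let v : ps := shift (spread d) (basis (seed n)).

Lemma witness_Wa : in_Wa v.
Proof. by rewrite /v shift_basis; apply: basis_Wa. Qed.

Lemma witness_span : span (2 * d + H).+1 v.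
Proof.
rewrite /v shift_basis; apply: span_basis.
have := heightD (4 * spread d) (seed n).
by rewrite height4 height_spread height_seed -/H ltnS.
Qed.

(** p^d sends v to theta up to an error of height less than H, which the remaining monomial of
    degree H kills. *)
Lemma witness_mono e : e <= H ->
  mono_act (d + e) (d + H - e) v = mono_act e (H - e) (basis (seed n)).
Proof.
move=> le_e; rewrite (_ : (d + H - e = (H - e) + d)%N) 1?(_ : (d + e = e + d)%N); try lia.
rewrite -mono_act_comp -T37_iterE; apply: padd_eq0.
rewrite -(proj2 (mono_act_additive _ _)).
have h0 : T37 (basis (seed n)) = 0 by rewrite /T37 T3_T7 T3_seed (proj1 T7_additive).
have h := T37_iter_spread d h0; apply: mono_act_eq0 h _.
by rewrite height_seed subnKC.
Qed.

Lemma witness_mono_pos e : 0 < e <= H -> mono_act (d + e) (d + H - e) v = 0.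
Proof.
move=> /andP[]; case: e => [//|e] _ le_e; rewrite witness_mono //.
have e0 f : mono_act e.+1 (H - e.+1) f = mono_act e (H - e.+1) (T3 f).
  by rewrite -[T3 f]/(mono_act 1 0 f) mono_act_comp addn1 addn0.
by rewrite e0 T3_seed (proj1 (mono_act_additive _ _)).
Qed.

End Witness.

Theorem theorem5p14 :
  forall P : ps2, (forall w : ps, in_Wa w -> act P w = pzero) ->
  forall i j : nat, P i j = false.
Proof.
move=> P hP i1 j1; apply/negbTE/negP => h1.
have [i [j [Pij low]]] : exists i j, P i j /\ forall i' j', P i' j' ->
    i + j < i' + j' \/ exists e, e <= j /\ (i' = i + e /\ j' = j - e)%N.
  by apply: lowest_term; exists i1, j1.
(* Seed index d gives H = 2^(d+1) > d, enough to cover every shift e <= j within the lowest form. *)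
pose d := (i + j)%N; pose v := shift (spread d) (basis (seed d)).
pose H := (2 ^ d.+1)%N.
have dH : d < H by apply: ltn_trans (ltnSn d) (ltn_expl _ _).
(* Multiplying by X^j Y^(H+i) moves the selected term to X^d Y^(d+H), the one monomial of its degree
   among those met that does not kill v. *)
have lead_term : mono_act (j + i) (H + i + j) v <> 0.
  have -> : (j + i = d + 0)%N by lia.
  have -> : (H + i + j = d + H - 0)%N by lia.
  rewrite witness_mono // subn0 => /(congr1 (fun f : ps => f 1%N)).
  by rewrite [LHS]T7_seed.
have vW : in_Wa v by apply: witness_Wa.
have vspan := witness_span d d.
(* The selected term survives the truncation in [act], since X^i Y^j does not kill v. *)
have ltN : i + j < nil_bound v.
  rewrite ltnNge; apply/negP => leN; apply: lead_term.
  by rewrite -mono_act_comp (nil_boundP vspan leN) (proj1 (mono_act_additive _ _)).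
have lt_i : i < nil_bound v by lia.
have lt_j : j < nil_bound v by lia.
apply: lead_term; transitivity (mono_act j (H + i) (act P v)); last first.
  by rewrite hP // (proj1 (mono_act_additive _ _)).
have zero i' j' : P i' j' -> (i', j') <> (i, j) -> mono_act (j + i') (H + i + j') v = 0.
  move=> h ne; case: (low _ _ h) => [lt|[e [le_e [ei ej]]]].
    by apply: mono_act_eq0 vspan _; lia.
  have e0 : 0 < e.
    by rewrite lt0n; apply/eqP => e0; apply: ne; congr pair; lia.
  have -> : (j + i' = d + e)%N by lia.
  have -> : (H + i + j' = d + H - e)%N by lia.
  by apply: witness_mono_pos; rewrite e0; lia.
rewrite mono_act_act (bigD1 (Ordinal lt_i)) //= (bigD1 (Ordinal lt_j)) //= Pij ltN /=.
rewrite big1 => [|j' ne]; last first.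
  case: ifP => // /andP[h _]; apply: zero h _ => -[e].
  by case/eqP: ne; apply/val_inj.
rewrite big1 => [|i' ne]; first by ring.
rewrite big1 // => j' _; case: ifP => // /andP[h _]; apply: zero h _ => -[e _].
by case/eqP: ne; apply/val_inj.
Qed.
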